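(* Let $\Omega\subset\mathbb R^2$ be a simply connected polygonal domain (with boundary), let $\triangle$ be a regular triangulation of $\Omega$, let $d\ge1$, and let no essential boundary conditions be imposed. Let $V_h^0=\ker C_0$, $V^1_{h,\mathrm{curl}}=\ker C_1^{\mathrm{curl}}$, $V_h^2=S^{-1}_{d-1}(\triangle)$, and let $D_{0,h}=D_0^{\mathrm{br}}|_{V_h^0}$, $D_{1,h}=D_1|_{V^1_{h,\mathrm{curl}}}$. Then the sequence $$\mathbb R\hookrightarrow V_h^0\xrightarrow{D_{0,h}}V^1_{h,\mathrm{curl}}\xrightarrow{D_{1,h}}V_h^2\to0$$ is exact: $\ker D_{0,h}$ consists of the constants, $\ker D_{1,h}=\operatorname{range}D_{0,h}$, and $D_{1,h}V^1_{h,\mathrm{curl}}=V_h^2$. For a polygonal domain $\Omega$ with holes (not necessarily simply connected), the dimension of $\ker D_{1,h}/\operatorname{range}D_{0,h}$ equals the first Betti number of $\Omega$.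
   Context: Triangulation: $\triangle$ is a finite set of nondegenerate closed triangles whose union is $\overline\Omega$, with $\Omega$ the (connected) interior of that union; any two distinct triangles meet in the empty set, a common vertex, or a common edge. An interior edge is an edge shared by two triangles $T^+,T^-$. $\mathcal P_m(T)$ is the space of polynomials of total degree at most $m$ on $T$; $S^{-1}_m(\triangle)$ is the space of families $(s|_T)_{T\in\triangle}$ with $s|_T\in\mathcal P_m(T)$, no continuity being imposed across edges. Each interior edge $e$ has a fixed orientation with unit tangent $t_e$ pointing from its first endpoint $a$ to its second endpoint $b$. The degree-$m$ coefficient vector on $e$ of a polynomial $p$ of degree at most $m$ is the vector $(r_0,\dots,r_m)$ with $p(a+t(b-a))=\sum_j r_j\binom mj t^j(1-t)^{m-j}$. For $u\in S^{-1}_{d+1}(\triangle)$, $C_{0,e}u$ is the degree-$(d+1)$ coefficient vector on $e$ of $u|_{T^+}$ minus that of $u|_{T^-}$. For $v\in[S^{-1}_d(\triangle)]^2$, $C^{\mathrm{curl}}_{1,e}v$ is the degree-$d$ coefficient vector on $e$ of $v|_{T^+}\cdot t_e$ minus that of $v|_{T^-}\cdot t_e$. $C_0$ and $C_1^{\mathrm{curl}}$ are obtained by stacking these blocks over all interior edges; thus $V_h^0$ is the space of continuous piecewise polynomials of degree $d+1$ and $V^1_{h,\mathrm{curl}}$ the space of piecewise $[\mathcal P_d]^2$ fields with single-valued tangential component on interior edges. The broken gradient $D_0^{\mathrm{br}}:S^{-1}_{d+1}(\triangle)\to[S^{-1}_d(\triangle)]^2$ and broken curl $D_1:[S^{-1}_d(\triangle)]^2\to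 S^{-1}_{d-1}(\triangle)$ act triangle by triangle, with $\mathrm{curl}\,v=\partial_xv^y-\partial_yv^x$. *)

(* Defs.v *)
From HB Require Import structures.
From mathcomp Require Import all_boot all_order all_algebra.
From mathcomp Require Import all_classical all_reals all_analysis.
(* The notations of multinomials clash with those of all_analysis. *)
From mathcomp.multinomials Require Import (canonicals, coercions) freeg mpoly.
Import Order.TTheory GRing.Theory Num.Theory.
Import numFieldNormedType.Exports.

Set Implicit Arguments.
Unset Strict Implicit.
Unset Printing Implicit Defensive.

Local Open Scope classical_set_scope.
Local Open Scope ring_scope.

(** * Dimension of a quotient *)

(* [dim (Z / B) = n], for linear subspaces [B] of [Z]: the classes of [f] form a
   basis of the quotient. *)
Definition quotient_dim (R : realType) (V : lmodType R) (Z B : set V)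
    (n : nat) : Prop :=
  B `<=` Z /\
  exists f : 'I_n -> V, (forall i, Z (f i)) /\
    forall z, Z z -> exists! c : 'rV[R]_n, B (z - \sum_i c 0 i *: f i).

(** * Simple connectedness and the first Betti number *)

Definition simply_connected (R : realType) (X : topologicalType) : Prop :=
  [/\ [set: X] !=set0,
      forall x y : X, exists g : R -> X,
        [/\ {within `[0, 1], continuous g}, g 0 = x & g 1 = y]
    & forall g : R -> X, {within `[0, 1], continuous g} -> g 0 = g 1 ->
        exists H : R * R -> X,
          [/\ {within `[0, 1] `*` `[0, 1], continuous H},
              forall t, t \in `[0, 1] -> H (0, t) = g t,
              forall t, t \in `[0, 1] -> H (1, t) = g 0
            & forall s, s \in `[0, 1] -> H (s, 0) = g 0 /\ H (s, 1) = g 0]].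

Definition stdsimplex (R : realType) (k : nat) : set 'rV[R]_k.+1 :=
  [set x | (forall i, 0 <= x 0 i) /\ \sum_i x 0 i = 1].
Arguments stdsimplex : clear implicits.

Section singular_homology.
Variables (R : realType) (X : topologicalType).

Definition insert0 (k : nat) (i : 'I_k.+2) (x : 'rV[R]_k.+1) : 'rV[R]_k.+2 :=
  \row_j oapp (x 0) 0 (unlift i j).

Lemma insert0_stdsimplex (k : nat) (i : 'I_k.+2) (x : stdsimplex R k) :
  insert0 i (set_val x) \in stdsimplex R k.+1.
Proof.
have [x0 x1] := set_valP x; apply/mem_set; split=> [j|].
  by rewrite mxE; case: unliftP => [l|] _ /=.
rewrite (bigD1_ord i) //= mxE unlift_none /= add0r -[RHS]x1.
by apply: eq_bigr => j _; rewrite mxE liftK.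
Qed.

Definition face_map (k : nat) (i : 'I_k.+2) (x : stdsimplex R k) :
  stdsimplex R k.+1 := SigSub (insert0_stdsimplex i x).

Lemma face_map_continuous (k : nat) (i : 'I_k.+2) : continuous (face_map i).
Proof.
apply: continuous_comp_initial => x.
apply: (@continuous_comp _ _ _ set_val (insert0 i)).
  exact: initial_continuous.
have Fx : Filter (nbhs (set_val x : 'rV[R]_k.+1)) by exact: nbhs_filter.
apply/cvg_ballP => e e0; apply: filterS (nbhsx_ballx (set_val x) e e0) => y.
move=> [_ xy]; split=> // a b; rewrite !mxE.
by case: unliftP => [l|] _ /=; [exact: xy|exact: ballxx].
Qed.

Definition singular_simplex (k : nat) : choiceType :=
  set_type [set s : stdsimplex R k -> X | continuous s].

Lemma face_continuous (k : nat) (i : 'I_k.+2) (s : singular_simplex k.+1) :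
  (set_val s \o face_map i) \in [set s' : stdsimplex R k -> X | continuous s'].
Proof.
apply/mem_set => x; apply: continuous_comp; first exact: face_map_continuous.
exact: (set_valP s).
Qed.

Definition face (k : nat) (i : 'I_k.+2) (s : singular_simplex k.+1) :
  singular_simplex k := SigSub (face_continuous i s).

(* the free R-module {freeg singular_simplex k / R} *)
Definition singular_chain (k : nat) : lmodType R :=
  freeg.FreegDefs.type_of (Phant R) (Phant (singular_simplex k)).

Definition chain_of (k : nat) (s : singular_simplex k) : singular_chain k :=
  freeg.Freeg [:: (1 : R, s)].

Definition boundary (k : nat) : singular_chain k.+1 -> singular_chain k :=
  freeg.fglift (fun s : singular_simplex k.+1 =>
    \sum_(i < k.+2) (-1) ^+ i *: chain_of (face i s)).

(* dim H_1(X; R) = n *)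
Definition first_betti_number (n : nat) : Prop :=
  quotient_dim [set z : singular_chain 1 | boundary z = 0]
    (range (@boundary 1)) n.

End singular_homology.

(** * Triangulations *)

Section triangulation.
Variable R : realType.
Local Notation point := 'rV[R]_2.

Definition segment (a b : point) : set point :=
  [set (1 - t) *: a + t *: b | t in `[0, 1]].

(* The three rows of [V] are the vertices. *)
Definition closed_triangle (V : 'M[R]_(3, 2)) : set point :=
  [set l *m V | l in stdsimplex R 2].

Definition nondegenerate (V : 'M[R]_(3, 2)) : bool :=
  row_free (row_mx V (const_mx 1 : 'cV[R]_3)).

Definition is_vertex (V : 'M[R]_(3, 2)) (p : point) : Prop :=
  exists i, p = row i V.

Definition is_edge (V : 'M[R]_(3, 2)) (E : set point) : Prop :=
  exists i j, i != j /\ E = segment (row i V) (row j V).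

Record triangulation := Triangulation {
  tri : finType;
  vtx : tri -> 'M[R]_(3, 2);
  tri_nondegenerate : forall T, nondegenerate (vtx T);
  tri_conforming : forall T T', T != T' ->
    let I := closed_triangle (vtx T) `&` closed_triangle (vtx T') in
    [\/ I = set0,
        exists p, [/\ is_vertex (vtx T) p, is_vertex (vtx T') p & I = [set p]]
      | exists E, [/\ is_edge (vtx T) E, is_edge (vtx T') E & I = E]] }.

Definition triangulates (M : triangulation) (Omega : set point) : Prop :=
  let U := \bigcup_(T : tri M) closed_triangle (vtx T) in
  [/\ Omega !=set0, connected Omega, Omega = interior U & closure Omega = U].

Definition interior_edge (M : triangulation) : choiceType :=
  set_type [set E | exists T T' : tri M,
    [/\ T != T', is_edge (vtx T) E & is_edge (vtx T') E]].

(* The fixed choices on each interior edge: first and second endpoint, and which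
   of the two adjacent triangles is T^+. *)
Record edge_labelling (M : triangulation) := EdgeLabelling {
  src : interior_edge M -> point;
  tgt : interior_edge M -> point;
  tri_plus : interior_edge M -> tri M;
  tri_minus : interior_edge M -> tri M;
  src_tgt : forall e, segment (src e) (tgt e) = set_val e;
  tri_plus_minus : forall e, tri_plus e != tri_minus e;
  tri_plus_edge : forall e, is_edge (vtx (tri_plus e)) (set_val e);
  tri_minus_edge : forall e, is_edge (vtx (tri_minus e)) (set_val e) }.

Definition unit_tangent (a b : point) : point :=
  (Num.sqrt (\sum_i (b - a) 0 i ^+ 2))^-1 *: (b - a).

End triangulation.

(** * The broken spaces and the discrete de Rham sequence *)

Section spaces.
Variables (R : realType) (M : triangulation R).
Local Notation poly := (mpoly.mpoly 2 R).

Definition eval (p : poly) (x : 'rV[R]_2) : R :=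
  mpoly.meval (fun i => x 0 i) p.

(* Total degree at most [m]; [msize] is the total degree plus one, or 0 for the
   zero polynomial. *)
Definition deg_le (m : nat) (p : poly) : Prop :=
  (mpoly.mmeasure mpoly.mdeg p <= m.+1)%N.

Definition broken (m : nat) : set {ffun tri M -> poly} :=
  [set u | forall T, deg_le m (u T)].

Definition broken_field (m : nat) : set {ffun tri M -> poly * poly} :=
  [set v | forall T, deg_le m (v T).1 /\ deg_le m (v T).2].

Definition is_coef (m : nat) (a b : 'rV[R]_2) (p : poly) (r : 'rV[R]_m.+1) :
  Prop := forall t : R, eval p (a + t *: (b - a)) =
    \sum_(j < m.+1) r 0 j * 'C(m, j)%:R * t ^+ j * (1 - t) ^+ (m - j).

(* For [p] of degree at most [m], the unique [r] with [is_coef m a b p r]. *)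
Definition coef (m : nat) (a b : 'rV[R]_2) (p : poly) : 'rV[R]_m.+1 :=
  xget 0 [set r | is_coef a b p r].

Definition dot (v : poly * poly) (t : 'rV[R]_2) : poly :=
  t 0 0 *: v.1 + t 0 1 *: v.2.

Definition grad (u : {ffun tri M -> poly}) : {ffun tri M -> poly * poly} :=
  [ffun T => (mpoly.mderiv 0 (u T), mpoly.mderiv 1 (u T))].

Definition curl (v : {ffun tri M -> poly * poly}) : {ffun tri M -> poly} :=
  [ffun T => mpoly.mderiv 0 (v T).2 - mpoly.mderiv 1 (v T).1].

Definition const (c : R) : {ffun tri M -> poly} := [ffun=> mpoly.mpolyC 2 c].

Variables (L : edge_labelling M) (d : nat).

Definition C0 (u : {ffun tri M -> poly}) (e : interior_edge M) :
    'rV[R]_(d.+1).+1 :=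
  coef d.+1 (src L e) (tgt L e) (u (tri_plus L e))
  - coef d.+1 (src L e) (tgt L e) (u (tri_minus L e)).

Definition C1curl (v : {ffun tri M -> poly * poly}) (e : interior_edge M) :
    'rV[R]_d.+1 :=
  let t := unit_tangent (src L e) (tgt L e) in
  coef d (src L e) (tgt L e) (dot (v (tri_plus L e)) t)
  - coef d (src L e) (tgt L e) (dot (v (tri_minus L e)) t).

Definition V0 : set {ffun tri M -> poly} :=
  [set u | broken d.+1 u /\ forall e, C0 u e = 0].

Definition V1curl : set {ffun tri M -> poly * poly} :=
  [set v | broken_field d v /\ forall e, C1curl v e = 0].

(* used for [1 <= d] only *)
Definition V2 : set {ffun tri M -> poly} := broken d.-1.

Definition ker_grad : set {ffun tri M -> poly} :=
  [set u | V0 u /\ grad u = 0].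

Definition range_grad : set {ffun tri M -> poly * poly} := grad @` V0.

Definition ker_curl : set {ffun tri M -> poly * poly} :=
  [set v | V1curl v /\ curl v = 0].

End spaces.

(* Main.v *)
(* A curl-free field [v] has on each triangle a potential, unique up to a
   constant.  Its periods, the jumps c(T,T') of the potentials between triangles
   meeting in Omega, form a cocycle: c(T,T') + c(T',T'') = c(T,T'') for triangles
   with a common point in Omega; and [v] is a gradient iff c(T,T') = k(T') - k(T)
   for some k.  Up to such terms every cocycle is realized by a broken gradient
   of piecewise linear functions, whose jumps are prescribed vertex by vertex.

   A cocycle is integrated along a path p in Omega by gluing local primitives of
   the jumps c(T(p(u)),T(p(v))), where T(x) is a chosen triangle containing x.
   Subdivision of the square shows that this integral vanishes on boundaries and
   is invariant under homotopy.  If Omega is simply connected, all cocycles are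
   therefore of the form k(T') - k(T).  In general, every cycle is homologous to a
   combination of two-segment paths connecting the centers of meeting triangles,
   and duality for matrices shows that the pairing of curl-free fields modulo
   gradients with cycles modulo boundaries is perfect.

   The curl can be prescribed on a triangle T by the field lam_a beta grad lam_b,
   at the price of some curl on the neighbour across the edge ab.  A nonempty set
   of triangles is never closed under taking all three neighbours (consider a
   vertex farthest from the origin), so the error can be pushed out of Omega. *)
From HB Require Import structures.
Require Import Defs.
From mathcomp Require Import all_boot all_order all_algebra.
From mathcomp Require Import all_classical all_reals all_analysis.

From mathcomp.multinomials Require Import (canonicals, coercions) freeg mpoly.
Import Order.TTheory GRing.Theory Num.Theory.
Import numFieldNormedType.Exports.
From mathcomp Require Import ring lra.
Import Defs.

Set Implicit Arguments.
Unset Strict Implicit.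
Unset Printing Implicit Defensive.

Local Open Scope classical_set_scope.
Local Open Scope ring_scope.

(** * Dimensions of quotients and perfect pairings *)

(** The obstacle is the boundary of [Omega]. The domain is the open interior of the union, so
    triangles sharing a boundary vertex need not meet in [Omega]: no jump is prescribed between
    them, and their star may fall into several fans. Hence all notions refer to common points in
    [Omega], and the combinatorics around a vertex rests on [fan_end]: it breaks a boundary star at
    a free edge, shows that an interior star is connected, and finds the outer edge through which a
    curl error leaves. A continuous path may cross edges infinitely often, so its integral cannot be
    a finite sum over crossings. But near a point x only triangles containing x occur, and among
    them the cocycle identity holds at x; jumps between nearby parameters are therefore increments
    of a function. Finiteness is proved for the fields, where finitely many periods decide; the
    pairing transports the dimension to the infinite-dimensional chains. Its perfectness is a double
    annihilator argument used twice: triple relations against cocycles, coboundaries against weights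
    without boundary. *)

Section quotient_dimension.
Variable R : realType.

Definition lin_closed (V : lmodType R) (Z : set V) : Prop :=
  Z 0 /\ forall a x y, Z x -> Z y -> Z (a *: x + y).

Lemma lin_closed_sum (V : lmodType R) (Z : set V) n (c : 'rV[R]_n) (f : 'I_n -> V) :
  lin_closed Z -> (forall i, Z (f i)) -> Z (\sum_i c 0 i *: f i).
Proof.
move=> [Z0 ZD] Zf; elim/big_rec: _ => // i x _ Zx; exact: ZD.
Qed.

Lemma lin_closedB (V : lmodType R) (Z : set V) x y :
  lin_closed Z -> Z x -> Z y -> Z (x - y).
Proof. by move=> [Z0 ZD] Zx Zy; rewrite addrC -scaleN1r; apply: ZD. Qed.

(** Families in [Z] with independent images have length at most [n]; in one of maximal length, a
    vector whose image left the span could be added. *)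
Lemma spanning_free_family (V : lmodType R) (Z : set V) n (Psi : V -> 'rV[R]_n) :
  exists r (f : 'I_r -> V), [/\ forall i, Z (f i),
    row_free (\matrix_i Psi (f i)) &
    forall z, Z z -> (Psi z <= \matrix_i Psi (f i))%MS].
Proof.
pose P r := `[< exists f : 'I_r -> V, (forall i, Z (f i)) /\
    row_free (\matrix_i Psi (f i)) >].
have P0 : exists r, P r.
  exists 0%N; apply/asboolP; exists (fun i : 'I_0 => 0); split; first by case.
  by rewrite /row_free eqn_leq rank_leq_row.
have Pn r : P r -> (r <= n)%N.
  by move=> /asboolP[f [_]] /eqP {1}<-; exact: rank_leq_col.
have [r /asboolP[f [Zf ff]] rmax] := ex_maxnP P0 Pn.
exists r, f; split=> // z Zz; apply/negPn/negP => nz.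
suff /rmax : P r.+1 by rewrite ltnn.
pose g (i : 'I_r.+1) := oapp f z (unlift ord0 i).
apply/asboolP; exists g; split.
  by move=> i; rewrite /g; case: unliftP => [j|] _ /=.
have -> : \matrix_i Psi (g i) = col_mx (Psi z) (\matrix_i Psi (f i)) :> 'M[R]_(1 + r, n).
  apply/matrixP => i j; rewrite !mxE; case: splitP => k.
    rewrite ord1 => ik; have -> : i = ord0 by apply/val_inj.
    by rewrite /g unlift_none /=.
  move=> ik; have -> : i = lift ord0 k by apply/val_inj; rewrite /= ik /bump.
  by rewrite /g liftK /= mxE.
have pz : Psi z != 0 by apply: contraNneq nz => ->; exact: sub0mx.
suff : \rank (col_mx (Psi z) (\matrix_i Psi (f i))) == r.+1 by [].
have rf : \rank (\matrix_i Psi (f i)) = r by apply/eqP.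
have rz : \rank (Psi z) = 1%N by rewrite rank_rV pz.
rewrite -addsmxE addsmxC mxrank_disjoint_sum ?rf ?rz ?addn1 //.
apply/eqP/negPn/negP => cap0; case/negP: nz.
have : (\rank (Psi z) <= \rank (\matrix_i Psi (f i) :&: Psi z)%MS)%N.
  by rewrite rz lt0n mxrank_eq0.
rewrite (geq_leqif (mxrank_leqif_sup (capmxSr _ _))) => /submx_trans; apply.
exact: capmxSl.
Qed.

(** Since [B] is the kernel of [Psi] on [Z], the quotient is isomorphic to the image, and lifts of a
    basis of the image give a basis of classes. *)
Lemma quotient_dim_ker (V : lmodType R) (Z B : set V) n r
    (Psi : {linear V -> 'rV[R]_n}) (f : 'I_r -> V) :
  lin_closed Z -> B `<=` Z -> (forall z, Z z -> B z <-> Psi z = 0) ->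
  (forall i, Z (f i)) -> row_free (\matrix_i Psi (f i)) ->
  (forall z, Z z -> (Psi z <= \matrix_i Psi (f i))%MS) ->
  quotient_dim Z B r.
Proof.
move=> Zlin BZ BP Zf ff span; split=> //; exists f; split=> // z Zz.
have PsiE (c : 'rV_r) : Psi (z - \sum_i c 0 i *: f i) =
    Psi z - c *m \matrix_i Psi (f i).
  rewrite linearB linear_sum mulmx_sum_row /=; congr (_ - _).
  by apply: eq_bigr => i _; rewrite linearZ rowK.
have Zc (c : 'rV_r) : Z (z - \sum_i c 0 i *: f i).
  by apply: lin_closedB => //; exact: lin_closed_sum.
have /submxP[c cE] := span _ Zz.
exists c; split=> [|c' /(BP _ (Zc _))].
  by apply/BP => //; rewrite PsiE cE subrr.
rewrite PsiE cE => /eqP; rewrite subr_eq0 => /eqP.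
exact: row_free_inj.
Qed.

Lemma quotient_dim_finite (V : lmodType R) (Z B : set V) n
    (Psi : {linear V -> 'rV[R]_n}) :
  lin_closed Z -> B `<=` Z -> (forall z, Z z -> B z <-> Psi z = 0) ->
  exists b, quotient_dim Z B b.
Proof.
move=> Zlin BZ BP; have [r [f [Zf ff span]]] := spanning_free_family Z Psi.
by exists r; exact: quotient_dim_ker span.
Qed.

(** Pairing with a basis [w] of the second quotient embeds the first one into row vectors of length
    [b]. If the image were a proper subspace, a vector orthogonal to it would give a combination of
    the [w i] orthogonal to [ZV], hence in [BW], against independence. Linearity in the second
    variable is asked on [ZW] only: integrals of periods add up when the periods are cocycles, that
    is, for curl-free fields. *)
Lemma quotient_dim_pairing (V W : lmodType R) (ZV BV : set V) (ZW BW : set W)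
    (form : V -> W -> R) b :
  lin_closed ZV -> BV `<=` ZV -> lin_closed ZW -> BW 0 ->
  (forall w, linear_for *%R (form^~ w)) ->
  (forall z a w w', ZW w -> ZW w' ->
    form z (a *: w + w') = a * form z w + form z w') ->
  (forall z, ZV z -> BV z <-> forall w, ZW w -> form z w = 0) ->
  (forall w, ZW w -> BW w <-> forall z, ZV z -> form z w = 0) ->
  quotient_dim ZW BW b -> quotient_dim ZV BV b.
Proof.
move=> ZVl BVZ ZWl BW0 formV formW BVP BWP [BWZ [w [Zw wP]]].
have form0 z : form z 0 = 0.
  have ZW0 : ZW 0 by case: ZWl.
  apply: (addrI (form z 0)); rewrite addr0.
  by have := formW z 1 0 0 ZW0 ZW0; rewrite scale1r addr0 mul1r.
have form_sum z (c : 'rV[R]_b) :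
    form z (\sum_i c 0 i *: w i) = \sum_i c 0 i * form z (w i).
  suff [] : form z (\sum_i c 0 i *: w i) = \sum_i c 0 i * form z (w i) /\
            ZW (\sum_i c 0 i *: w i) by [].
  elim/big_rec2: _ => [|i x y _ [<- ZWx]]; first by split=> //; case: ZWl.
  by split; [rewrite formW|apply ZWl].
pose Psi z : 'rV[R]_b := \row_i form z (w i).
have PsiL : linear Psi.
  by move=> a x y; apply/rowP => i; rewrite !mxE formV.
pose PsiM := GRing.isLinear.Build _ _ _ _ Psi PsiL.
pose PsiLin : {linear V -> 'rV[R]_b} := HB.pack Psi PsiM.
have [r [f [Zf ff span]]] := spanning_free_family ZV PsiLin.
have rb : r = b.
  apply/eqP; rewrite eqn_leq -{1}(eqP ff) rank_leq_col /= leqNgt.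
  apply/negP => rb.
  have : kermx (\matrix_i Psi (f i))^T != 0.
    rewrite kermx_eq0 /row_free mxrank_tr; apply: contraL rb => /eqP <-.
    by rewrite -leqNgt rank_leq_row.
  move=> /rowV0Pn[c] /sub_kermxP cker c0.
  have orth z : ZV z -> form z (\sum_i c 0 i *: w i) = 0.
    move=> /span /submxP[e eE].
    have -> : form z (\sum_i c 0 i *: w i) = (Psi z *m c^T) 0 0.
      by rewrite form_sum mxE; apply: eq_bigr => i _; rewrite !mxE mulrC.
    rewrite [Psi z]eE -mulmxA -[X in _ *m X]trmxK trmx_mul trmxK.
    have -> : \matrix_i PsiLin (f i) = \matrix_i Psi (f i) by [].
    by rewrite cker trmx0 mulmx0 mxE.
  have ZWc := lin_closed_sum c ZWl Zw.
  have ZW0 : ZW 0 by case: ZWl.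
  (* The class of 0 has unique coordinates, but both 0 and [- c] qualify. *)
  have [c1 [_ c1P]] := wP _ ZW0.
  have e1 : c1 = 0.
    apply: c1P; rewrite big1 ?subr0 // => i _; by rewrite mxE scale0r.
  have e2 : c1 = - c.
    apply: c1P; rewrite sub0r -sumrN.
    rewrite (eq_bigr (fun i => c 0 i *: w i)); last first.
      by move=> i _; rewrite mxE scaleNr opprK.
    by apply/BWP.
  by move: c0; rewrite -oppr_eq0 -e2 e1 eqxx.
rewrite rb in f Zf ff span *.
apply: (@quotient_dim_ker _ _ _ _ _ PsiLin f) => // z ZVz.
rewrite (BVP _ ZVz); split=> [fz|/rowP Pz v ZWv].
  by apply/rowP => i; rewrite !mxE fz.
have [c [BWc _]] := wP _ ZWv.
have /(BWP _ (BWZ _ BWc)) /(_ _ ZVz) fz := BWc.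
have Zc := lin_closed_sum c ZWl Zw.
have : form z v = form z (1 *: (v - \sum_i c 0 i *: w i) + \sum_i c 0 i *: w i).
  by rewrite scale1r subrK.
rewrite formW; [|exact: BWZ|exact: Zc].
rewrite fz mulr0 add0r form_sum => ->; apply: big1 => i _.
by have := Pz i; rewrite !mxE => ->; rewrite mulr0.
Qed.

(** Finite-dimensional double annihilator: the columns of the cokernel matrix are vectors killed by
    [A], and they detect membership in its row space. *)
Lemma submx_dual (F : fieldType) m n (A : 'M[F]_(m, n)) (u : 'rV[F]_n) :
  (forall c : 'rV[F]_n, A *m c^T = 0 -> u *m c^T = 0) -> (u <= A)%MS.
Proof.
move=> H; rewrite submxE; apply/eqP/matrixP => i j; rewrite ord1 mxE.
have /H : A *m ((cokermx A *m delta_mx j 0 : 'cV_n)^T)^T = 0.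
  by rewrite trmxK mulmxA mulmx_coker mul0mx.
by rewrite trmxK mulmxA -colE => /colP/(_ 0); rewrite !mxE.
Qed.

End quotient_dimension.

(** * Bivariate polynomials *)

Section polynomials.
Variable R : realType.
Local Notation poly2 := (mpoly.mpoly 2 R).
Local Notation degree_bound s p := (mpoly.mmeasure mpoly.mdeg p <= s)%N.
Implicit Types (p q : poly2) (s : nat) (a w x : 'rV[R]_2).

Lemma ord2P (i : 'I_2) : i = 0 \/ i = 1.
Proof.
by case: i => -[|[|//]] ?; [left|right]; apply/val_inj.
Qed.

Definition coord_poly (i : 'I_2) : poly2 := mpoly.mpolyX R (mpoly.mnm1 i).

Definition dir_deriv w p : poly2 :=
  w 0 0 *: mpoly.mderiv 0 p + w 0 1 *: mpoly.mderiv 1 p.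

(** A degree bound here is a bound on the size, so [degree_bound s] means degree less than [s],
    shifted by one from [deg_le]. *)
Lemma degree_boundP s p :
  degree_bound s p <-> forall m, (s <= mpoly.mdeg m)%N -> mpoly.mcoeff m p = 0.
Proof.
split=> [ps m' sm|p0].
  by apply: mpoly.memN_msupp_eq0; apply: mpoly.msize_mdeg_ge; exact: leq_trans sm.
rewrite mpoly.msizeE; apply/bigmax_leqP_seq => m' mp _.
rewrite ltnNge; apply/negP => /p0/eqP; rewrite mpoly.mcoeff_eq0 => /negP; exact.
Qed.

Lemma degree_bound0 s : degree_bound s (0 : poly2).
Proof. by rewrite mpoly.mmeasure0. Qed.

Lemma degree_bound_lin s (c : R) p q : degree_bound s p -> degree_bound s q ->
  degree_bound s (c *: p + q).
Proof.
move=> /degree_boundP ps /degree_boundP qs; apply/degree_boundP => m' sm.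
by rewrite mpoly.mcoeffD mpoly.mcoeffZ ps // qs // mulr0 addr0.
Qed.

Lemma degree_boundD s p q : degree_bound s p -> degree_bound s q ->
  degree_bound s (p + q).
Proof. by move=> ps qs; rewrite -[p]scale1r; apply: degree_bound_lin. Qed.

Lemma degree_boundZ s (c : R) p : degree_bound s p -> degree_bound s (c *: p).
Proof.
move=> ps; rewrite -[c *: p]addr0.
by apply: degree_bound_lin => //; exact: degree_bound0.
Qed.

Lemma degree_boundB s p q : degree_bound s p -> degree_bound s q ->
  degree_bound s (p - q).
Proof.
by move=> ps qs; rewrite addrC -scaleN1r; apply: degree_bound_lin.
Qed.

Lemma degree_bound_sum s (I : Type) (r : seq I) (P : pred I) (F : I -> poly2) :
  (forall i, P i -> degree_bound s (F i)) -> degree_bound s (\sum_(i <- r | P i) F i).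
Proof.
move=> Fs; elim/big_ind: _ => //; [exact: degree_bound0|exact: degree_boundD].
Qed.

Lemma degree_boundM s t p q : degree_bound s.+1 p -> degree_bound t.+1 q ->
  degree_bound (s + t).+1 (p * q).
Proof.
move=> ps qt; have [->|p0] := eqVneq p 0; first by rewrite mul0r degree_bound0.
have [->|q0] := eqVneq q 0; first by rewrite mulr0 degree_bound0.
rewrite mpoly.msizeM // -subn1 leq_subLR add1n -addSn -addnS.
exact: leq_add.
Qed.

Lemma degree_boundX s k p : degree_bound s.+1 p -> degree_bound (k * s).+1 (p ^+ k).
Proof.
move=> ps; elim: k => [|k IH]; first by rewrite expr0 mpoly.msize1.
by rewrite exprS mulSn; apply: degree_boundM.
Qed.

Lemma degree_boundC (c : R) : degree_bound 1 (mpoly.mpolyC 2 c).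
Proof. by rewrite mpoly.mmeasureC; case: (c != 0). Qed.

Lemma degree_bound_coord (i : 'I_2) : degree_bound 2 (coord_poly i).
Proof. by rewrite mpoly.msizeX mpoly.mdeg1. Qed.

Lemma degree_bound_deriv s (i : 'I_2) p : degree_bound s p ->
  degree_bound s.-1 (mpoly.mderiv i p).
Proof.
move=> /degree_boundP p0; apply/degree_boundP => m' sm.
rewrite mpoly.mcoeff_mderiv p0 ?mul0rn // mpoly.mdegD mpoly.mdeg1 addn1.
by case: (s) sm.
Qed.

Lemma degree_bound_dir_deriv s w p : degree_bound s p ->
  degree_bound s.-1 (dir_deriv w p).
Proof.
move=> ps; apply: degree_bound_lin; first exact: degree_bound_deriv.
exact/degree_boundZ/degree_bound_deriv.
Qed.

Lemma dir_deriv_is_linear w : linear (dir_deriv w).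
Proof.
move=> c p q; rewrite /dir_deriv !mpoly.mderivD !mpoly.mderivZ !scalerDr !scalerA.
by rewrite ![_ * c]mulrC -!scalerA addrACA.
Qed.

HB.instance Definition _ w :=
  GRing.isLinear.Build R poly2 poly2 _ (dir_deriv w) (dir_deriv_is_linear w).

Lemma dir_derivD w p q : dir_deriv w (p + q) = dir_deriv w p + dir_deriv w q.
Proof. exact: raddfD. Qed.

Lemma dir_derivB w p q : dir_deriv w (p - q) = dir_deriv w p - dir_deriv w q.
Proof. exact: raddfB. Qed.

Lemma dir_derivM w p q :
  dir_deriv w (p * q) = dir_deriv w p * q + p * dir_deriv w q.
Proof.
rewrite /dir_deriv !mpoly.mderivM !scalerDr mulrDl mulrDr -!scalerAl -!scalerAr.
by rewrite addrACA.
Qed.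

Lemma dir_derivC w (c : R) : dir_deriv w (mpoly.mpolyC 2 c) = 0.
Proof. by rewrite /dir_deriv !mpoly.mderivC !scaler0 addr0. Qed.

Lemma deriv_coord (i j : 'I_2) : mpoly.mderiv i (coord_poly j) = (i == j)%:R.
Proof.
rewrite mpoly.mderivX mpoly.mnm1E eq_sym; case: eqP => [->|_].
  have -> : mpoly.mnm_sub (mpoly.mnm1 j) (mpoly.mnm1 j) = @mpoly.mnm0 2.
    by apply/mpoly.mnmP => k; rewrite mpoly.mnmBE mpoly.mnm0E subnn.
  by rewrite mpoly.mpolyX0 scale1r.
by rewrite scale0r.
Qed.

Lemma dir_deriv_coord w (i : 'I_2) : dir_deriv w (coord_poly i) = mpoly.mpolyC 2 (w 0 i).
Proof.
rewrite /dir_deriv !deriv_coord -mpoly.alg_mpolyC.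
have o01 : (0 == 1 :> 'I_2) = false by [].
have o10 : (1 == 0 :> 'I_2) = false by [].
by case: (ord2P i) => ->; rewrite eqxx ?o01 ?o10 mulr1n mulr0n scaler0 ?addr0 ?add0r.
Qed.

Lemma dir_deriv_comm w w' p :
  dir_deriv w (dir_deriv w' p) = dir_deriv w' (dir_deriv w p).
Proof.
rewrite /dir_deriv !mpoly.mderivD !mpoly.mderivZ !scalerDr !scalerA.
rewrite [mpoly.mderiv 1 (mpoly.mderiv 0 _)]mpoly.mderiv_comm.
by rewrite ![w' 0 _ * _]mulrC -!addrA; congr (_ + _); rewrite addrCA.
Qed.

Lemma dir_deriv_delta (i : 'I_2) p : dir_deriv (delta_mx 0 i) p = mpoly.mderiv i p.
Proof.
have o01 : (0 == 1 :> 'I_2) = false by [].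
have o10 : (1 == 0 :> 'I_2) = false by [].
by rewrite /dir_deriv !mxE eqxx; case: (ord2P i) => ->;
  rewrite eqxx ?o01 ?o10 andbF scale0r scale1r ?addr0 ?add0r.
Qed.

Lemma dir_deriv_dir w w' (c : R) p :
  dir_deriv (c *: w + w') p = c *: dir_deriv w p + dir_deriv w' p.
Proof. by rewrite /dir_deriv !mxE !scalerDl !scalerDr !scalerA addrACA. Qed.

Lemma dir_derivX w p k :
  dir_deriv w (p ^+ k) = k%:R *: (p ^+ k.-1 * dir_deriv w p).
Proof.
elim: k => [|[|k] IH]; first by rewrite expr0 scale0r -mpoly.mpolyC1 dir_derivC.
  by rewrite expr1 expr0 mul1r scale1r.
rewrite exprS dir_derivM IH -scalerAr mulrA -exprS /=.
by rewrite -[in RHS]natr1 scalerDl scale1r addrC [dir_deriv w p * _]mulrC.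
Qed.

Lemma iter_dir_deriv_bound w p s k : degree_bound s p ->
  degree_bound (s - k) (iter k (dir_deriv w) p).
Proof.
move=> ps; elim: k => [|k IH]; first by rewrite subn0.
by rewrite subnS /=; exact: degree_bound_dir_deriv.
Qed.

(* Repeated integration by parts, starting with the antiderivative [l] of 1 in
   the direction [w]; the terms vanish once [k] exceeds the degree of [p]. *)
Definition antideriv_quot s w (l : poly2) p : poly2 :=
  \sum_(k < s) ((-1) ^+ k / k.+1`!%:R) *: (l ^+ k * iter k (dir_deriv w) p).

(** The factor [l] is split off because [bubble_curl] needs the cofactor by itself. *)
Definition antideriv s w (l : poly2) p : poly2 := l * antideriv_quot s w l p.

Lemma antideriv_quot_bound s w l p : degree_bound 2 l -> degree_bound s p ->
  degree_bound s (antideriv_quot s w l p).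
Proof.
move=> l2 ps; apply: degree_bound_sum => k _; apply: degree_boundZ.
have := @degree_boundX 1 k l l2; rewrite muln1 => lk.
have := iter_dir_deriv_bound w k ps.
have -> : (s - k = (s - k.+1).+1)%N by rewrite subnSK.
move=> /(degree_boundM lk) /leq_trans; apply.
by rewrite -addSn subnKC.
Qed.

Lemma antideriv_bound s w l p : degree_bound 2 l -> degree_bound s p ->
  degree_bound s.+1 (antideriv s w l p).
Proof.
move=> l2 ps; case: s ps => [|s] ps.
  by rewrite /antideriv /antideriv_quot big_ord0 mulr0 degree_bound0.
exact: (@degree_boundM 1 s) (antideriv_quot_bound _ _ _).
Qed.

Lemma dir_deriv_antideriv s w l p : degree_bound s p -> dir_deriv w l = 1 ->
  dir_deriv w (antideriv s w l p) = p.
Proof.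
move=> ps wl; rewrite /antideriv /antideriv_quot mulr_sumr linear_sum /=.
(* Differentiating the term of index [k] by the product rule gives [F k - F k.+1], so the sum
   telescopes to [F 0 - F s]; [F 0] is [p], and [F s] vanishes because [s] derivatives kill [p]. *)
pose F k := ((-1) ^+ k / k`!%:R) *: (l ^+ k * iter k (dir_deriv w) p).
rewrite (eq_bigr (fun k : 'I_s => F k - F k.+1)) => [|k _]; last first.
  rewrite -scalerAr mulrA -exprS linearZ /= dir_derivM dir_derivX wl mulr1 /=.
  rewrite scalerDr -scalerAl scalerA /F [(-1) ^+ k.+1]exprS mulN1r mulNr scaleNr opprK.
  congr (_ *: _ + _ *: _); rewrite -mulrA; congr (_ * _).
  by rewrite factS natrM invfM mulrAC mulVf ?mul1r // pnatr_eq0.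
have := @telescope_sumr _ 0 s F (leq0n s); rewrite big_mkord.
rewrite (eq_bigr (fun k : 'I_s => - (F k - F k.+1))) => [|k _]; last by rewrite opprB.
rewrite sumrN => /(congr1 -%R); rewrite opprK opprB => ->.
have -> : F s = 0.
  have := iter_dir_deriv_bound w s ps; rewrite subnn leqn0.
  by rewrite mpoly.mmeasure_poly_eq0 /F => /eqP ->; rewrite mulr0 scaler0.
by rewrite /F expr0 divr1 mul1r scale1r subr0.
Qed.

Lemma antideriv_is_linear s w l : linear (antideriv s w l).
Proof.
move=> c p q; rewrite /antideriv /antideriv_quot scalerAr -mulrDr; congr (_ * _).
rewrite scaler_sumr -big_split; apply: eq_bigr => k _ /=.
suff -> : iter k (dir_deriv w) (c *: p + q) =
    c *: iter k (dir_deriv w) p + iter k (dir_deriv w) q.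
  by rewrite mulrDr scalerDr -scalerAr !scalerA [c * _]mulrC.
by elim: (k : nat) => //= n ->; rewrite linearP.
Qed.

HB.instance Definition _ s w l :=
  GRing.isLinear.Build R poly2 poly2 _ (antideriv s w l) (antideriv_is_linear s w l).

Lemma dir_deriv_antideriv_comm s w w' l p : dir_deriv w' l = 0 ->
  dir_deriv w' (antideriv s w l p) = antideriv s w l (dir_deriv w' p).
Proof.
move=> wl; rewrite /antideriv dir_derivM wl mul0r add0r; congr (_ * _).
rewrite /antideriv_quot linear_sum; apply: eq_bigr => k _ /=.
rewrite linearZ /= dir_derivM dir_derivX wl mulr0 scaler0 mul0r add0r.
congr (_ *: (_ * _)); elim: (k : nat) => //= n <-.
exact: dir_deriv_comm.
Qed.

(** Integrate the first component in x, then the remainder of the second in y. For a curl-free field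
    this remainder has no x-derivative, so the second integration leaves the first component intact.
    The formula is linear in [v] for arbitrary [v], which makes periods linear. *)
Definition potential s (v : poly2 * poly2) : poly2 :=
  let p := antideriv s (delta_mx 0 0) (coord_poly 0) v.1 in
  p + antideriv s (delta_mx 0 1) (coord_poly 1) (v.2 - mpoly.mderiv (1%R : 'I_2) p).

Lemma potential_is_linear s : linear (potential s).
Proof.
move=> c u v; rewrite /potential linearP /= mpoly.mderivD mpoly.mderivZ.
set a := antideriv _ _ _ u.1; set b := antideriv _ _ _ v.1.
have -> : c *: u.2 + v.2 - (c *: mpoly.mderiv 1 a + mpoly.mderiv 1 b) =
   c *: (u.2 - mpoly.mderiv 1 a) + (v.2 - mpoly.mderiv 1 b).
  by rewrite scalerBr opprD addrACA.
by rewrite linearP /= scalerDr addrACA.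
Qed.

HB.instance Definition _ s :=
  GRing.isLinear.Build R (poly2 * poly2)%type poly2 _ (potential s)
    (potential_is_linear s).

Lemma potential_bound s v : degree_bound s v.1 -> degree_bound s v.2 ->
  degree_bound s.+1 (potential s v).
Proof.
move=> v1 v2; have vs := antideriv_bound (delta_mx 0 0) (degree_bound_coord 0) v1.
apply: degree_boundD => //; apply: antideriv_bound; first exact: degree_bound_coord.
apply: degree_boundB => //; exact: degree_bound_deriv vs.
Qed.

Lemma mderiv_potential s v : degree_bound s v.1 -> degree_bound s v.2 ->
  mpoly.mderiv 0 v.2 = mpoly.mderiv 1 v.1 ->
  mpoly.mderiv 0 (potential s v) = v.1 /\ mpoly.mderiv 1 (potential s v) = v.2.
Proof.
move=> v1 v2 vc; rewrite /potential !mpoly.mderivD.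
have d0 : dir_deriv (delta_mx 0 0) (coord_poly 0) = 1.
  by rewrite dir_deriv_coord mxE.
have d1 : dir_deriv (delta_mx 0 1) (coord_poly 1) = 1.
  by rewrite dir_deriv_coord mxE.
have d01 : dir_deriv (delta_mx 0 0) (coord_poly 1) = 0.
  by rewrite dir_deriv_coord mxE mpoly.mpolyC0.
set p := antideriv _ _ _ v.1.
have p1 : mpoly.mderiv 0 p = v.1.
  by rewrite -dir_deriv_delta dir_deriv_antideriv.
have ps : degree_bound s.+1 p by apply: antideriv_bound => //; exact: degree_bound_coord.
have qs : degree_bound s (v.2 - mpoly.mderiv (1%R : 'I_2) p).
  by apply: degree_boundB => //; exact: degree_bound_deriv ps.
split.
  rewrite p1 -[mpoly.mderiv 0 (antideriv _ _ _ _)]dir_deriv_delta.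
  rewrite dir_deriv_antideriv_comm // dir_deriv_delta mpoly.mderivB vc.
  by rewrite mpoly.mderiv_comm p1 subrr linear0 addr0.
rewrite -[mpoly.mderiv 1 (antideriv _ _ _ _)]dir_deriv_delta.
by rewrite dir_deriv_antideriv // addrC subrK.
Qed.

Lemma mderiv_eq0_const p : mpoly.mderiv 0 p = 0 -> mpoly.mderiv 1 p = 0 ->
  exists c, p = mpoly.mpolyC 2 c.
Proof.
move=> p0 p1; exists (mpoly.mcoeff (@mpoly.mnm0 2) p); apply/mpoly.mpolyP => m.
rewrite mpoly.mcoeffC; have [->|m0] := eqVneq m (@mpoly.mnm0 2); first by rewrite mulr1.
rewrite mulr0; have [i mi] : exists i, m i != 0%N.
  apply/existsP; rewrite -negb_forall; apply: contra m0 => /forallP m0.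
  by apply/eqP/mpoly.mnmP => i; rewrite mpoly.mnm0E; exact/eqP.
have pi : mpoly.mderiv i p = 0.
  by case: (ord2P i) => ->.
have := mpoly.mcoeff_mderiv i p (mpoly.mnm_sub m (mpoly.mnm1 i)).
rewrite mpoly.submK ?mpoly.lep1mP // pi mpoly.mcoeff0 => /esym/eqP.
by rewrite -mulr_natr mulf_eq0 pnatr_eq0 orbF => /eqP.
Qed.

Lemma evalD p q x : eval (p + q) x = eval p x + eval q x.
Proof. exact: mpoly.mevalD. Qed.

Lemma evalB p q x : eval (p - q) x = eval p x - eval q x.
Proof. exact: mpoly.mevalB. Qed.

Lemma evalM p q x : eval (p * q) x = eval p x * eval q x.
Proof. exact: mpoly.mevalM. Qed.

Lemma evalZ (c : R) p x : eval (c *: p) x = c * eval p x.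
Proof. exact: mpoly.mevalZ. Qed.

Lemma evalC (c : R) x : eval (mpoly.mpolyC 2 c) x = c.
Proof. exact: mpoly.mevalC. Qed.

Lemma eval_coord (i : 'I_2) x : eval (coord_poly i) x = x 0 i.
Proof. exact: mpoly.mevalXU. Qed.

(** Restriction to a line as a univariate polynomial, to which root counting and formal derivatives
    apply. *)
Definition on_line a w p : {poly R} :=
  mpoly.mmap (polyC : R -> {poly R}) (fun i => (a 0 i)%:P + w 0 i *: 'X) p.

Lemma on_line_is_monoid_morphism a w : monoid_morphism (on_line a w).
Proof.
have [? ?] := @mpoly.mmap_is_multiplicative 2 R {poly R} (fun i => (a 0 i)%:P + w 0 i *: 'X)
  (polyC : {rmorphism R -> {poly R}}).
by split.
Qed.

HB.instance Definition _ a w :=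
  GRing.isAdditive.Build poly2 {poly R} (on_line a w) (@mpoly.mmap_is_additive 2 R {poly R} _ _).
HB.instance Definition _ a w :=
  GRing.isMonoidMorphism.Build poly2 {poly R} (on_line a w)
   (on_line_is_monoid_morphism a w).

Lemma on_lineD a w p q : on_line a w (p + q) = on_line a w p + on_line a w q.
Proof. exact: raddfD. Qed.

Lemma on_lineM a w p q : on_line a w (p * q) = on_line a w p * on_line a w q.
Proof. exact: rmorphM. Qed.

Lemma on_lineZ a w (c : R) p : on_line a w (c *: p) = c *: on_line a w p.
Proof. by rewrite /on_line mpoly.mmapZ mul_polyC. Qed.

Lemma on_lineC a w (c : R) : on_line a w (mpoly.mpolyC 2 c) = c%:P.
Proof. exact: mpoly.mmapC. Qed.

Lemma on_line_coord a w (i : 'I_2) :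
  on_line a w (coord_poly i) = (a 0 i)%:P + w 0 i *: 'X.
Proof. by rewrite /on_line mpoly.mmapX mpoly.mmap1U. Qed.

Lemma poly2_ind (P : poly2 -> Prop) :
  (forall c, P (mpoly.mpolyC 2 c)) -> (forall i, P (coord_poly i)) ->
  (forall p q, P p -> P q -> P (p + q)) -> (forall p q, P p -> P q -> P (p * q)) ->
  forall p, P p.
Proof.
move=> PC PX PD PM; have P0 : P 0 by rewrite -mpoly.mpolyC0.
elim/mpoly.mpolyind => // c m p _ _ Pp; apply: PD => //.
rewrite -mpoly.mul_mpolyC; apply: (PM) => //.
rewrite mpoly.mpolyXE_id; elim/big_ind: _ => [|u v Pu Pv|i _];
  [by rewrite -mpoly.mpolyC1|exact: PM|].
elim: (m i) => [|k IH]; first by rewrite expr0 -mpoly.mpolyC1.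
by rewrite exprS; apply: (PM) => //; exact: PX.
Qed.

Lemma horner_on_line a w p t : (on_line a w p).[t] = eval p (a + t *: w).
Proof.
elim/poly2_ind: p => [c|i|p q IHp IHq|p q IHp IHq].
- by rewrite on_lineC hornerC evalC.
- by rewrite on_line_coord !hornerE eval_coord !mxE mulrC.
- by rewrite on_lineD hornerD IHp IHq evalD.
- by rewrite on_lineM hornerM IHp IHq evalM.
Qed.

Lemma deriv_on_line a w p : (on_line a w p)^`() = on_line a w (dir_deriv w p).
Proof.
elim/poly2_ind: p => [c|i|p q IHp IHq|p q IHp IHq].
- by rewrite on_lineC derivC dir_derivC rmorph0.
- by rewrite on_line_coord derivD derivC derivZ derivX add0r dir_deriv_coord on_lineC alg_polyC.
- by rewrite on_lineD derivD IHp IHq -on_lineD -dir_derivD.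
- by rewrite on_lineM derivM IHp IHq -!on_lineM -on_lineD -dir_derivM.
Qed.

Lemma size_on_line a w p s : degree_bound s p -> (size (on_line a w p) <= s)%N.
Proof.
move=> ps; rewrite [p]mpoly.mpolyE rmorph_sum /= big_seq.
elim/big_ind: _ => [|u v us vs|m mp]; first by rewrite size_poly0.
  by apply: (leq_trans (size_polyD _ _)); rewrite geq_max us vs.
rewrite on_lineZ (leq_trans (size_scale_leq _ _)) //.
apply: leq_trans (leq_trans (mpoly.msize_mdeg_lt mp) ps).
rewrite /on_line mpoly.mmapX /mpoly.mmap1 mpoly.mdegE.
pose h (i : 'I_2) : {poly R} := (a 0 i)%:P + w 0 i *: 'X.
have lin i : (size (h i) <= 2)%N.
  apply: (leq_trans (size_polyD _ _)); rewrite geq_max.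
  rewrite (leq_trans (size_polyC_leq1 _)) //= (leq_trans (size_scale_leq _ _)) //.
  by rewrite size_polyX.
rewrite -[X in (size (polyseq X) <= _)%N]/(\prod_(i < 2) h i ^+ m i).
apply: leq_trans (size_prod_leq _ _) _ => /=.
rewrite cardT size_enum_ord leq_subLR.
have : (\sum_i size (h i ^+ m i)%R <= \sum_(i < 2) (m i).+1)%N.
  apply: leq_sum => i _; apply: leq_trans (size_poly_exp_leq _ _) _.
  rewrite ltnS -subn1; have := lin i; case: (size _) => [|[|[|//]]] _ //=.
  by rewrite mul1n.
have -> : (\sum_(i < 2) (m i).+1 = 2 + \sum_(i < 2) m i)%N.
  by rewrite !big_ord_recl !big_ord0 !addn0 addSn addnS.
by move=> H; apply: (leq_ltn_trans H); rewrite addnS ltnS.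
Qed.

Lemma poly_eq0_unit_interval (f : {poly R}) :
  (forall t, 0 <= t <= 1 -> f.[t] = 0) -> f = 0.
Proof.
move=> f0; apply/eqP/negPn/negP => fn0.
(* The numbers 1/(k+1) for [k < size f] are [size f] distinct roots in the unit interval, one more
   than a nonzero [f] can have. *)
pose rs := [seq (k.+1%:R^-1 : R) | k <- iota 0 (size f)].
have := @max_poly_roots _ f rs fn0; rewrite size_map size_iota ltnn.
suff [-> ->] : all (root f) rs /\ uniq rs by move=> /(_ isT isT).
split.
  apply/allP => _ /mapP[k _ ->]; apply/rootP/f0.
  by rewrite invr_ge0 ler0n /= invf_le1 ?ltr0n // ler1n.
rewrite map_inj_uniq ?iota_uniq // => k l /invr_inj/eqP.
by rewrite eqr_nat => /eqP[].
Qed.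

Lemma is_coef_exists m a (b : 'rV[R]_2) p : degree_bound m.+1 p ->
  exists r, is_coef a b p (r : 'rV[R]_m.+1).
Proof.
move=> pm; set f := on_line a (b - a) p.
have fm : (size f <= m.+1)%N by exact: size_on_line.
pose B (j : nat) (t : R) := t ^+ j * (1 - t) ^+ (m - j).
(* Bernstein form of a monomial: multiply [t ^+ k] by [(1 - t + t) ^+ (m - k)], which is 1, and
   expand. *)
have pow k t : (k <= m)%N ->
    \sum_(j < m.+1) (if (k <= j)%N then 'C(m - k, j - k)%:R else 0) * B j t = t ^+ k.
  move=> km; rewrite -(big_mkord xpredT (fun j => (if (k <= j)%N then 'C(m - k, j - k)%:R else 0) * B j t)).
  rewrite (big_cat_nat (n := k)) //=; last by rewrite ltnW.
  rewrite big_nat big1 => [|j /andP[_ jk]]; last by rewrite leqNgt jk mul0r.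
  rewrite add0r -{1}[k]add0n big_addn big_mkord subSn //.
  have := exprDn (1 - t) t (m - k); rewrite subrK expr1n => E.
  rewrite -[RHS]mulr1 [X in _ = _ * X]E mulr_sumr; apply: eq_bigr => j _.
  rewrite leq_addl addnK /B exprD -subnDA [(j + k)%N]addnC.
  by rewrite -[X in _ = _ * X]mulr_natl; ring.
exists (\row_j ((\sum_(k < m.+1) f`_k * (if (k <= j)%N then 'C(m - k, j - k)%:R else 0))
   / 'C(m, j)%:R)) => t.
rewrite -horner_on_line -/f (horner_coef_wide _ fm).
have termE (j : 'I_m.+1) : (\row_(j < m.+1) ((\sum_(k < m.+1) f`_k *
    (if (k <= j)%N then 'C(m - k, j - k)%:R else 0)) / 'C(m, j)%:R)) 0 j
    * 'C(m, j)%:R * t ^+ j * (1 - t) ^+ (m - j) =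
    \sum_(k < m.+1) f`_k * ((if (k <= j)%N then 'C(m - k, j - k)%:R else 0) * B j t).
  rewrite mxE divfK; last by rewrite pnatr_eq0 -lt0n bin_gt0 -ltnS.
  rewrite -mulrA mulr_suml; by apply: eq_bigr => k _; rewrite -[LHS]mulrA.
rewrite (eq_bigr _ (fun j _ => termE j)) exchange_big /=.
by apply: eq_bigr => k _; rewrite -mulr_sumr pow // -ltnS.
Qed.

(** A coefficient vector determines the restriction to the edge. Conversely, polynomials that agree
    on the edge agree on its line, so they have the same set of admissible vectors and [xget] makes
    the same choice. *)
Lemma coef_eqP m a (b : 'rV[R]_2) p q : degree_bound m.+1 p -> degree_bound m.+1 q ->
  coef m a b p = coef m a b q <->
  forall t, 0 <= t <= 1 -> eval p (a + t *: (b - a)) = eval q (a + t *: (b - a)).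
Proof.
move=> pm qm; split=> [pq t _|pq].
  have cP r : degree_bound m.+1 r -> is_coef a b r (coef m a b r).
    by move=> /(is_coef_exists a b)[c cc]; exact: (xgetPex 0 (ex_intro _ c cc)).
  by rewrite (cP _ pm) (cP _ qm) pq.
have E : on_line a (b - a) p = on_line a (b - a) q.
  apply/eqP; rewrite -subr_eq0; apply/eqP/poly_eq0_unit_interval => t t01.
  by rewrite hornerD hornerN !horner_on_line pq // subrr.
congr (xget 0 _); apply/funext => r; apply/propext; rewrite /is_coef /mkset.
by split=> H t; rewrite -H -!horner_on_line E.
Qed.

End polynomials.

(** * Barycentric coordinates *)

Section continuity.
Variables (R : realType) (T : topologicalType).

Lemma continuous_idfun : continuous (fun x : T => x).
Proof. by move=> x; exact: cvg_id. Qed.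

Lemma continuous_fst (U : topologicalType) : continuous (fun x : T * U => x.1).
Proof. by move=> x; exact: cvg_fst. Qed.

Lemma continuous_snd (U : topologicalType) : continuous (fun x : T * U => x.2).
Proof. by move=> x; exact: cvg_snd. Qed.

Lemma continuous_add (V : normedModType R) (f g : T -> V) :
  continuous f -> continuous g -> continuous (fun x => f x + g x).
Proof. by move=> fc gc x; exact: cvgD (fc x) (gc x). Qed.

Lemma continuous_sub (V : normedModType R) (f g : T -> V) :
  continuous f -> continuous g -> continuous (fun x => f x - g x).
Proof. by move=> fc gc x; exact: cvgB (fc x) (gc x). Qed.

Lemma continuous_scale (V : normedModType R) (f : T -> R) (g : T -> V) :
  continuous f -> continuous g -> continuous (fun x => f x *: g x).
Proof. by move=> fc gc x; exact: cvgZ (fc x) (gc x). Qed.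

Lemma continuous_radd (f g : T -> R) :
  continuous f -> continuous g -> continuous (fun x => f x + g x).
Proof. exact: (@continuous_add R^o). Qed.

Lemma continuous_rsub (f g : T -> R) :
  continuous f -> continuous g -> continuous (fun x => f x - g x).
Proof. exact: (@continuous_sub R^o). Qed.

Lemma continuous_rmul (f g : T -> R) :
  continuous f -> continuous g -> continuous (fun x => f x * g x).
Proof. exact: (@continuous_scale R^o). Qed.

End continuity.

Lemma continuous_coord (R : realType) n (j : 'I_n) :
  continuous (fun x : 'rV[R]_n => x 0 j).
Proof. exact: (@coord_continuous R 1 n 0 j). Qed.

Definition homog (R : realType) (V : 'M[R]_(3, 2)) : 'M[R]_3 :=
  row_mx V (const_mx 1 : 'cV[R]_3).

HB.lock Definition bary (R : realType) (V : 'M[R]_(3, 2)) (x : 'rV[R]_2) : 'rV[R]_3 :=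
  (row_mx x (const_mx 1 : 'M[R]_1) : 'rV[R]_3) *m invmx (homog V).

(* The linear part of [bary]. *)
HB.lock Definition dbary (R : realType) (V : 'M[R]_(3, 2)) (w : 'rV[R]_2) : 'rV[R]_3 :=
  (row_mx w (0 : 'M[R]_1) : 'rV[R]_3) *m invmx (homog V).

Section barycentric.
Variable R : realType.
Implicit Types (V : 'M[R]_(3, 2)) (x y z w : 'rV[R]_2).

Lemma homog_unit V : nondegenerate V -> homog V \in unitmx.
Proof. by rewrite -row_free_unit. Qed.

Lemma dbary_is_linear V : linear (dbary V).
Proof.
move=> a x y; rewrite dbary.unlock scalemxAl -mulmxDl; congr (_ *m _).
rewrite -[RHS]/(a *: row_mx x (0 : 'M[R]_1) + row_mx y (0 : 'M[R]_1)).
by rewrite scale_row_mx add_row_mx scaler0 addr0.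
Qed.

HB.instance Definition _ V :=
  GRing.isLinear.Build R 'rV[R]_2 'rV[R]_3 _ (dbary V) (dbary_is_linear V).

Lemma baryD V x w : bary V (x + w) = bary V x + dbary V w.
Proof.
rewrite bary.unlock dbary.unlock -mulmxDl; congr (_ *m _).
rewrite -[RHS]/(row_mx x (const_mx 1 : 'M[R]_1) + row_mx w (0 : 'M[R]_1)).
by rewrite add_row_mx addr0.
Qed.

Lemma bary_unique V x (l : 'rV[R]_3) : nondegenerate V ->
  l *m V = x -> \sum_i l 0 i = 1 -> bary V x = l.
Proof.
move=> /homog_unit Vu lx l1; rewrite bary.unlock -[RHS](mulmxK Vu); congr (_ *m _).
rewrite -[RHS]/(l *m row_mx V (const_mx 1 : 'cV[R]_3)) mul_mx_row lx.
suff -> : l *m (const_mx 1 : 'cV[R]_3) = (const_mx 1 : 'M[R]_1) by [].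
apply/matrixP => i j; rewrite !ord1 !mxE -[RHS]l1; apply: eq_bigr => k _.
by rewrite mxE mulr1.
Qed.

Lemma baryK V x : nondegenerate V -> bary V x *m V = x /\ \sum_i bary V x 0 i = 1.
Proof.
move=> /homog_unit Vu.
have : bary V x *m homog V = row_mx x (const_mx 1 : 'M[R]_1).
  by rewrite bary.unlock mulmxKV.
rewrite -[X in _ = X]/(row_mx x (const_mx 1 : 'M[R]_1)).
rewrite -[X in X = _]/(bary V x *m row_mx V (const_mx 1 : 'cV[R]_3)) mul_mx_row.
move=> E; have [xE /matrixP/(_ 0 0)] := @eq_row_mx _ 1 2 1 _ _ _ _ E.
rewrite [X in X = _]mxE [X in _ = X]mxE => sE; split=> //.
by rewrite -[RHS]sE; apply: eq_bigr => i _; rewrite [const_mx _ _ _]mxE mulr1.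
Qed.

Lemma bary_sum V (x : 'rV[R]_2) : nondegenerate V -> \sum_i bary V x 0 i = 1.
Proof. by move=> /baryK -/(_ x)[]. Qed.

Lemma bary_vertex V i : nondegenerate V -> bary V (row i V) = delta_mx 0 i.
Proof.
move=> nV; apply: bary_unique; rewrite -?rowE //.
rewrite (bigD1 i) //= mxE !eqxx big1 ?addr0 // => j ji.
by rewrite mxE (negPf ji).
Qed.

Lemma bary_vertexE V i k : nondegenerate V -> bary V (row i V) 0 k = (k == i)%:R.
Proof. by move=> nV; rewrite bary_vertex // mxE. Qed.

Lemma bary_inj V x y : nondegenerate V -> bary V x = bary V y -> x = y.
Proof. by move=> nV xy; rewrite -(baryK x nV).1 xy (baryK y nV).1. Qed.

Lemma dbaryE V x y : dbary V (y - x) = bary V y - bary V x.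
Proof.
have e : x + (y - x) = y by rewrite addrC subrK.
by rewrite -[in bary V y]e baryD [bary V x + _]addrC addrK.
Qed.

Lemma bary_lin V t x y k :
  bary V ((1 - t) *: x + t *: y) 0 k = (1 - t) * bary V x 0 k + t * bary V y 0 k.
Proof.
have -> : (1 - t) *: x + t *: y = x + t *: (y - x).
  by rewrite scalerBl scale1r scalerBr -addrA; congr (_ + _); rewrite addrC.
by rewrite baryD linearZ /= dbaryE !mxE; ring.
Qed.

(** A coordinate of [V'] is an affine function, hence interpolates its values at the vertices of
    [V]. *)
Lemma bary_bary V V' x k : nondegenerate V -> nondegenerate V' ->
  bary V' x 0 k = \sum_i bary V x 0 i * bary V' (row i V) 0 k.
Proof.
move=> nV nV'; have [xE s1] := baryK x nV.
pose l : 'rV[R]_3 := \sum_i bary V x 0 i *: bary V' (row i V).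
suff -> : bary V' x = l by rewrite summxE; apply: eq_bigr => i _; rewrite mxE.
apply: bary_unique => //.
  rewrite mulmx_suml -[RHS]xE mulmx_sum_row; apply: eq_bigr => i _.
  by rewrite -scalemxAl (baryK _ nV').1.
rewrite -[RHS]s1; under eq_bigr => j _ do rewrite summxE.
rewrite exchange_big; apply: eq_bigr => i _ /=.
under eq_bigr => j _ do rewrite mxE.
by rewrite -mulr_sumr bary_sum // mulr1.
Qed.

Lemma dbary_sum V w : nondegenerate V -> \sum_i dbary V w 0 i = 0.
Proof.
move=> nV; have -> : dbary V w = bary V w - bary V 0 by rewrite -dbaryE subr0.
under eq_bigr => i _ do rewrite !mxE.
by rewrite big_split sumrN /= !bary_sum // subrr.
Qed.

Lemma dbaryK V w : nondegenerate V -> w = \sum_i dbary V w 0 i *: row i V.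
Proof.
move=> nV; rewrite -mulmx_sum_row.
have -> : dbary V w = bary V w - bary V 0 by rewrite -dbaryE subr0.
by rewrite mulmxBl (baryK _ nV).1 (baryK 0 nV).1 subr0.
Qed.

(** At the vertex [i] the other two [dbary] coordinates are the coefficients on the edge vectors
    leaving it; [w] points into the triangle exactly when both are nonnegative. This is the cone
    test used below. *)
Lemma dbary_cone V w i : nondegenerate V ->
  w = \sum_(k | k != i) dbary V w 0 k *: (row k V - row i V).
Proof.
move=> nV; rewrite {1}(dbaryK w nV) (bigD1 i) //=.
have := dbary_sum w nV; rewrite (bigD1 i) //= => /eqP; rewrite addr_eq0 => /eqP ->.
rewrite scaleNr scaler_suml -sumrN -big_split /=; apply: eq_bigr => k _.
by rewrite scalerBr addrC.
Qed.

Lemma closed_triangleP V x : nondegenerate V ->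
  closed_triangle V x <-> forall i, 0 <= bary V x 0 i.
Proof.
move=> nV; split=> [[l [l0 l1] lx]|x0]; first by rewrite (bary_unique nV lx l1).
by exists (bary V x); [split=> //; exact: bary_sum|exact: (baryK x nV).1].
Qed.

Lemma bary_le1 V x i : nondegenerate V -> closed_triangle V x -> bary V x 0 i <= 1.
Proof.
move=> nV /(closed_triangleP _ nV) x0; rewrite -(bary_sum x nV) (bigD1 i) //=.
by rewrite lerDl sumr_ge0.
Qed.

Lemma triangle_convex V t x y : nondegenerate V -> 0 <= t <= 1 ->
  closed_triangle V x -> closed_triangle V y ->
  closed_triangle V ((1 - t) *: x + t *: y).
Proof.
move=> nV /andP[t0 t1] /(closed_triangleP _ nV) x0 /(closed_triangleP _ nV) y0.
apply/(closed_triangleP _ nV) => i; rewrite bary_lin.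
by rewrite addr_ge0 // mulr_ge0 // subr_ge0.
Qed.

Lemma vertex_in V i : nondegenerate V -> closed_triangle V (row i V).
Proof.
by move=> nV; apply/(closed_triangleP _ nV) => k; rewrite bary_vertexE // ler0n.
Qed.

Lemma row_inj V i j : nondegenerate V -> row i V = row j V -> i = j.
Proof.
move=> nV ij; have := bary_vertexE i i nV; rewrite ij bary_vertexE // eqxx.
by case: eqVneq => // _ /eqP; rewrite mulr0n eq_sym oner_eq0.
Qed.

Definition bary_poly V k : mpoly.mpoly 2 R :=
  mpoly.mpolyC 2 (bary V 0 0 k) +
  \sum_(j < 2) dbary V (delta_mx 0 j) 0 k *: mpoly.mpolyX R (mpoly.mnm1 j).

Lemma eval_bary_poly V k x : eval (bary_poly V k) x = bary V x 0 k.
Proof.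
rewrite /bary_poly /eval mpoly.mevalD mpoly.mevalC raddf_sum /=.
rewrite -[in RHS](add0r x) baryD mxE; congr (_ + _).
rewrite {2}(row_sum_delta x) linear_sum summxE; apply: eq_bigr => j _.
by rewrite mpoly.mevalZ mpoly.mevalXU linearZ mxE mulrC.
Qed.

Lemma bary_continuous V k : continuous (fun x => bary V x 0 k).
Proof.
have -> : (fun x => bary V x 0 k) = (fun x => bary V 0 0 k +
    (x 0 0 * dbary V (delta_mx 0 0) 0 k + x 0 1 * dbary V (delta_mx 0 1) 0 k)).
  apply/funext => x; rewrite -[in LHS](add0r x) baryD mxE; congr (_ + _).
  rewrite {1}(row_sum_delta x) linear_sum summxE big_ord_recl big_ord1.
  by rewrite !linearZ /= !mxE; congr (_ + x 0 _ * dbary V (delta_mx 0 _) 0 k); apply/val_inj.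
apply: continuous_radd; first exact: cst_continuous.
by apply: continuous_radd; apply: continuous_rmul;
  [exact: continuous_coord|exact: cst_continuous|exact: continuous_coord|exact: cst_continuous].
Qed.

Lemma bary_lt0_near V x k : bary V x 0 k < 0 -> \forall y \near x, bary V y 0 k < 0.
Proof. by move=> x0; exact: (@bary_continuous V k x _ (lt_nbhsl x0)). Qed.

Lemma bary_gt0_near V x k : 0 < bary V x 0 k -> \forall y \near x, 0 < bary V y 0 k.
Proof. by move=> x0; exact: (@bary_continuous V k x _ (lt_nbhsr x0)). Qed.

Lemma outside_near V x : nondegenerate V -> ~ closed_triangle V x ->
  \forall y \near x, ~ closed_triangle V y.
Proof.
move=> nV xV; have [k xk] : exists k, bary V x 0 k < 0.
  apply: contrapT => H; apply: xV; apply/(closed_triangleP _ nV) => k.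
  by rewrite leNgt; apply/negP => xk; apply: H; exists k.
by apply: filterS (bary_lt0_near xk) => y yk /(closed_triangleP _ nV)/(_ k); rewrite leNgt yk.
Qed.

Lemma near_direction x w (P : set 'rV[R]_2) : nbhs x P ->
  exists2 e : R, 0 < e & forall t, `|t| < e -> P (x + t *: w).
Proof.
move=> xP.
have c : continuous (fun t : R => x + t *: w).
  apply: continuous_add; first exact: cst_continuous.
  by apply: continuous_scale; [exact: continuous_idfun|exact: cst_continuous].
have : nbhs (0 : R) [set t | P (x + t *: w)].
  by apply: (c 0); rewrite scale0r addr0.
move=> /nbhs_ballP[e e0 eP]; exists e => // t te; apply: eP.
by rewrite /ball /= sub0r normrN.
Qed.

Lemma ord3P (i j : 'I_3) : i != j ->
  exists k, [/\ k != i, k != j & forall l, [\/ l = i, l = j | l = k]].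
Proof.
by case: i j => [[|[|[|//]]] ?] [[|[|[|//]]] ?] // _;
  [exists 2|exists 1|exists 2|exists 0|exists 1|exists 0]; split=> //;
  case=> [[|[|[|//]]] ?]; solve [ by apply: Or31; apply/val_inj
    | by apply: Or32; apply/val_inj | by apply: Or33; apply/val_inj ].
Qed.

(** Sides are numbered by the opposite vertex, whose coordinate vanishes on them. *)
Definition side V k : set 'rV[R]_2 :=
  [set x | closed_triangle V x /\ bary V x 0 k = 0].

Lemma sideE V i j k : nondegenerate V -> i != j -> k != i -> k != j ->
  segment (row i V) (row j V) = side V k.
Proof.
move=> nV ij ki kj; apply/seteqP; split=> x.
  move=> [t t01 <-]; split; last by rewrite bary_lin !bary_vertexE // (negPf ki) (negPf kj) !mulr0 addr0.
  by apply: triangle_convex => //; exact: vertex_in.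
have [k' [k'i k'j kP]] := ord3P ij.
have kk : k' = k by case: (kP k) => // kk; [move: ki|move: kj]; rewrite kk eqxx.
rewrite {k'}kk in k'i k'j kP *.
have E (F : 'I_3 -> R) : \sum_l F l = F i + F j + F k.
  rewrite (bigD1 i) //= (bigD1 j) 1?eq_sym //= (bigD1 k) ?ki ?kj //= big1 ?addr0 ?addrA // => l.
  by move=> /andP[/andP[li lj] lk]; case: (kP l) => E; move: li lj lk; rewrite E eqxx ?andbF.
have E' (F : 'I_3 -> 'rV[R]_2) : \sum_l F l = F i + F j + F k.
  rewrite (bigD1 i) //= (bigD1 j) 1?eq_sym //= (bigD1 k) ?ki ?kj //= big1 ?addr0 ?addrA // => l.
  by move=> /andP[/andP[li lj] lk]; case: (kP l) => E0; move: li lj lk; rewrite E0 eqxx ?andbF.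
move=> [xV xk]; have := bary_sum x nV; rewrite E xk addr0 => s1.
exists (bary V x 0 j).
  rewrite /= in_itv /= bary_le1 // andbT; by move/(closed_triangleP _ nV): xV.
have -> : 1 - bary V x 0 j = bary V x 0 i by rewrite -s1 addrK.
rewrite -[RHS](baryK x nV).1 mulmx_sum_row E' xk scale0r addr0.
by [].
Qed.

Lemma is_edgeP V E : nondegenerate V -> is_edge V E <-> exists k, E = side V k.
Proof.
move=> nV; split=> [[i [j [ij ->]]]|[k ->]].
  by have [k [ki kj _]] := ord3P ij; exists k; exact: sideE.
have /existsP[i ik] : [exists i, i != k].
  by case: k => [[|[|[|//]]] ?]; apply/existsP; [exists 1|exists 0|exists 0].
have [j [jk ji jP]] := ord3P ik; exists i, j; split; first by rewrite eq_sym.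
by rewrite (@sideE _ i j k) // eq_sym.
Qed.

Lemma side_inj V k l : nondegenerate V -> side V k `<=` side V l -> k = l.
Proof.
move=> nV kl; have [//|kl'] := eqVneq k l.
have [j [jk jl _]] := ord3P kl'.
have /kl[_] : side V k (row l V).
  by split; [exact: vertex_in|rewrite bary_vertexE // (negPf kl')].
by rewrite bary_vertexE // eqxx => /eqP; rewrite oner_eq0.
Qed.

End barycentric.

(** * Geometry of triangulations *)

Lemma convex_comb_eq0 (R : realFieldType) (t x y : R) : 0 < t < 1 -> 0 <= x -> 0 <= y ->
  (1 - t) * x + t * y = 0 -> x = 0 /\ y = 0.
Proof.
rewrite -[t < 1]subr_gt0 => /andP[t0 t1] x0 y0 /eqP.
have h1 : 0 <= (1 - t) * x by rewrite mulr_ge0 // ltW.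
have h2 : 0 <= t * y by rewrite mulr_ge0 // ltW.
rewrite paddr_eq0 // !mulf_eq0 (gt_eqF t0) (gt_eqF t1) /=.
by move=> /andP[/eqP -> /eqP ->].
Qed.

Lemma convex_comb_eq1 (R : realFieldType) (t x y : R) : 0 < t < 1 -> x <= 1 -> y <= 1 ->
  (1 - t) * x + t * y = 1 -> x = 1 /\ y = 1.
Proof.
rewrite -subr_ge0 -[y <= 1]subr_ge0 => t01 x1 y1 e.
have [] := convex_comb_eq0 t01 x1 y1; first by rewrite !mulrBr !mulr1 addrACA -opprD e; ring.
by move=> /eqP; rewrite subr_eq0 => /eqP <- /eqP; rewrite subr_eq0 => /eqP <-.
Qed.

Section triangulation_geometry.
Variables (R : realType) (M : triangulation R).
Implicit Types (T : tri M) (x y z w : 'rV[R]_2) (k : 'I_3).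

Local Notation nd := tri_nondegenerate.
Local Notation lam T x k := (bary (vtx T) x 0 k).
Local Notation dlam T w k := (dbary (vtx T) w 0 k).

Definition in_tri T x : Prop := closed_triangle (vtx T) x.
Definition corner T k : 'rV[R]_2 := row k (vtx T).
Definition edge T k : set 'rV[R]_2 := side (vtx T) k.

Lemma in_triP T x : in_tri T x <-> forall k, 0 <= lam T x k.
Proof. exact: (closed_triangleP _ (nd T)). Qed.

Lemma lam_corner T i k : lam T (corner T i) k = (k == i)%:R.
Proof. exact: bary_vertexE (nd T). Qed.

Lemma corner_in T i : in_tri T (corner T i).
Proof. exact: vertex_in (nd T). Qed.

Lemma corner_inj T : injective (corner T).
Proof. by move=> i j; exact: row_inj (nd T). Qed.

Lemma lam_eq1 T x i : in_tri T x -> lam T x i = 1 -> x = corner T i.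
Proof.
move=> /in_triP xT xi; apply: (bary_inj (nd T)); rewrite (bary_vertex i (nd T)).
have := bary_sum x (nd T); rewrite (bigD1 i) //= xi -[in RHS](addr0 1).
move=> /addrI/eqP; rewrite psumr_eq0 => [/allP s0|k _]; last exact: xT.
apply/rowP => k; rewrite [RHS]mxE eqxx; case: eqVneq => [->//|ki].
by have := s0 k; rewrite mem_index_enum ki => /(_ isT)/eqP.
Qed.

Lemma other_index k : exists i : 'I_3, i != k.
Proof. by case: k => [[|[|[|//]]] ?]; [exists 1|exists 0|exists 0]. Qed.

Lemma edge_corners T k : exists i j, [/\ i != j, k != i, k != j &
  edge T k = segment (corner T i) (corner T j)].
Proof.
have [i ik] := other_index k.
have [j [ji jk _]] := ord3P ik; exists i, j.
have [ij ki kj] : [/\ i != j, k != i & k != j] by split; rewrite eq_sym.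
by split=> //; rewrite /edge -(sideE (nd T) ij ki kj).
Qed.

Lemma conforming T T' x : T != T' -> in_tri T x -> in_tri T' x ->
  (exists i i', corner T i = corner T' i' /\
     forall y, in_tri T y -> in_tri T' y -> y = corner T i) \/
  (exists k k', edge T k = edge T' k' /\
     forall y, in_tri T y -> in_tri T' y -> edge T k y).
Proof.
move=> TT xT xT'; have [I0|[p [[i pi] [i' pi'] Ip]]|[E [ET ET' IE]]] := tri_conforming TT.
- by have : set0 x by rewrite -I0.
- left; exists i, i'; rewrite /corner -pi -pi'; split=> // y yT yT'.
  by have : [set p] y by rewrite -Ip.
- have /(is_edgeP _ (nd T))[k Ek] := ET; have /(is_edgeP _ (nd T'))[k' Ek'] := ET'.
  right; exists k, k'; rewrite /edge -Ek -Ek'; split=> // y yT yT'.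
  by rewrite -IE.
Qed.

Lemma in_tri_convex T t x y : 0 <= t <= 1 -> in_tri T x -> in_tri T y ->
  in_tri T ((1 - t) *: x + t *: y).
Proof. exact: triangle_convex (nd T). Qed.

Lemma lam_le1 T x k : in_tri T x -> lam T x k <= 1.
Proof. exact: bary_le1 (nd T). Qed.

(* Two triangles meet in a vertex or an edge, which is an extreme subset. *)
Lemma in_tri_extreme T T' x y t : 0 < t < 1 -> in_tri T x -> in_tri T y ->
  in_tri T' ((1 - t) *: x + t *: y) -> in_tri T' x /\ in_tri T' y.
Proof.
move=> t01 xT yT mT'; have [<-//|TT] := eqVneq T T'.
have mT : in_tri T ((1 - t) *: x + t *: y).
  by case/andP: t01 => t0 t1; apply: in_tri_convex => //; rewrite !ltW.
case: (conforming TT mT mT') => [[i [i' [ii I]]]|[k [k' [kk I]]]].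
  have mi := I _ mT mT'.
  have : lam T ((1 - t) *: x + t *: y) i = 1 by rewrite mi lam_corner eqxx.
  rewrite bary_lin => /(convex_comb_eq1 t01 (lam_le1 i xT) (lam_le1 i yT))[xi yi].
  by rewrite (lam_eq1 xT xi) (lam_eq1 yT yi) ii; split; exact: corner_in.
have [_] := I _ mT mT'; rewrite bary_lin.
move=> /(convex_comb_eq0 t01 ((in_triP _ _).1 xT k) ((in_triP _ _).1 yT k))[x0 y0].
have xk : edge T k x by split.
have yk : edge T k y by split.
by move: xk yk; rewrite kk => -[? _] [].
Qed.

(** There are no hanging vertices: if a corner of [T] lay strictly inside a common edge, its
    coordinate 1 would force both ends of that edge to equal the corner. *)
Lemma corner_shared T T' i : in_tri T' (corner T i) ->
  exists i', corner T i = corner T' i'.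
Proof.
move=> xT'; have [TT|TT] := eqVneq T T'; first by subst T'; exists i.
have xT := corner_in T i.
case: (conforming TT xT xT') => [[j [j' [jj I]]]|[k [k' [kk I]]]].
  by exists j'; rewrite -jj; exact: I.
have := I _ xT xT'; rewrite kk.
have [p [q [pq _ _ pqE]]] := edge_corners T' k'; rewrite pqE => -[t /= t01 tE].
move: t01; rewrite in_itv /= => /andP[t0 t1].
have [t0'|t0'] := eqVneq t 0.
  by exists p; rewrite -tE t0' subr0 scale1r scale0r addr0.
have [t1'|t1'] := eqVneq t 1.
  by exists q; rewrite -tE t1' subrr scale1r scale0r add0r.
have pT : in_tri T (corner T' p).
  suff : edge T' k' (corner T' p) by rewrite -kk => -[].
  by rewrite pqE; exists 0; rewrite /= ?in_itv /= ?lexx ?ler01 // subr0 scale1r scale0r addr0.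
have qT : in_tri T (corner T' q).
  suff : edge T' k' (corner T' q) by rewrite -kk => -[].
  by rewrite pqE; exists 1; rewrite /= ?in_itv /= ?lexx ?ler01 // subrr scale1r scale0r add0r.
have : lam T (corner T i) i = 1 by rewrite lam_corner eqxx.
have t01 : 0 < t < 1 by rewrite !lt_neqAle eq_sym t0' t1' t0.
rewrite -tE bary_lin => /(convex_comb_eq1 t01 (lam_le1 i pT) (lam_le1 i qT))[pi qi].
have : corner T' p = corner T' q by rewrite (lam_eq1 pT pi) (lam_eq1 qT qi).
by move=> /corner_inj pq'; rewrite pq' eqxx in pq.
Qed.

Definition adjacent T k T' k' : Prop := T != T' /\ edge T k = edge T' k'.

Lemma adjacent_sym T k T' k' : adjacent T k T' k' -> adjacent T' k' T k.
Proof. by case=> TT kk; split; rewrite 1?eq_sym. Qed.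

Lemma corner_edge T i k : i != k -> edge T k (corner T i).
Proof.
move=> ik; split; first exact: corner_in.
by rewrite -/(lam T (corner T i) k) lam_corner eq_sym (negPf ik).
Qed.

(** Both coordinates are affine and vanish along the common edge, so they are proportional; the
    factor is read off at the corner opposite the edge. *)
Lemma lam_adjacent T k T' k' z : edge T k = edge T' k' ->
  lam T' z k' = lam T z k * lam T' (corner T k) k'.
Proof.
move=> kk; rewrite (bary_bary z k' (nd T) (nd T')) (bigD1 k) //= big1 ?addr0 // => i ik.
have [_ ->] : edge T' k' (corner T i); last by rewrite mulr0.
by rewrite -kk; exact: corner_edge.
Qed.

Lemma dlam_adjacent T k T' k' w : edge T k = edge T' k' ->
  dlam T' w k' = dlam T w k * lam T' (corner T k) k'.
Proof.
move=> kk; rewrite -[w]subr0 !dbaryE !mxE (lam_adjacent w kk) (lam_adjacent 0 kk).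
by rewrite mulrDl mulNr.
Qed.

Lemma edge_mid T k : exists m, edge T k m /\ forall l, l != k -> lam T m l = 2^-1.
Proof.
have [i [j [ij ki kj E]]] := edge_corners T k.
exists ((1 - 2^-1) *: corner T i + 2^-1 *: corner T j); split.
  by rewrite E; exists 2^-1 => //=; rewrite in_itv /= invr_ge0 ler0n invf_le1 ?ltr0n // ler1n.
have [k' [k'i k'j kP]] := ord3P ij.
have kk : k' = k by case: (kP k) => // kk; [move: ki|move: kj]; rewrite kk eqxx.
move=> l lk; rewrite bary_lin !lam_corner; case: (kP l) => E'.
- by rewrite E' eqxx (negPf ij) mulr0 addr0 mulr1; field.
- by rewrite E' eqxx eq_sym (negPf ij) mulr0 add0r mulr1.
- by move: lk; rewrite E' kk eqxx.
Qed.

Lemma inner_point_unique T T' z : (forall k, 0 < lam T z k) -> in_tri T' z -> T = T'.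
Proof.
move=> zT zT'; apply/eqP/negPn/negP => TT.
have zT0 : in_tri T z by apply/in_triP => k; exact: ltW.
case: (conforming TT zT0 zT') => [[i [i' [ii I]]]|[k [k' [kk I]]]].
  have [j ji] := other_index i.
  by have := zT j; rewrite (I _ zT0 zT') lam_corner (negPf ji) ltxx.
by have [_ z0] := I _ zT0 zT'; have := zT k; rewrite z0 ltxx.
Qed.

Lemma near_pick x w (P : set 'rV[R]_2) : nbhs x P ->
  exists2 t : R, 0 < t < 1 & forall s, 0 <= s <= t -> P (x + s *: w).
Proof.
move=> /(near_direction w)[e e0 eP]; exists (Num.min e 1 / 2).
  by rewrite divr_gt0 ?lt_min ?e0 //= ltr_pdivrMr // mul1r gt_min ltr1n orbT.
move=> s /andP[s0 st]; apply: eP; rewrite ger0_norm //; apply: le_lt_trans st _.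
rewrite ltr_pdivrMr //; have : Num.min e 1 <= e by rewrite ge_min lexx.
by move=> /le_lt_trans; apply; rewrite mulrDr mulr1 ltrDl.
Qed.

Lemma near_pos T (P : pred 'I_3) x : (forall l, P l -> 0 < lam T x l) ->
  nbhs x [set z | forall l, P l -> 0 < lam T z l].
Proof.
move=> xP; have Fx : Filter (nbhs x) by exact: nbhs_filter.
apply: (@filter_forall _ _ (fun l => [set z | P l -> 0 < lam T z l]) _ Fx) => l.
have [Pl|nPl] := boolP (P l).
  by apply: filterS (bary_gt0_near (xP l Pl)) => z /= zl _.
by apply: filterS filterT => z _.
Qed.

(** If the factor were nonnegative, a small move from the midpoint of the edge towards the opposite
    corner of [T] would stay in both triangles while leaving the edge, against conformity. *)
Lemma adjacent_opposite T k T' k' : adjacent T k T' k' -> lam T' (corner T k) k' < 0.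
Proof.
move=> [TT kk]; rewrite ltNge; apply/negP => c0.
have [m [mE mP]] := edge_mid T' k'.
have mT : edge T k m by rewrite kk.
have near_m : nbhs m [set z | forall l, l != k' -> 0 < lam T' z l].
  by apply: (near_pos (P := predC1 k')) => l lk; rewrite mP // invr_gt0 ltr0n.
have [t /andP[t0 t1] tP] := near_pick (corner T k - m) near_m.
have t01 : 0 <= t <= 1 by rewrite !ltW.
have := tP t; rewrite ltW //= lexx => /(_ isT).
have -> : m + t *: (corner T k - m) = (1 - t) *: m + t *: corner T k.
  by rewrite scalerBl scale1r scalerBr -addrA; congr (_ + _); rewrite addrC.
set z := _ + _ => zP.
have zT : in_tri T z by apply: in_tri_convex => //; [case: mT|exact: corner_in].
have zT' : in_tri T' z.
  apply/in_triP => l; have [->|lk] := eqVneq l k'; last exact/ltW/zP.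
  rewrite bary_lin; have [_ ->] := mE; rewrite mulr0 add0r.
  by rewrite mulr_ge0 // ltW.
have eT' y : edge T k y -> in_tri T' y by rewrite kk => -[].
case: (conforming TT zT zT') => [[i [i' [ii I]]]|[l [l' [ll I]]]].
  have [p [q [pq kp kq _]]] := edge_corners T k.
  rewrite eq_sym in kp; rewrite eq_sym in kq.
  have /corner_inj e1 := I _ (corner_in T p) (eT' _ (corner_edge T kp)).
  have /corner_inj e2 := I _ (corner_in T q) (eT' _ (corner_edge T kq)).
  by move: pq; rewrite e1 e2 eqxx.
have kl : k = l by apply: (side_inj (nd T)) => y yk; apply: I; [case: yk|exact: eT'].
have [_] := I _ zT zT'; rewrite -kl bary_lin lam_corner eqxx.
have [_ ->] := mT; rewrite mulr0 add0r mulr1 => t00.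
by rewrite t00 ltxx in t0.
Qed.

(** Two neighbours across the same edge would also be adjacent to each other. All three
    proportionality factors would be negative, yet one is the product of the other two. *)
Lemma adjacent_unique T k T' k' T'' k'' : adjacent T k T' k' -> adjacent T k T'' k'' ->
  T' = T''.
Proof.
move=> a a'; apply/eqP/negPn/negP => TT.
have o := adjacent_opposite a; have o' := adjacent_opposite a'.
have a'' : adjacent T' k' T'' k'' by split=> //; case: a => _ <-; case: a'.
have o'' := adjacent_opposite a''.
by move: o'; rewrite (lam_adjacent (corner T k) (proj2 a'')) nmulr_rlt0 // ltNge ltW.
Qed.

(** Near a relatively interior point of the edge the other coordinates stay positive in both
    triangles, and the sign of [lam T y k] decides which triangle contains [y]. *)
Lemma adjacent_interior T k T' k' x : adjacent T k T' k' -> edge T k x ->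
  (forall l, l != k -> 0 < lam T x l) ->
  nbhs x [set y | in_tri T y \/ in_tri T' y].
Proof.
move=> a xk xP; have [TT kk] := a; have o := adjacent_opposite a.
have xP' l' : l' != k' -> 0 < lam T' x l'.
  move=> lk; have xk' : edge T' k' x by rewrite -kk.
  have [xT' _] := xk'; rewrite lt_neqAle (in_triP _ _).1 // andbT.
  apply/negP => /eqP xl.
  have [j [jl jk jP]] := ord3P lk.
  (* otherwise [x] is a vertex of T', hence of T *)
  have xj : x = corner T' j.
    apply: lam_eq1 => //; have := bary_sum x (nd T').
    rewrite (bigD1 j) //= big1 ?addr0 // => i ij; case: (jP i) => E.
    + by rewrite E -xl.
    + by rewrite E; case: xk'.
    + by rewrite E eqxx in ij.
  have [xT _] := xk; have [i xi] := @corner_shared T' T j (ltac:(by rewrite -xj)).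
  have [l [lk' li _]] := ord3P (i := k) (j := i)
    (ltac:(apply/eqP => ki; have [_ ] := xk; rewrite xj xi -/(lam _ _ _) ki;
           rewrite lam_corner eqxx => /eqP; rewrite oner_eq0 //)).
  by have := xP l lk'; rewrite xj xi lam_corner (negPf li) ltxx.
have near1 : nbhs x [set z | forall l, l != k -> 0 < lam T z l].
  exact: (near_pos (P := predC1 k)).
have near2 : nbhs x [set z | forall l, l != k' -> 0 < lam T' z l].
  exact: (near_pos (P := predC1 k')).
apply: filterS2 near1 near2 => y y1 y2.
have [y0|y0] := leP 0 (lam T y k).
  by left; apply/in_triP => l; have [->//|lk] := eqVneq l k; exact/ltW/y1.
right; apply/in_triP => l; have [->|lk] := eqVneq l k'; last exact/ltW/y2.
by rewrite (lam_adjacent y kk); apply: ltW; rewrite nmulr_rgt0.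
Qed.

End triangulation_geometry.

(** * Stars of points, free edges and families of neighbours *)

Section triangulation_domain.
Variables (R : realType) (M : triangulation R).
Implicit Types (T : tri M) (x y z w : 'rV[R]_2) (k : 'I_3).

Local Notation nd := tri_nondegenerate.
Local Notation lam T x k := (bary (vtx T) x 0 k).
Local Notation dlam T w k := (dbary (vtx T) w 0 k).

Definition covered : set 'rV[R]_2 := [set x | exists T : tri M, in_tri T x].
Definition inside x : Prop := nbhs x covered.

Lemma inside_covered x : inside x -> covered x.
Proof. exact: nbhs_singleton. Qed.

Lemma inside_near x : inside x -> nbhs x inside.
Proof. exact: nbhs_interior. Qed.

(** Each of the finitely many closed triangles missing [x] keeps a distance from it. *)
Lemma star_near x : nbhs x [set y | forall T, in_tri T y -> in_tri T x].
Proof.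
have Fx : Filter (nbhs x) by exact: nbhs_filter.
apply: (@filter_forall _ _ (fun T => [set y | in_tri T y -> in_tri T x]) _ Fx) => T.
have [xT|xT] := pselect (in_tri T x); first by apply: filterS filterT => y _ _.
by apply: filterS (outside_near (nd T) xT) => y yT yT'; case: (yT yT').
Qed.

Lemma nbhs_affine x y (c : R) (P : set 'rV[R]_2) : nbhs x P ->
  nbhs y [set z | P (x + c *: (z - y))].
Proof.
move=> xP; have H : continuous (fun z : 'rV[R]_2 => x + c *: (z - y)).
  apply: continuous_add; first exact: cst_continuous.
  apply: continuous_scale; first exact: cst_continuous.
  by apply: continuous_sub; [exact: continuous_idfun|exact: cst_continuous].
by apply: (H y); rewrite subrr scaler0 addr0.
Qed.

Lemma segE x y (t : R) : x + t *: (y - x) = (1 - t) *: x + t *: y.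
Proof. by rewrite scalerBl scale1r scalerBr -addrA; congr (_ + _); rewrite addrC. Qed.

(** [Omega] itself is not convex, but its trace on one triangle is. Let [m'] be a point on the
    segment close to [x]. A triangle containing points near [m'] contains [m'], hence also [y] by
    extremality; so the homothety with center [y] that carries [m'] to [m] keeps the neighbourhood
    covered. *)
Lemma inside_convex T x y t : 0 <= t <= 1 -> in_tri T x -> in_tri T y ->
  inside x -> inside y -> inside ((1 - t) *: x + t *: y).
Proof.
move=> /andP[t0 t1] xT yT ix iy.
have [r /andP[r0 r1] rP] := near_pick (y - x) (inside_near ix).
have [tr|rt] := leP t r; first by rewrite -segE; apply: rP; rewrite t0.
have [->|t1'] := eqVneq t 1; first by rewrite subrr scale0r add0r scale1r.
have {}t1 : t < 1 by rewrite lt_neqAle t1'.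
(* [q] solves (1 - q)(1 - r) = 1 - t, which puts the required point at parameter [q] between [m']
   and [y]. *)
pose m' := x + r *: (y - x); pose q := (t - r) / (1 - r).
have r1' : 0 < 1 - r by rewrite subr_gt0.
have im' : inside m' by apply: rP; rewrite lexx ltW.
have q01 : 0 < q < 1.
  by rewrite divr_gt0 ?subr_gt0 //= ltr_pdivrMr // mul1r ltrD2r.
have q1 : 0 < 1 - q by rewrite subr_gt0; case/andP: q01.
pose m := (1 - q) *: m' + q *: y.
have -> : (1 - t) *: x + t *: y = m.
  rewrite /m /m' -!segE; apply/rowP => j; rewrite !mxE /q; field.
  by rewrite gt_eqF.
apply: filterS (nbhs_affine m (1 - q)^-1 (filterI im' (star_near m'))) => z /=.
move=> [[T' zT'] sT']; exists T'.
have [_ yT'] : in_tri T' x /\ in_tri T' y.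
  apply: (@in_tri_extreme _ _ T T' x y r) => //; first by rewrite r0.
  by rewrite -segE; exact: sT'.
have -> : z = (1 - q) *: (m' + (1 - q)^-1 *: (z - m)) + q *: y.
  by rewrite scalerDr scalerA mulfV ?gt_eqF // scale1r addrAC -/m addrC subrK.
apply: in_tri_convex => //; case/andP: q01 => q0 q1'; by rewrite !ltW.
Qed.

(** A small step from [x] away from the opposite corner leaves [T] but stays covered. The triangle
    found there also contains [x], and conformity makes it share the whole edge. *)
Lemma open_edge_shared T k x : inside x -> edge T k x ->
  (forall l, l != k -> 0 < lam T x l) -> exists T' k', adjacent T k T' k'.
Proof.
move=> ix xk xP; have [xT x0] := xk.
have [t /andP[t0 t1] tP] := near_pick (x - corner T k) (filterI ix (star_near x)).
have := tP t; rewrite lexx ltW // => /(_ isT)[[T' yT'] sT']; exists T'.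
have TT : T != T'.
  apply/eqP => TT; move: yT'; rewrite -TT => /in_triP/(_ k).
  rewrite baryD linearZ /= dbaryE !mxE x0 -/(lam _ _ _) lam_corner eqxx.
  by rewrite add0r sub0r mulrN1 oppr_ge0 leNgt t0.
have xT' := sT' _ yT'.
case: (conforming TT xT xT') => [[i [i' [ii I]]]|[l [l' [ll I]]]].
  have [j [ji jk _]] : exists j, [/\ j != i, j != k & true].
    have [ik|ik] := eqVneq i k; last by have [j [? ? _]] := ord3P ik; exists j.
    by have [j ji] := other_index i; exists j; rewrite -ik.
  by have := xP j jk; rewrite (I _ xT xT') lam_corner (negPf ji) ltxx.
have kl : k = l.
  apply/eqP/negPn/negP => kl; have := xP l; rewrite eq_sym kl.
  by have [_ ->] := I _ xT xT'; rewrite ltxx => /(_ isT).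
by exists l'; split; rewrite // kl.
Qed.

Lemma cone_coords T i j k w : j != i -> k != i -> k != j ->
  w = dlam T w j *: (corner T j - corner T i) + dlam T w k *: (corner T k - corner T i).
Proof.
move=> ji ki kj; rewrite {1}(dbary_cone w i (nd T)) (bigD1 j) //= (bigD1 k) /= ?ki //.
rewrite big1 ?addr0 // => l /andP[/andP[li lj] lk].
have [k' [k'i k'j kP]] := ord3P ji.
move: k'i k'j li lj lk; case: (kP k) => E; case: (kP l) => E';
  by rewrite ?E ?E' ?eqxx //; move: ki kj; rewrite ?E ?eqxx.
Qed.

(* Two triangles of [A] with the vertex [x] meet across an edge at [x]; if the
   direction [w] is in none of the cones of [A] at [x], rotating away from [w]
   must come to an end.  Slopes with respect to [w] stand in for angles. *)
Lemma fan_end (A : {set tri M}) x w :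
  A != finset.set0 -> (forall T, T \in A -> exists i, corner T i = x) ->
  (forall T i, T \in A -> corner T i = x -> exists2 k, k != i & dlam T w k < 0) ->
  exists T i k, [/\ T \in A, corner T i = x, k != i &
    forall T' k', T' \in A -> ~ adjacent T k T' k'].
Proof.
move=> /finset.set0Pn[T0 T0A] Ax Aw; apply: contrapT => H.
have {}H T i k : T \in A -> corner T i = x -> k != i ->
    exists T' k', T' \in A /\ adjacent T k T' k'.
  move=> TA Ti ki; apply: contrapT => H'; apply: H; exists T, i, k; split=> //.
  by move=> T' k' T'A a; apply: H'; exists T', k'.
(* [be] is the cross product with [w] and [al] the inner product; [al / (eps * be)] is then the
   cotangent of the angle to [w], measured on the side of [w] selected by the sign [eps]. *)
pose be (u : 'rV[R]_2) : R := w 0 0 * u 0 1 - w 0 1 * u 0 0.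
pose al (u : 'rV[R]_2) : R := w 0 0 * u 0 0 + w 0 1 * u 0 1.
have be_lin a b u v : be (a *: u + b *: v) = a * be u + b * be v.
  by rewrite /be !mxE; ring.
have al_lin a b u v : al (a *: u + b *: v) = a * al u + b * al v.
  by rewrite /al !mxE; ring.
have be_w : be w = 0 by rewrite /be mulrC subrr.
have w_neq0 : w != 0.
  apply/eqP => w0; have [i T0i] := Ax _ T0A; have [k _] := Aw _ _ T0A T0i.
  by rewrite w0 linear0 mxE ltxx.
have al_w : 0 < al w.
  have : al w != 0.
    apply: contra w_neq0; rewrite /al paddr_eq0 ?sqr_ge0 // !mulf_eq0 !orbb.
    move=> /andP[/eqP w0 /eqP w1]; apply/eqP/rowP => j; rewrite mxE.
    by case: (ord2P j) => ->.
  by rewrite lt_neqAle eq_sym => -> /=; rewrite addr_ge0 ?sqr_ge0.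
(* The edge vectors of a triangle at [x] span the plane, so one of them is not parallel to [w];
   [eps] is the side on which it lies. *)
have [eps [T1 [j1 [T1A eps1]]]] : exists eps T j, T \in A /\ 0 < eps * be (corner T j - x).
  have [i T0i] := Ax _ T0A; have [j ji] := other_index i.
  have [k [kj ki _]] := ord3P ji.
  suff [l bl] : exists l, be (corner T0 l - x) != 0.
    by exists (Num.sg (be (corner T0 l - x))), T0, l; rewrite -normrEsg normr_gt0.
  apply: contrapT => nb.
  have b0 l : be (corner T0 l - x) = 0.
    by apply/eqP/negPn/negP => bl; apply: nb; exists l.
  pose w' : 'rV[R]_2 := \row_l (if l == 0 then - w 0 1 else w 0 0).
  have : be w' = al w by rewrite /be /al /w' !mxE /=; ring.
  rewrite (cone_coords T0 w' ji ki kj) be_lin T0i !b0 !mulr0 addr0 => e.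
  by rewrite -e ltxx in al_w.
(* As [w] lies outside the cone, its coefficient on corner [j] is negative. Hence the edge vector to
   [k] is a positive combination of [w] and the one to [j]: it lies on the same side, with a larger
   slope. *)
have step T i j k : T \in A -> corner T i = x -> j != i -> k != i -> k != j ->
    0 < eps * be (corner T j - x) -> 0 < dlam T w k ->
    0 < eps * be (corner T k - x) /\
    al (corner T j - x) / (eps * be (corner T j - x)) <
    al (corner T k - x) / (eps * be (corner T k - x)).
  move=> TA Ti ji ki kj; set u := corner T j - x; set v := corner T k - x => bu b0.
  have wE := cone_coords T w ji ki kj; rewrite Ti -/u -/v in wE.
  set a := dlam T w j in wE; set b := dlam T w k in wE b0.
  have a0 : a < 0.
    have [l li l0] := Aw _ _ TA Ti; have [//|lj] := eqVneq l j; first by move=> e; rewrite -/a /a -e.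
    have lk : l = k.
      have [k' [k'i k'j kP]] := ord3P ji.
      by case: (kP l) => E; case: (kP k) => E'; rewrite ?E ?E' //;
        move: li lj ki kj; rewrite ?E ?E' ?eqxx.
    by move: b0; rewrite /b -lk ltNge ltW.
  have bvE : b * (eps * be v) = - a * (eps * be u).
    have := be_w; rewrite {1}wE be_lin => e.
    have {}e : b * be v = - a * be u by apply/eqP; rewrite -subr_eq0 mulNr opprK addrC e.
    by rewrite mulrCA e; ring.
  have avE : b * al v = al w - a * al u by rewrite {1}wE al_lin; ring.
  have na : 0 < - a by rewrite oppr_gt0.
  have bv : 0 < eps * be v by rewrite -(pmulr_rgt0 _ b0) bvE mulr_gt0.
  split=> //; rewrite ltr_pdivrMr // mulrAC ltr_pdivlMr //.
  rewrite -(ltr_pM2l b0).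
  have -> : b * (al u * (eps * be v)) = al u * (b * (eps * be v)) by ring.
  rewrite [X in _ < X]mulrA avE bvE -subr_gt0.
  have -> : (al w - a * al u) * (eps * be u) - al u * (- a * (eps * be u)) =
    al w * (eps * be u) by ring.
  exact: mulr_gt0.
pose P (p : tri M * 'I_3) := (p.1 \in A) && (0 < eps * be (corner p.1 p.2 - x)).
pose F (p : tri M * 'I_3) := al (corner p.1 p.2 - x) / (eps * be (corner p.1 p.2 - x)).
have P1 : P (T1, j1) by rewrite /P T1A.
case: (Order.TotalTheory.arg_maxP F P1) => -[T j] /andP[/= TA bj] maxF.
have no_better T' k : T' \in A -> 0 < eps * be (corner T' k - x) ->
    al (corner T j - x) / (eps * be (corner T j - x)) <
    al (corner T' k - x) / (eps * be (corner T' k - x)) -> False.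
  move=> T'A b0; have := maxF (T', k); rewrite /P /F /= T'A b0 => /(_ isT) le lt.
  by have := le_lt_trans le lt; rewrite ltxx.
have [i Ti] := Ax _ TA.
have ji : j != i.
  by apply/eqP => ji; move: bj; rewrite ji Ti subrr /be !mxE !mulr0 subrr mulr0 ltxx.
have [k [kj ki _]] := ord3P ji.
have bu0 : be (corner T j - x) != 0 by apply: contraTneq bj => ->; rewrite mulr0 ltxx.
have bn0 : dlam T w k != 0.
  apply: contra bu0 => /eqP b0; have := cone_coords T w ji ki kj.
  rewrite b0 Ti => wE; move: be_w; rewrite wE be_lin mul0r addr0 => /eqP.
  rewrite mulf_eq0 => /orP[/eqP a0|//].
  by move: w_neq0; rewrite wE a0 !scale0r addr0 eqxx.
have [b0|b0] := ltP 0 (dlam T w k).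
  by have [] := step T i j k TA Ti ji ki kj bj b0; exact: no_better.
have {}b0 : dlam T w k < 0 by rewrite lt_neqAle bn0.
(* Cross the edge from [x] to corner [j], which has the maximal slope. The coordinate opposite this
   edge changes sign, so [step] applies in the neighbour and its third corner beats the maximum. *)
have [T' [k' [T'A a]]] := H T i k TA Ti ki.
have [_ kk] := a; have o := adjacent_opposite a.
have b0' : 0 < dlam T' w k' by rewrite (dlam_adjacent w kk) nmulr_rgt0.
have shared l : l != k -> exists l', corner T' l' = corner T l /\ l' != k'.
  move=> lk; have : edge T' k' (corner T l) by rewrite -kk; exact: corner_edge.
  move=> [lT' l0]; have [l' ll] := corner_shared lT'; exists l'; split=> //.
  apply/eqP => lk'; move: l0; rewrite ll lk' -/(lam _ _ _) lam_corner eqxx.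
  by move/eqP; rewrite oner_eq0.
have [i' [ii ik']] : exists i', corner T' i' = x /\ i' != k'.
  by rewrite -Ti; apply: shared; rewrite eq_sym.
have [j' [jj jk']] : exists j', corner T' j' = corner T j /\ j' != k'.
  by apply: shared; rewrite eq_sym.
have ji' : j' != i'.
  by apply/eqP => e; move: bu0; rewrite -jj e ii subrr /be !mxE !mulr0 subrr eqxx.
have [] := step T' i' j' k' T'A ii ji' _ _ _ b0'; rewrite ?jj // 1?eq_sym //.
exact: no_better.
Qed.

(** At the farthest corner [x] take the direction [w = x]. All corners lie in a disc with [x] on its
    rim, so edge vectors at [x] have negative inner product with [x]; no cone at [x] contains this
    direction and [fan_end] yields an edge without neighbour in the family. *)
Lemma no_closed_family (A : {set tri M}) : A != finset.set0 ->
  (forall T k, T \in A -> exists T' k', T' \in A /\ adjacent T k T' k') -> False.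
Proof.
move=> /finset.set0Pn[T0 T0A] H.
pose sq (u : 'rV[R]_2) : R := u 0 0 ^+ 2 + u 0 1 ^+ 2.
pose P (p : tri M * 'I_3) := p.1 \in A.
have P0 : P (T0, 0) by [].
case: (Order.TotalTheory.arg_maxP (fun p => sq (corner p.1 p.2)) P0) => -[T1 i1] /= T1A.
rewrite /P /= in T1A *; set x := corner T1 i1 => maxx.
pose Ax := [set T in A | [exists i, corner T i == x]]%SET.
have [||T i TAx Ti|T [i [k [TAx Ti ki no]]]] := @fan_end Ax x x.
- by apply/finset.set0Pn; exists T1; rewrite finset.inE T1A; apply/existsP; exists i1.
- by move=> T; rewrite finset.inE => /andP[_ /existsP[i /eqP ?]]; exists i.
- apply: contrapT => nk; have TA : T \in A by move: TAx; rewrite finset.inE => /andP[].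
  have d0 k : k != i -> 0 <= dlam T x k.
    by move=> ki; rewrite leNgt; apply/negP => kn; apply: nk; exists k.
  (* From 2 x.(q - x) = |q|^2 - |x|^2 - |q - x|^2, with |q| at most |x| and q different from x. *)
  have dot_lt k : k != i -> x 0 0 * (corner T k - x) 0 0 + x 0 1 * (corner T k - x) 0 1 < 0.
    move=> ki; have := maxx (T, k) TA; rewrite /sq /=; set q := corner T k => qx.
    have qnx : q != x by rewrite -Ti; apply: contra ki => /eqP/corner_inj ->.
    have : 0 < (q 0 0 - x 0 0) ^+ 2 + (q 0 1 - x 0 1) ^+ 2.
      rewrite lt_neqAle addr_ge0 ?sqr_ge0 // andbT eq_sym.
      rewrite paddr_eq0 ?sqr_ge0 // !sqrf_eq0 !subr_eq0.
      apply: contra qnx => /andP[/eqP q0 /eqP q1]; apply/eqP/rowP => l.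
      by case: (ord2P l) => ->.
    have sub l : (q - x) 0 l = q 0 l - x 0 l by rewrite [LHS]mxE [X in _ + X]mxE.
    move: qx; rewrite !sub; move: (q 0 0) (q 0 1) (x 0 0) (x 0 1) => q0 q1 x0 x1 qx q_gt.
    have -> : x0 * (q0 - x0) + x1 * (q1 - x1) = (q0 ^+ 2 + q1 ^+ 2 - (x0 ^+ 2 + x1 ^+ 2)
      - ((q0 - x0) ^+ 2 + (q1 - x1) ^+ 2)) / 2 by field.
    by rewrite pmulr_llt0 ?invr_gt0 //; lra.
  have [j ji] := other_index i; have [k [kj ki _]] := ord3P ji.
  have xE := cone_coords T x ji ki kj; rewrite Ti in xE.
  have := dot_lt j ji; have := dot_lt k ki; have := d0 j ji; have := d0 k ki.
  set a := dlam T x j in xE *; set b := dlam T x k in xE *.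
  set u := corner T j - x in xE *; set v := corner T k - x in xE * => b0 a0 v0 u0.
  have e0 : x 0 0 = a * u 0 0 + b * v 0 0 by rewrite {1}xE !mxE.
  have e1 : x 0 1 = a * u 0 1 + b * v 0 1 by rewrite {1}xE !mxE.
  have s0 : x 0 0 ^+ 2 + x 0 1 ^+ 2 = a * (x 0 0 * u 0 0 + x 0 1 * u 0 1) +
     b * (x 0 0 * v 0 0 + x 0 1 * v 0 1).
    transitivity (x 0 0 * (a * u 0 0 + b * v 0 0) + x 0 1 * (a * u 0 1 + b * v 0 1)).
      by rewrite -e0 -e1 !expr2.
    by ring.
  have au := mulr_ge0_le0 a0 (ltW u0); have bv := mulr_ge0_le0 b0 (ltW v0).
  have : x 0 0 ^+ 2 + x 0 1 ^+ 2 <= 0 by rewrite s0; lra.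
  have := sqr_ge0 (x 0 0); have := sqr_ge0 (x 0 1) => x1 x0 xs.
  have : x 0 0 ^+ 2 == 0 by apply/eqP; lra.
  have : x 0 1 ^+ 2 == 0 by apply/eqP; lra.
  rewrite !sqrf_eq0 => /eqP z1 /eqP z0; move: u0.
  by rewrite z0 z1 !mul0r addr0 ltxx.
- have TA : T \in A by move: TAx; rewrite finset.inE => /andP[].
  have [T' [k' [T'A a]]] := H T k TA.
  apply: (no T' k' _ a); rewrite finset.inE T'A; apply/existsP.
  have : edge T' k' (corner T i) by case: a => _ <-; apply: corner_edge; rewrite eq_sym.
  by move=> [/corner_shared[i' ii] _]; exists i'; rewrite -ii Ti.
Qed.

End triangulation_domain.

(** * Boundary stars and interior stars *)

Section triangulation_stars.
Variables (R : realType) (M : triangulation R).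
Implicit Types (T : tri M) (x y z w : 'rV[R]_2) (k : 'I_3).

Local Notation nd := tri_nondegenerate.
Local Notation lam T x k := (bary (vtx T) x 0 k).
Local Notation dlam T w k := (dbary (vtx T) w 0 k).
Local Notation inside := (inside M).

Lemma adjacent_inside T k T' k' : adjacent T k T' k' ->
  exists m, [/\ edge T k m, in_tri T m, in_tri T' m & inside m].
Proof.
move=> a; have [m [mE mP]] := edge_mid T k; exists m; split=> //.
- by case: mE.
- by move: mE; rewrite (proj2 a) => -[].
- apply: filterS (adjacent_interior a mE _) => [y [yT|yT']|l lk].
  + by exists T.
  + by exists T'.
  + by rewrite mP // invr_gt0 ltr0n.
Qed.

Lemma lam_lin T (t : R) x w k : lam T (x + t *: w) k = lam T x k + t * dlam T w k.
Proof. by rewrite baryD linearZ [LHS]mxE [X in _ + X]mxE. Qed.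

Lemma lam_seg T (t : R) x y k :
  lam T (x + t *: (y - x)) k = (1 - t) * lam T x k + t * lam T y k.
Proof. by rewrite segE bary_lin. Qed.

Lemma edge_ncorner T k i : edge T k (corner T i) -> k != i.
Proof.
move=> [_]; rewrite -/(lam _ _ _) lam_corner; case: (k == i) => // /eqP.
by rewrite oner_eq0.
Qed.

(** There are uncovered points [z] so close to [x] that, in every triangle with corner [x], the
    coordinate of that corner is still positive at [z]. Since [z] is outside, another coordinate is
    negative there, so [z - x] lies in no cone. *)
Lemma outside_direction x : ~ inside x -> exists w, forall T i,
  corner T i = x -> exists2 k, k != i & dlam T w k < 0.
Proof.
move=> nx.
have Fx : Filter (nbhs x) by exact: nbhs_filter.
have near_x : nbhs x [set z | forall p : tri M * 'I_3, corner p.1 p.2 = x ->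
    0 < lam p.1 z p.2].
  apply: (@filter_forall _ _ (fun (p : tri M * 'I_3) => [set z | corner p.1 p.2 = x ->
    0 < lam p.1 z p.2]) _ Fx) => -[T i] /=.
  have [xT|xT] := pselect (corner T i = x); last by apply: filterS filterT => z _ /xT.
  have : 0 < lam T x i by rewrite -xT lam_corner eqxx.
  by move=> /bary_gt0_near; apply: filterS => z zT _.
have [z [zP zU]] : exists z, (forall p : tri M * 'I_3, corner p.1 p.2 = x ->
    0 < lam p.1 z p.2) /\ ~ covered M z.
  apply: contrapT => H; apply: nx; apply: filterS near_x => z zP.
  by apply: contrapT => zU; apply: H; exists z.
exists (z - x) => T i Ti; apply: contrapT => H; apply: zU; exists T.
apply/in_triP => k; have [->|ki] := eqVneq k i; first exact/ltW/(zP (T, i)).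
have -> : lam T z k = lam T (x + 1 *: (z - x)) k by rewrite scale1r addrC subrK.
rewrite lam_lin mul1r -Ti lam_corner (negPf ki) add0r Ti leNgt; apply/negP => kn.
by apply: H; exists k.
Qed.

(** Around a boundary vertex, adjacency has no cycles: [fan_end] supplies a triangle with a free
    edge at [x], hence with at most one neighbour across an edge at [x]. Removing it and arguing by
    induction, any antisymmetric jumps can be realized. *)
Lemma boundary_potential_on (c : tri M -> tri M -> R) x n (A : {set tri M}) :
  (forall T k T' k', adjacent T k T' k' -> c T T' = - c T' T) ->
  ~ inside x -> (#|A| <= n)%N -> (forall T, T \in A -> exists i, corner T i = x) ->
  exists kap : tri M -> R, forall T k T' k', T \in A -> T' \in A ->
    adjacent T k T' k' -> edge T k x -> kap T - kap T' = c T T'.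
Proof.
move=> cN nx; have [w wP] := outside_direction nx.
elim: n A => [|n IH] A An Ax.
  exists (fun=> 0) => T k T' k' TA.
  by move: An; rewrite leqn0 cards_eq0 => /eqP A0; rewrite A0 finset.inE in TA.
have [A0|A0] := eqVneq A finset.set0.
  by exists (fun=> 0) => T k T' k' TA; rewrite A0 finset.inE in TA.
have [T0 [i0 [k0 [T0A T0i ki0 k0P]]]] := fan_end A0 Ax (fun T i _ => wP T i).
have [||kap kapP] := IH (A :\ T0)%SET.
- by rewrite -ltnS; apply: leq_trans An; rewrite [in X in (_ < X)%N](cardsD1 T0) T0A.
- by move=> T /finset.setD1P[_ /Ax].
pose Q T := T \in A /\ exists k k', adjacent T0 k T k' /\ edge T0 k x.
have Qk k T k' : T \in A -> adjacent T0 k T k' -> edge T0 k x -> k != i0 /\ k != k0.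
  move=> TA a xk; split; first by apply: (@edge_ncorner T0); rewrite T0i.
  by apply/eqP => kk; apply: (k0P T k' TA); rewrite -kk.
have Qu T T' : Q T -> Q T' -> T = T'.
  move=> [TA [k [k' [a xk]]]] [TA' [l [l' [b xl]]]].
  have [kn kn'] := Qk _ _ _ TA a xk; have [ln ln'] := Qk _ _ _ TA' b xl.
  have [j [j1 j2 jP]] := ord3P ki0.
  have kl : k = l.
    case: (jP k) => E; case: (jP l) => E'; rewrite ?E ?E' //; move: kn kn' ln ln';
      by rewrite ?E ?E' ?eqxx.
  by apply: (adjacent_unique a (k'' := l')); rewrite kl.
(* The value at [T0] is dictated by its only possible neighbour, and arbitrary if there is none. *)
have [v vP] : exists v, forall T, Q T -> v = kap T + c T0 T.
  have [[T QT]|nQ] := pselect (exists T, Q T).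
    by exists (kap T + c T0 T) => T' QT'; rewrite (Qu _ _ QT QT').
  by exists 0 => T QT; case: nQ; exists T.
exists (fun T => if T == T0 then v else kap T) => T k T' k' TA T'A a xk.
have [TT0|TT0] := eqVneq T T0; have [TT0'|TT0'] := eqVneq T' T0.
- by case: a; rewrite TT0 TT0' eqxx.
- have QT' : Q T' by split=> //; exists k, k'; rewrite -TT0.
  by rewrite (vP T' QT') addrAC subrr add0r TT0.
- have QT : Q T.
    split=> //; exists k', k; rewrite -TT0' -(proj2 a); split=> //.
    exact: adjacent_sym.
  by rewrite (vP T QT) opprD addrA subrr add0r -TT0' (cN _ _ _ _ a).
- by apply: (kapP T k T' k') => //; apply/finset.setD1P.
Qed.

Lemma boundary_potential (c : tri M -> tri M -> R) x :
  (forall T k T' k', adjacent T k T' k' -> c T T' = - c T' T) ->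
  ~ inside x ->
  exists kap : tri M -> R, forall T k T' k' i, corner T i = x ->
    adjacent T k T' k' -> edge T k x -> kap T - kap T' = c T T'.
Proof.
move=> cN nx; pose A := [set T : tri M | [exists i, corner T i == x]]%SET.
have [T|kap kapP] := boundary_potential_on cN nx (leqnn #|A|).
  by rewrite finset.inE => /existsP[i /eqP Ti]; exists i.
exists kap => T k T' k' i Ti a xk; apply: (kapP T k T' k') => //.
  by rewrite finset.inE; apply/existsP; exists i; rewrite Ti.
have [xT' _] : edge T' k' x by rewrite -(proj2 a).
rewrite finset.inE; apply/existsP; rewrite -Ti in xT'.
by have [i' ii] := corner_shared xT'; exists i'; rewrite -ii Ti.
Qed.

Definition center T : 'rV[R]_2 := \sum_i 3^-1 *: corner T i.

Lemma lam_center T k : lam T (center T) k = 3^-1.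
Proof.
suff -> : bary (vtx T) (center T) = const_mx 3^-1 by rewrite mxE.
apply: (bary_unique (nd T)).
  by rewrite mulmx_sum_row; apply: eq_bigr => i _; rewrite mxE.
by rewrite !big_ord_recl big_ord0 !mxE; field.
Qed.

Lemma center_inner T k : 0 < lam T (center T) k.
Proof. by rewrite lam_center invr_gt0 ltr0n. Qed.

Lemma center_in T : in_tri T (center T).
Proof. by apply/in_triP => k; exact/ltW/center_inner. Qed.

Lemma center_inside T : inside (center T).
Proof.
apply: filterS (near_pos (P := predT) (fun k _ => center_inner T k)) => z zP.
by exists T; apply/in_triP => k; exact/ltW/zP.
Qed.

(** At a vertex, let [A] be the triangles at [x] with the value of [T], and aim [w] at the center of
    [T']. A cone of [A] containing [w] could only belong to [T'], which has another value. So
    [fan_end] gives an edge at [x] without neighbour in [A]; but [x] is interior, so that edge has a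
    neighbour, and it carries the same value. *)
Lemma star_constant (kap : tri M -> R) x T T' :
  (forall T k T' k', adjacent T k T' k' -> edge T k x -> kap T = kap T') ->
  inside x -> in_tri T x -> in_tri T' x -> kap T = kap T'.
Proof.
move=> kapP ix xT xT'; have [->//|TT] := eqVneq T T'.
case: (conforming TT xT xT') => [[i [i' [ii I]]]|[k [k' [kk I]]]]; last first.
  by apply: (kapP T k T' k') => //; exact: I.
have Ti : corner T i = x by rewrite (I _ xT xT').
have Ti' : corner T' i' = x by rewrite -ii.
apply/eqP/negPn/negP => nkap.
pose A := [set T1 : tri M | [exists i, corner T1 i == x] && (kap T1 == kap T)]%SET.
have AP T1 : T1 \in A -> (exists i, corner T1 i = x) /\ kap T1 = kap T.
  by rewrite finset.inE => /andP[/existsP[j /eqP Tj] /eqP]; split; first exists j.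
have [||T1 i1 T1A T1i|T1 [i1 [k1 [T1A T1i ki1 k1P]]]] := @fan_end _ _ A x (center T' - x).
- apply/finset.set0Pn; exists T; rewrite finset.inE eqxx andbT.
  by apply/existsP; exists i; rewrite Ti.
- by move=> T1 /AP[].
- apply: contrapT => H; have [_ kap1] := AP _ T1A.
  have d0 k : k != i1 -> 0 <= dlam T1 (center T' - x) k.
    by move=> ki; rewrite leNgt; apply/negP => kn; apply: H; exists k.
  have near_x : nbhs x [set z | forall k, k == i1 -> 0 < lam T1 z k].
    by apply: (near_pos (P := pred1 i1)) => k /= /eqP ->; rewrite -T1i lam_corner eqxx.
  have [t /andP[t0 t1] tP] := near_pick (center T' - x) near_x.
  have zT1 : in_tri T1 (x + t *: (center T' - x)).
    apply/in_triP => k; have [->|ki] := eqVneq k i1.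
      by apply/ltW/tP; rewrite // lexx ltW.
    by rewrite lam_lin -T1i lam_corner (negPf ki) add0r T1i mulr_ge0 ?d0 // ltW.
  suff : T' = T1 by move=> e; move: nkap; rewrite -kap1 -e eqxx.
  apply: inner_point_unique zT1 => k; rewrite lam_seg.
  have t1' : 0 <= 1 - t by rewrite subr_ge0 ltW.
  rewrite ltr_wpDl ?mulr_gt0 ?center_inner // mulr_ge0 //.
  exact: (in_triP _ _).1.
- have [m [mE mP]] := edge_mid T1 k1.
  have [t /andP[t0 t1] tP] := near_pick (m - x) (inside_near ix).
  have iy := tP t; rewrite lexx ltW // in iy.
  have yE : edge T1 k1 (x + t *: (m - x)).
    split; last by rewrite -/(lam _ _ _) lam_seg -T1i lam_corner (negPf ki1); case: mE => _ ->; rewrite !mulr0 addr0.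
    rewrite segE; apply: in_tri_convex; rewrite ?ltW //; last by case: mE.
    by rewrite -T1i; exact: corner_in.
  have [|T2 [k2 a]] := open_edge_shared (iy isT) yE.
    move=> l lk; rewrite lam_seg mP // ltr_wpDl ?mulr_gt0 ?invr_gt0 ?ltr0n //.
    have t1' : 0 <= 1 - t by rewrite subr_ge0 ltW.
    by rewrite mulr_ge0 // -T1i lam_corner ler0n.
  have xE : edge T1 k1 x by rewrite -T1i; apply: corner_edge; rewrite eq_sym.
  apply: (k1P T2 k2 _ a); rewrite finset.inE -(kapP _ _ _ _ a xE) (AP _ T1A).2 eqxx andbT.
  have [xT2 _] : edge T2 k2 x by rewrite -(proj2 a).
  rewrite -T1i in xT2; have [i2 ii2] := corner_shared xT2.
  by apply/existsP; exists i2; rewrite -ii2 T1i.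
Qed.

End triangulation_stars.

(** * Integrals of locally additive functions *)

Section local_integral.
Variable R : realType.
Implicit Types (a b t u v e : R) (G : R -> R -> R) (K : R -> R).

Definition near_in a b t e : set R := [set u | a <= u <= b /\ `|u - t| < e].

(** Compactness of the interval in Cousin's form: the supremum of the endpoints reachable from [a]
    is itself reachable, and could be exceeded if it were less than [b]. It takes the place of fine
    subdivisions in all later arguments. *)
Lemma interval_chain (P : R -> R -> Prop) a b : a <= b ->
  (forall u v w, a <= u -> u <= v -> v <= w -> w <= b -> P u v -> P v w -> P u w) ->
  (forall t, a <= t <= b -> exists2 e : R, 0 < e & forall u v, u <= v ->
     near_in a b t e u -> near_in a b t e v -> P u v) ->
  P a b.
Proof.
move=> ab Padd Ploc.
pose S := [set t | a <= t <= b /\ P a t].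
have Sa : S a.
  split; first by rewrite lexx.
  have [|e e0 eP] := Ploc a; first by rewrite lexx.
  by apply: eP => //; split; rewrite ?lexx // subrr normr0.
have Sub : has_sup S by split; [exists a|exists b => t [/andP[]]].
set s := sup S; have as_ : a <= s by apply: ub_le_sup => //; case: Sub.
have sb : s <= b by apply: ge_sup; [exists a|move=> t [/andP[]]].
have [|e e0 eP] := Ploc s; first by rewrite as_.
have [t [/andP[at_ tb] Pt] st] := sup_adherent e0 Sub.
have ts : t <= s by apply: ub_le_sup; [case: Sub|split; rewrite ?at_].
pose r := Num.min (s + e / 2) b.
have e2 : 0 < e / 2 by rewrite divr_gt0.
have sr : s <= r by rewrite le_min sb andbT lerDl ltW.
have rb : r <= b by rewrite ge_min lexx orbT.
have tr : t <= r by apply: le_trans sr.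
have Pr : P a r.
  apply: (Padd a t r) => //; apply: eP => //; split.
  - by rewrite at_.
  - by rewrite ler0_norm ?subr_le0 // opprB ltrBlDr addrC -ltrBlDr.
  - by rewrite rb andbT (le_trans as_).
  - rewrite ger0_norm ?subr_ge0 // ltrBlDl; apply: le_lt_trans (_ : s + e / 2 < _).
      by rewrite ge_min lexx.
    by rewrite ltrD2l ltr_pdivrMr // mulr_natr mulr2n ltrDl.
have Sr : S r by split=> //; rewrite rb andbT (le_trans as_).
have rs : r <= s by apply: ub_le_sup => //; case: Sub.
move: rs; rewrite /r ge_min => /orP[|bs]; first by rewrite gerDl leNgt e2.
by move: Pr; rewrite /r min_r // (le_trans bs) // lerDl ltW.
Qed.

Definition locally_additive a b G : Prop :=
  forall t, a <= t <= b -> exists2 e, 0 < e & forall u v w,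
    near_in a b t e u -> near_in a b t e v -> near_in a b t e w ->
    G u v + G v w = G u w.

(** [G] is the increment of [K] between nearby parameters only, as for a branch of the logarithm
    continued along a path. *)
Definition primitive a b G K : Prop :=
  forall t, a <= t <= b -> exists2 e, 0 < e & forall u v,
    near_in a b t e u -> near_in a b t e v -> K v - K u = G u v.

Lemma near_in_min a b t e e' u : near_in a b t (Num.min e e') u ->
  near_in a b t e u /\ near_in a b t e' u.
Proof. by move=> [uab]; rewrite lt_min => /andP[? ?]. Qed.

Lemma near_in_sub a b a' b' t e u : a' <= a -> b <= b' ->
  near_in a b t e u -> near_in a' b' t e u.
Proof. by move=> aa bb [/andP[au ub] ute]; split; rewrite ?(le_trans aa) ?(le_trans ub). Qed.

Lemma primitive_sub a b a' b' G K : a' <= a -> b <= b' ->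
  primitive a' b' G K -> primitive a b G K.
Proof.
move=> aa bb KP t /andP[at_ tb].
have [|e e0 eP] := KP t; first by rewrite (le_trans aa) ?(le_trans tb).
by exists e => // u v uP vP; apply: eP; apply: near_in_sub; eassumption.
Qed.

Lemma locally_additive_sub a b a' b' G : a' <= a -> b <= b' ->
  locally_additive a' b' G -> locally_additive a b G.
Proof.
move=> aa bb GP t /andP[at_ tb].
have [|e e0 eP] := GP t; first by rewrite (le_trans aa) ?(le_trans tb).
by exists e => // u v w uP vP wP; apply: eP; apply: near_in_sub; eassumption.
Qed.

Lemma primitive_unique a b G K K' : a <= b -> primitive a b G K -> primitive a b G K' ->
  K b - K a = K' b - K' a.
Proof.
move=> ab KP KP'.
apply: (@interval_chain (fun u v => K v - K u = K' v - K' u)) => //.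
  by move=> u v w _ _ _ _ uv vw; rewrite -(subrKA (K v)) vw uv subrKA.
move=> t tab; have [e e0 eP] := KP t tab; have [e' e0' eP'] := KP' t tab.
exists (Num.min e e'); first by rewrite lt_min e0.
by move=> u v _ /near_in_min[u1 u2] /near_in_min[v1 v2]; rewrite eP // eP'.
Qed.

Lemma primitive_exists a b G : a <= b -> locally_additive a b G ->
  exists K, primitive a b G K.
Proof.
move=> ab GP; apply: (@interval_chain (fun u v => exists K, primitive u v G K)) => //.
  move=> u v w au uv vw wb [K KP] [K' KP'].
  (* Glue the two primitives at [v], after shifting the right one by a constant. *)
  exists (fun t => if t <= v then K t else K' t - K' v + K v) => t /andP[ut tw].
  have [|e3 e30 e3P] := GP t; first by rewrite (le_trans au) ?(le_trans tw).
  have in_ab e s : near_in u w t e s -> near_in a b t e s by apply: near_in_sub.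
  have [tv|vt|tv] := ltgtP t v.
  - have [|e e0 eP] := KP t; first by rewrite ut ltW.
    exists (Num.min e (v - t)); first by rewrite lt_min e0 subr_gt0.
    have small s : near_in u w t (Num.min e (v - t)) s -> s <= v /\ near_in u v t e s.
      move=> /near_in_min[[/andP[us sw] st] [_ st']].
      have sv : s <= v by move: st'; rewrite ltr_norml => /andP[_]; rewrite ltrD2r => /ltW.
      by split=> //; split; rewrite ?us.
    by move=> s s' /small[sv sP] /small[sv' sP']; rewrite sv sv' eP.
  - have [|e e0 eP] := KP' t; first by rewrite tw ltW.
    exists (Num.min e (t - v)); first by rewrite lt_min e0 subr_gt0.
    have small s : near_in u w t (Num.min e (t - v)) s -> v < s /\ near_in v w t e s.
      move=> /near_in_min[[/andP[us sw] st] [_ st']].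
      have sv : v < s by move: st'; rewrite ltr_norml opprB ltrD2r => /andP[].
      by split=> //; split; rewrite ?sw ?andbT ?ltW.
    move=> s s' /small[sv sP] /small[sv' sP']; rewrite (lt_geF sv) (lt_geF sv').
    by rewrite opprD addrACA subrr addr0 opprB addrA subrK eP.
  have {}tv : t = v by [].
  have [|e e0 eP] := KP t; first by rewrite ut tv lexx.
  have [|e' e0' eP'] := KP' t; first by rewrite tw tv lexx.
  exists (Num.min e (Num.min e' e3)); first by rewrite !lt_min e0 e0' e30.
  have near_v e4 : 0 < e4 -> near_in u w t e4 v.
    by move=> e40; split; rewrite ?uv ?vw // tv subrr normr0.
  move=> s s' /near_in_min[s1 /near_in_min[s2 s3]] /near_in_min[s1' /near_in_min[s2' s3']].
  have v3 := near_v _ e30.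
  have L r : near_in u w t e r -> r <= v -> near_in u v t e r.
    by move=> [/andP[ur rw] rt] rv; split; rewrite ?ur.
  have L' r : near_in u w t e' r -> v <= r -> near_in v w t e' r.
    by move=> [/andP[ur rw] rt] rv; split; rewrite ?rv.
  have Lv : near_in u v t e v by split; rewrite ?uv ?lexx // tv subrr normr0.
  have Lv' : near_in v w t e' v by split; rewrite ?vw ?lexx // tv subrr normr0.
  have G3 r r' r'' : near_in u w t e3 r -> near_in u w t e3 r' -> near_in u w t e3 r'' ->
    G r r' + G r' r'' = G r r'' by move=> *; apply: e3P; apply: in_ab.
  have [sv|sv] := leP s v; have [sv'|sv'] := leP s' v.
  - by apply: eP; apply: L.
  - have := eP _ _ (L _ s1 sv) Lv; have := eP' _ _ Lv' (L' _ s2' (ltW sv')).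
    have := G3 _ _ _ s3 v3 s3'; lra.
  - have := eP _ _ Lv (L _ s1' sv'); have := eP' _ _ (L' _ s2 (ltW sv)) Lv'.
    have := G3 _ _ _ s3 v3 s3'; lra.
  - have := eP' _ _ (L' _ s2 (ltW sv)) (L' _ s2' (ltW sv')); lra.
move=> t tab; have [e e0 eP] := GP t tab; exists e => // u v uv uP vP.
(* [G t] is a primitive by additivity. Any radius works, as the whole interval from [u] to [v] lies
   in the neighbourhood of [t]. *)
exists (G t) => s suv; exists 1 => // r r' [ruv _] [ruv' _].
have nt : near_in a b t e t by split=> //; rewrite subrr normr0.
have nr r1 : u <= r1 <= v -> near_in a b t e r1.
  case: uP vP => [/andP[au _] ut] [/andP[_ vb] vt] /andP[u1 v1]; split.
    by rewrite (le_trans au) // (le_trans v1).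
  move: ut vt; rewrite !ltr_norml => /andP[ut _] /andP[_ vt].
  by rewrite (lt_le_trans ut) ?lerD2r //= (le_lt_trans _ vt) ?lerD2r.
by rewrite -(eP t r r' nt (nr r ruv) (nr r' ruv')) addrAC subrr add0r.
Qed.

(** The total increment of a primitive, independent of its choice by [primitive_unique]; the value
    is 0 when there is none. *)
Definition local_integral a b G : R :=
  xget 0 [set r | exists K, primitive a b G K /\ r = K b - K a].

Lemma local_integralE a b G K : a <= b -> primitive a b G K ->
  local_integral a b G = K b - K a.
Proof.
move=> ab KP; rewrite /local_integral; case: xgetP => [r _ [K' [KP' ->]]|/(_ (K b - K a))].
  exact: primitive_unique KP.
by case; exists K.
Qed.

Lemma local_integralD a b c G : a <= b -> b <= c -> locally_additive a c G ->
  local_integral a c G = local_integral a b G + local_integral b c G.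
Proof.
move=> ab bc /(primitive_exists (le_trans ab bc))[K KP].
rewrite (local_integralE (le_trans ab bc) KP).
rewrite (local_integralE ab (primitive_sub (lexx _) bc KP)).
rewrite (local_integralE bc (primitive_sub ab (lexx _) KP)).
by ring.
Qed.

Lemma local_integral_additive a b G : a <= b ->
  (forall u v w, a <= u <= b -> a <= v <= b -> a <= w <= b -> G u v + G v w = G u w) ->
  local_integral a b G = G a b.
Proof.
move=> ab GP; have aab : a <= a <= b by rewrite lexx.
have bab : a <= b <= b by rewrite lexx andbT.
rewrite (@local_integralE a b G (G a)) //.
  by have := GP a a b aab aab bab; lra.
move=> t tab; exists 1 => // u v [uab _] [vab _].
by rewrite -(GP a u v aab uab vab) addrAC subrr add0r.
Qed.

Lemma local_integral_lin a b (c : R) G G' : a <= b ->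
  locally_additive a b G -> locally_additive a b G' ->
  local_integral a b (fun u v => c * G u v + G' u v) =
  c * local_integral a b G + local_integral a b G'.
Proof.
move=> ab /(primitive_exists ab)[K KP] /(primitive_exists ab)[K' KP'].
rewrite (local_integralE ab KP) (local_integralE ab KP').
rewrite (@local_integralE a b _ (fun t => c * K t + K' t)) //; first by ring.
move=> t tab; have [e e0 eP] := KP t tab; have [e' e0' eP'] := KP' t tab.
exists (Num.min e e'); first by rewrite lt_min e0.
move=> u v /near_in_min[u1 u2] /near_in_min[v1 v2].
by rewrite -eP // -eP' //; ring.
Qed.

(** Both ways around a rectangle give the same sum. The identity adds up when rectangles are
    juxtaposed, and on a small one the integrals are values of [G]. The chain argument runs in the
    second variable and, for each [t], in the first; there the radius around [t] belongs to the
    chained property. *)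
Lemma local_integral_rectangle (G : R -> R -> R -> R -> R) :
  (forall s t, 0 <= s <= 1 -> 0 <= t <= 1 -> exists2 e, 0 < e &
     forall u u' v v' w w',
     near_in 0 1 s e u -> near_in 0 1 s e v -> near_in 0 1 s e w ->
     near_in 0 1 t e u' -> near_in 0 1 t e v' -> near_in 0 1 t e w' ->
     G u u' v v' + G v v' w w' = G u u' w w') ->
  local_integral 0 1 (fun u v => G u 0 v 0) + local_integral 0 1 (fun u v => G 1 u 1 v) =
  local_integral 0 1 (fun u v => G 0 u 0 v) + local_integral 0 1 (fun u v => G u 1 v 1).
Proof.
move=> GP.
pose H a b c := local_integral a b (fun u v => G u c v c).
pose V a c d := local_integral c d (fun u v => G a u a v).
have HA c : 0 <= c <= 1 -> locally_additive 0 1 (fun u v => G u c v c).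
  move=> c01 t t01; have [e e0 eP] := GP t c t01 c01; exists e => // u v w *.
  by apply: eP => //; split; rewrite // subrr normr0.
have VA a : 0 <= a <= 1 -> locally_additive 0 1 (fun u v => G a u a v).
  move=> a01 t t01; have [e e0 eP] := GP a t a01 t01; exists e => // u v w *.
  by apply: eP => //; split; rewrite // subrr normr0.
pose Q a b c d := H a b c + V b c d = V a c d + H a b d.
apply: (@interval_chain (Q 0 1)) => //.
  move=> c d e c0 cd de e1 q1 q2; rewrite /Q /V.
  have VD a : 0 <= a <= 1 -> V a c e = V a c d + V a d e.
    move=> a01; apply: local_integralD => //.
    by apply: locally_additive_sub (VA a a01).
  rewrite -!/(V _ _ _) !VD ?lexx ?ler01 //; move: q1 q2; rewrite /Q; lra.
move=> t t01.
suff : exists2 e : R, 0 < e & forall c d, c <= d -> near_in 0 1 t e c ->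
    near_in 0 1 t e d -> Q 0 1 c d by [].
apply: (@interval_chain (fun a b => exists2 e : R, 0 < e & forall c d, c <= d ->
    near_in 0 1 t e c -> near_in 0 1 t e d -> Q a b c d)) => //.
  move=> a b b' a0 ab bb b1 [e e0 eP] [e' e0' eP'].
  exists (Num.min e e'); first by rewrite lt_min e0.
  move=> c d cd /near_in_min[c1 c2] /near_in_min[d1 d2].
  have HD c' : 0 <= c' <= 1 -> H a b' c' = H a b c' + H b b' c'.
    move=> c01; apply: local_integralD => //.
    by apply: locally_additive_sub (HA c' c01).
  have := eP c d cd c1 d1; have := eP' c d cd c2 d2.
  have [c01 _] := c1; have [d01 _] := d1.
  by rewrite /Q (HD c c01) (HD d d01); lra.
move=> s s01; have [e e0 eP] := GP s t s01 t01; exists e => // a b ab aP bP.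
exists e => // c d cd cP dP.
have between s' x y z : near_in 0 1 s' e x -> near_in 0 1 s' e y -> x <= z <= y ->
    near_in 0 1 s' e z.
  move=> [/andP[x0 _] xs] [/andP[_ y1] ys] /andP[xz zy]; split.
    by rewrite (le_trans x0) // (le_trans zy).
  move: xs ys; rewrite !ltr_norml => /andP[xs _] /andP[_ ys].
  by rewrite (lt_le_trans xs) ?lerD2r //= (le_lt_trans _ ys) ?lerD2r.
have Hs c' : near_in 0 1 t e c' -> H a b c' = G a c' b c'.
  move=> c'P; apply: local_integral_additive => // u v w uab vab wab.
  by apply: eP => //; apply: (between s a b).
have Vs a' : near_in 0 1 s e a' -> V a' c d = G a' c a' d.
  move=> a'P; apply: local_integral_additive => // u v w uab vab wab.
  by apply: eP => //; apply: (between t c d).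
by rewrite /Q !Hs // !Vs // !eP.
Qed.

Lemma local_integral_ext a b (G G' : R -> R -> R) :
  (forall u v, a <= u <= b -> a <= v <= b -> G u v = G' u v) ->
  local_integral a b G = local_integral a b G'.
Proof.
move=> GG; rewrite /local_integral; congr (xget 0 _); apply/funext => r.
apply/propext; split=> -[K [KP ->]]; exists K; split=> // t tab;
  have [e e0 eP] := KP t tab; exists e => // u v uP vP; rewrite (eP _ _ uP vP);
  by rewrite GG //; [case: uP|case: vP].
Qed.

(** The result is expressed by a primitive so that a decreasing [h], as for a path run backwards, is
    covered too. *)
Lemma local_integral_comp a b a' b' (L : R) (h : R -> R) G K :
  a' <= b' -> 0 < L -> (forall u, a' <= u <= b' -> a <= h u <= b) ->
  (forall u v, `|h u - h v| <= L * `|u - v|) -> primitive a b G K ->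
  local_integral a' b' (fun u v => G (h u) (h v)) = K (h b') - K (h a').
Proof.
move=> ab L0 hab hL KP; apply: (local_integralE (K := K \o h)) => // t tab.
have [e e0 eP] := KP (h t) (hab t tab); exists (e / L); first exact: divr_gt0.
have near_h u : near_in a' b' t (e / L) u -> near_in a b (h t) e (h u).
  move=> [uab ut]; split; first exact: hab.
  by apply: le_lt_trans (hL u t) _; rewrite mulrC -ltr_pdivlMr.
by move=> u v uP vP; apply: eP; exact: near_h.
Qed.

End local_integral.

(** * Singular simplices and paths *)

Section simplices.
Variables (R : realType) (Omega : set 'rV[R]_2).
Local Notation X := (set_type Omega).
Local Notation pt := 'rV[R]_2.

(** Retraction onto the unit interval: precomposed with it, paths and simplices become maps on the
    whole line, continuous in the plain sense. *)
Definition clamp (t : R) : R := Num.max 0 (Num.min 1 t).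

Lemma clamp_in t : 0 <= clamp t <= 1.
Proof. by rewrite le_max lexx /= ge_max ler01 ge_min lexx. Qed.

Lemma clampE t : 0 <= t <= 1 -> clamp t = t.
Proof. by move=> /andP[t0 t1]; rewrite /clamp min_r // max_r. Qed.

Lemma clamp_ge1 t : 1 <= t -> clamp t = 1.
Proof. by move=> t1; rewrite /clamp min_l // max_r. Qed.

Lemma clamp_le0 t : t <= 0 -> clamp t = 0.
Proof. by move=> t0; rewrite /clamp min_r ?max_l // (le_trans t0). Qed.

Lemma clamp_continuous : continuous clamp.
Proof.
move=> t; apply: continuous_max; first exact: cst_continuous.
apply: continuous_min; first exact: cst_continuous.
exact: cvg_id.
Qed.

Lemma continuous_sub_type (T : topologicalType) n (A : set 'rV[R]_n)
    (f : T -> set_type A) :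
  continuous (fun x => set_val (f x) : 'rV[R]_n) -> continuous f.
Proof. by move=> fc; exact: continuous_comp_initial. Qed.

Lemma continuous_pair (T U V : topologicalType) (f : T -> U) (g : T -> V) :
  continuous f -> continuous g -> continuous (fun x => (f x, g x)).
Proof. by move=> fc gc x; exact: cvg_pair (fc x) (gc x). Qed.

Lemma continuous_rowP (T : topologicalType) n (f : T -> 'rV[R]_n) :
  (forall j, continuous (fun x => f x 0 j)) -> continuous f.
Proof.
move=> fc x; have Fx : Filter (nbhs x) by exact: nbhs_filter.
apply/cvg_ballP => e e0.
have := @filter_forall T 'I_n (fun j => [set y | ball (f x 0 j) e (f y 0 j)]) _ Fx _.
move=> H; apply: filterS (H _) => [y yP|j].
  by split=> // i j; rewrite ord1; exact: yP.
by apply: (fc j x); exact: nbhsx_ballx.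
Qed.

Lemma set_val_continuous n (A : set 'rV[R]_n) :
  continuous (fun x : set_type A => set_val x : 'rV[R]_n).
Proof. by move=> x; exact: initial_continuous. Qed.

Lemma simplex_coord_continuous k j :
  continuous (fun l : stdsimplex R k => (set_val l : 'rV[R]_k.+1) 0 j).
Proof.
move=> l; apply: (@continuous_comp _ _ _ (fun l : stdsimplex R k => set_val l : 'rV[R]_k.+1)
  (fun v => v 0 j)); first exact: set_val_continuous.
exact: continuous_coord.
Qed.

Definition row2 (a b : R) : 'rV[R]_2 := \row_j nth 0 [:: a; b] j.
Definition row3 (a b c : R) : 'rV[R]_3 := \row_j nth 0 [:: a; b; c] j.

Lemma edge_point_subproof t : row2 (1 - clamp t) (clamp t) \in stdsimplex R 1.
Proof.
have /andP[t0 t1] := clamp_in t; apply/mem_set; split.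
  by move=> j; rewrite mxE; case: j => [[|[|//]]] _ //=; rewrite subr_ge0.
by rewrite !big_ord_recl big_ord0 !mxE /= addr0 subrK.
Qed.

Definition edge_point t : stdsimplex R 1 := SigSub (edge_point_subproof t).

Lemma edge_point_continuous : continuous edge_point.
Proof.
apply: continuous_sub_type; apply: continuous_rowP => j.
under eq_fun do rewrite /= mxE.
case: j => [[|[|//]]] _ /=; last exact: clamp_continuous.
by apply: continuous_rsub; [exact: cst_continuous|exact: clamp_continuous].
Qed.

Lemma triangle_point_subproof (q : R * R) :
  row3 (1 - clamp q.1) (clamp q.1 - clamp q.1 * clamp q.2) (clamp q.1 * clamp q.2)
    \in stdsimplex R 2.
Proof.
have /andP[u0 u1] := clamp_in q.1; have /andP[v0 v1] := clamp_in q.2.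
apply: mem_set; split.
  move=> j; rewrite mxE; case: j => [[|[|[|//]]]] _ //=.
  - by rewrite subr_ge0.
  - by rewrite subr_ge0 ler_piMr.
  - by rewrite mulr_ge0.
by rewrite !big_ord_recl big_ord0 !mxE /= addr0 subrK subrK.
Qed.

(* The square, with the side [u = 0] collapsed to the vertex 0. *)
Definition triangle_point q : stdsimplex R 2 := SigSub (triangle_point_subproof q).

Lemma triangle_point_continuous : continuous triangle_point.
Proof.
have c1 : continuous (fun q : R * R => clamp q.1).
  by move=> q; apply: continuous_comp; [exact: continuous_fst|exact: clamp_continuous].
have c2 : continuous (fun q : R * R => clamp q.2).
  by move=> q; apply: continuous_comp; [exact: continuous_snd|exact: clamp_continuous].
have c3 := continuous_rmul c1 c2.
apply: continuous_sub_type; apply: continuous_rowP => j.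
under eq_fun do rewrite /= mxE.
case: j => [[|[|[|//]]]] _ /=.
- by apply: continuous_rsub => //; exact: cst_continuous.
- exact: continuous_rsub.
- exact: c3.
Qed.

Definition path_of (s : singular_simplex R X 1) (t : R) : pt :=
  set_val ((set_val s : stdsimplex R 1 -> X) (edge_point t)).

Definition square_of (s : singular_simplex R X 2) (q : R * R) : pt :=
  set_val ((set_val s : stdsimplex R 2 -> X) (triangle_point q)).

Lemma path_of_in s t : Omega (path_of s t).
Proof. exact: set_valP. Qed.

Lemma square_of_in s q : Omega (square_of s q).
Proof. exact: set_valP. Qed.

Lemma path_of_continuous s : continuous (path_of s).
Proof.
move=> t; apply: (@continuous_comp _ _ _ (set_val s \o edge_point) (fun x : X => set_val x)).
  apply: continuous_comp; first exact: edge_point_continuous.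
  exact: (set_valP s).
exact: set_val_continuous.
Qed.

Lemma square_of_continuous s : continuous (square_of s).
Proof.
move=> q; apply: (@continuous_comp _ _ _ (set_val s \o triangle_point) (fun x : X => set_val x)).
  apply: continuous_comp; first exact: triangle_point_continuous.
  exact: (set_valP s).
exact: set_val_continuous.
Qed.

Lemma path_of_face s (i : 'I_3) (h : R -> R * R) :
  (forall t, face_map i (edge_point t) = triangle_point (h t)) ->
  path_of (face i s) = fun t => square_of s (h t).
Proof. by move=> hP; apply/funext => t; rewrite /square_of -hP. Qed.

Lemma ord1P (j : 'I_2) : j = 0 \/ j = 1.
Proof. by case: j => [[|[|//]]] ?; [left|right]; apply/val_inj. Qed.

Lemma clamp0 : clamp 0 = 0. Proof. by rewrite clampE // lexx ler01. Qed.
Lemma clamp1 : clamp 1 = 1. Proof. by rewrite clampE // lexx ler01. Qed.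

Lemma insert0E k (i : 'I_k.+2) (x : 'rV[R]_k.+1) (j : 'I_k.+1) :
  insert0 i x 0 (lift i j) = x 0 j /\ insert0 i x 0 i = 0.
Proof. by rewrite !mxE liftK unlift_none. Qed.

Lemma face_edge0 t : face_map 0 (edge_point t) = triangle_point (1, t).
Proof.
apply/val_inj/rowP => j; rewrite -[val _]/(insert0 0 (row2 (1 - clamp t) (clamp t))).
rewrite [RHS]mxE /= clamp1 subrr mul1r; case: (unliftP 0 j) => [l ->|->].
  by rewrite (insert0E _ _ l).1 mxE; case: (ord1P l) => ->.
by rewrite (insert0E 0 _ 0).2.
Qed.

Lemma face_edge1 t : face_map 1 (edge_point t) = triangle_point (t, 1).
Proof.
apply/val_inj/rowP => j; rewrite -[val _]/(insert0 1 (row2 (1 - clamp t) (clamp t))).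
rewrite [RHS]mxE /= clamp1 mulr1 subrr; case: (unliftP 1 j) => [l ->|->].
  by rewrite (insert0E _ _ l).1 mxE; case: (ord1P l) => ->.
by rewrite (insert0E 1 _ 0).2.
Qed.

Lemma face_edge2 t : face_map 2 (edge_point t) = triangle_point (t, 0).
Proof.
apply/val_inj/rowP => j; rewrite -[val _]/(insert0 2 (row2 (1 - clamp t) (clamp t))).
rewrite [RHS]mxE /= clamp0 mulr0 subr0; case: (unliftP 2 j) => [l ->|->].
  by rewrite (insert0E _ _ l).1 mxE; case: (ord1P l) => ->.
by rewrite (insert0E 2 _ 0).2.
Qed.

Lemma triangle_point_apex t t' : triangle_point (0, t) = triangle_point (0, t').
Proof. by apply/val_inj; rewrite /= clamp0 !mul0r. Qed.

(** Continuity is global but only [0, 1] must be mapped into [Omega], so that affine paths qualify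
    without truncation. *)
Definition good_path (p : R -> pt) : Prop :=
  continuous p /\ forall t, 0 <= t <= 1 -> Omega (p t).

Lemma edge_coord (l : stdsimplex R 1) : 0 <= (set_val l : 'rV[R]_2) 0 1 <= 1.
Proof.
have [l0 l1] := set_valP l; rewrite l0 /= -[leRHS]l1 !big_ord_recl big_ord0 addr0.
have -> : lift ord0 ord0 = 1 :> 'I_2 by apply/val_inj.
by rewrite lerDr.
Qed.

Lemma simplex1_sub (p : R -> pt) (H : good_path p) (l : stdsimplex R 1) :
  p ((set_val l : 'rV[R]_2) 0 1) \in Omega.
Proof. by apply: mem_set; apply: H.2; exact: edge_coord. Qed.

Lemma simplex1_continuous p (H : good_path p) :
  (fun l => SigSub (simplex1_sub H l) : X) \in
    [set s : stdsimplex R 1 -> X | continuous s].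
Proof.
apply: mem_set; apply: continuous_sub_type => l /=.
by apply: (@continuous_comp _ _ _ (fun l : stdsimplex R 1 => (set_val l : 'rV[R]_2) 0 1));
  [exact: simplex_coord_continuous|exact: H.1].
Qed.

Definition simplex1 p (H : good_path p) : singular_simplex R X 1 :=
  SigSub (simplex1_continuous H).

Lemma path_of_simplex1 p (H : good_path p) t : path_of (simplex1 H) t = p (clamp t).
Proof.
by rewrite -[LHS]/(p (row2 (1 - clamp t) (clamp t) 0 1)) mxE.
Qed.

Lemma singular_simplex1_ext (s s' : singular_simplex R X 1) :
  (forall t, 0 <= t <= 1 -> path_of s t = path_of s' t) -> s = s'.
Proof.
move=> ss; apply/val_inj/funext => l; apply/val_inj.
have lE : l = edge_point ((set_val l : 'rV[R]_2) 0 1).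
  apply/val_inj/rowP => j; rewrite [RHS]mxE /= clampE ?edge_coord //.
  have [_ l1] := set_valP l; rewrite !big_ord_recl big_ord0 addr0 in l1.
  have e1 : lift ord0 ord0 = 1 :> 'I_2 by apply/val_inj.
  rewrite e1 in l1.
  by case: (ord1P j) => -> //=; rewrite -l1 addrK.
by rewrite lE; apply: ss; exact: edge_coord.
Qed.

(** Made total by the value 0, so that chains of explicit paths can be written without carrying
    proofs of admissibility. *)
Definition path_chain p : singular_chain R X 1 :=
  match pselect (good_path p) with
  | left H => chain_of (simplex1 H)
  | right _ => 0
  end.

Lemma path_chainE p (H : good_path p) : path_chain p = chain_of (simplex1 H).
Proof.
rewrite /path_chain; case: pselect => // H'; congr chain_of.
by apply: singular_simplex1_ext => t t01; rewrite !path_of_simplex1.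
Qed.

Lemma good_path_of s : good_path (path_of s).
Proof. by split; [exact: path_of_continuous|move=> t _; exact: path_of_in]. Qed.

Lemma path_chain_of s : path_chain (path_of s) = chain_of s.
Proof.
rewrite (path_chainE (good_path_of s)); congr chain_of.
by apply: singular_simplex1_ext => t t01; rewrite path_of_simplex1 clampE.
Qed.

(** Only the half 0 <= v <= u <= 1 of the square matters; the simplex is mapped onto it by sending
    barycentric coordinates l to (l1 + l2, l2). *)
Definition good_square (f : R * R -> pt) : Prop :=
  continuous f /\ forall u v, 0 <= v -> v <= u -> u <= 1 -> Omega (f (u, v)).

Lemma triangle_coords (l : stdsimplex R 2) :
  let a := (set_val l : 'rV[R]_3) 0 1 in let b := (set_val l : 'rV[R]_3) 0 2 in
  [/\ 0 <= b, b <= a + b & a + b <= 1].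
Proof.
have [l0 l1] := set_valP l; rewrite !big_ord_recl big_ord0 addr0 in l1.
have e1 : lift ord0 ord0 = 1 :> 'I_3 by apply/val_inj.
have e2 : lift ord0 (lift ord0 ord0) = 2 :> 'I_3 by apply/val_inj.
rewrite e1 e2 in l1 => a b; split; first exact: l0.
  by rewrite lerDr l0.
by rewrite -[leRHS]l1 lerDr l0.
Qed.

Lemma simplex2_sub f (H : good_square f) (l : stdsimplex R 2) :
  f ((set_val l : 'rV[R]_3) 0 1 + (set_val l : 'rV[R]_3) 0 2,
     (set_val l : 'rV[R]_3) 0 2) \in Omega.
Proof. by have [? ? ?] := triangle_coords l; apply: mem_set; apply: H.2. Qed.

Lemma simplex2_continuous f (H : good_square f) :
  (fun l => SigSub (simplex2_sub H l) : X) \in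
    [set s : stdsimplex R 2 -> X | continuous s].
Proof.
apply: mem_set; apply: continuous_sub_type => l /=.
apply: (@continuous_comp _ _ _ (fun l : stdsimplex R 2 =>
  ((set_val l : 'rV[R]_3) 0 1 + (set_val l : 'rV[R]_3) 0 2, (set_val l : 'rV[R]_3) 0 2)));
  last exact: H.1.
apply: continuous_pair; last exact: simplex_coord_continuous.
by apply: continuous_radd; exact: simplex_coord_continuous.
Qed.

Definition simplex2 f (H : good_square f) : singular_simplex R X 2 :=
  SigSub (simplex2_continuous H).

Lemma boundary_simplex (s : singular_simplex R X 2) : boundary (chain_of s) =
  chain_of (face 0 s) - chain_of (face 1 s) + chain_of (face 2 s).
Proof.
have b0 : bump 0 0 = 1%N by [].
have b1 : bump 0 1 = 2%N by [].
have e1 : lift ord0 ord0 = 1 :> 'I_3 by apply/val_inj.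
have e2 : lift ord0 (lift ord0 ord0) = 2 :> 'I_3 by apply/val_inj.
have e0 : ord0 = 0 :> 'I_3 by apply/val_inj.
rewrite /boundary /chain_of freeg.liftU scale1r !big_ord_recl big_ord0 addr0 /=.
by rewrite b0 b1 e2 e1 e0 expr0 expr1 sqrrN expr1n !scale1r scaleN1r addrA.
Qed.

Lemma boundary_path (s : singular_simplex R X 1) : boundary (chain_of s) =
  chain_of (face 0 s) - chain_of (face 1 s).
Proof.
have b0 : bump 0 0 = 1%N by [].
have e1 : lift ord0 ord0 = 1 :> 'I_2 by apply/val_inj.
have e0 : ord0 = 0 :> 'I_2 by apply/val_inj.
rewrite /boundary /chain_of freeg.liftU scale1r !big_ord_recl big_ord0 addr0 /=.
by rewrite b0 e1 e0 expr0 expr1 scale1r scaleN1r.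
Qed.

(** The three sides of the half square. All homologies between explicit paths below come from this
    one relation. *)
Lemma triangle_boundary f : good_square f ->
  range (@boundary R X 1)
    (path_chain (fun t => f (t, 0)) + path_chain (fun t => f (1, t)) -
     path_chain (fun t => f (t, t))).
Proof.
move=> H; exists (chain_of (simplex2 H)) => //; rewrite boundary_simplex.
have c1 : continuous (fun t : R => (t, 0 : R)).
  by apply: continuous_pair; [exact: continuous_idfun|exact: cst_continuous].
have c2 : continuous (fun t : R => (1 : R, t)).
  by apply: continuous_pair; [exact: cst_continuous|exact: continuous_idfun].
have c3 : continuous (fun t : R => (t, t)).
  by apply: continuous_pair; exact: continuous_idfun.
have comp (h : R -> R * R) : continuous h -> continuous (fun t => f (h t)).
  by move=> hc t; apply: continuous_comp; [exact: hc|exact: H.1].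
have H1 : good_path (fun t => f (t, 0)).
  by split; [exact: comp|move=> t /andP[t0 t1]; apply: H.2].
have H2 : good_path (fun t => f (1, t)).
  by split; [exact: comp|move=> t /andP[t0 t1]; apply: H.2].
have H3 : good_path (fun t => f (t, t)).
  by split; [exact: comp|move=> t /andP[t0 t1]; apply: H.2].
have faceE (i : 'I_3) p (Hp : good_path p) :
    (forall t, 0 <= t <= 1 -> let q := insert0 i (row2 (1 - t) t) in
       f (q 0 1 + q 0 2, q 0 2) = p t) ->
    chain_of (face i (simplex2 H)) = path_chain p.
  move=> fp; rewrite (path_chainE Hp); congr chain_of.
  apply: singular_simplex1_ext => t t01.
  rewrite path_of_simplex1 clampE // -(fp t t01) /=.
  by rewrite -[in RHS](clampE t01).
have e1 : 1 = lift 0 0 :> 'I_3 by apply/val_inj.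
have e2 : 2 = lift 0 1 :> 'I_3 by apply/val_inj.
have e3 : 2 = lift 1 1 :> 'I_3 by apply/val_inj.
have e4 : 1 = lift 2 1 :> 'I_3 by apply/val_inj.
rewrite (faceE 0 _ H2); last first.
  move=> t _ /=; rewrite {1}e1 e2 !(insert0E 0 _ _).1 !mxE /=.
  by rewrite subrK.
rewrite (faceE 1 _ H3); last first.
  move=> t _ /=; rewrite (insert0E 1 _ 0).2 e3 !(insert0E 1 _ _).1 !mxE /=.
  by rewrite add0r.
rewrite (faceE 2 _ H1); last first.
  move=> t _ /=; rewrite (insert0E 2 _ 0).2 addr0.
  have -> (r : 'rV[R]_2) : insert0 (2 : 'I_3) r 0 1 = r 0 1.
    by rewrite -(insert0E (2 : 'I_3) r 1).1; congr (insert0 2 r 0 _).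
  by rewrite mxE.
by rewrite addrAC [path_chain _ + path_chain _]addrC.
Qed.

End simplices.

(** * Linear maps on free modules *)

Section free_modules.
Variables (R : realType) (K : choiceType) (V : lmodType R).
Local Notation freegT := (freeg.FreegDefs.type_of (Phant R) (Phant K)).

Lemma fglift_is_linear (f : K -> V) : linear (freeg.fglift f : freegT -> V).
Proof.
have add : additive (freeg.fglift f : freegT -> V) by exact: freeg.lift_is_additive.
pose aM := GRing.isAdditive.Build _ _ _ add.
pose F : {additive freegT -> V} := HB.pack (freeg.fglift f : freegT -> V) aM.
have FE (D : freegT) : freeg.fglift f D = \sum_(x <- freeg.dom D) freeg.coeff x D *: f x.
  rewrite -{1}(freeg.freeg_sumE D) -[LHS]/(F _) raddf_sum /=.
  by apply: eq_bigr => x _; exact: freeg.liftU.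
move=> a D D'; rewrite -[LHS]/(F _) raddfD /=; congr (_ + _).
rewrite [in RHS]FE scaler_sumr -[a *: D]/(freeg.fgscale a D) /freeg.fgscale.
rewrite -[LHS]/(F _) raddf_sum; apply: eq_bigr => x _ /=.
by rewrite freeg.liftU scalerA.
Qed.

Lemma freeg_linear_ext (f g : freegT -> V) : linear f -> linear g ->
  (forall x, f (freeg.Freeg [:: (1 : R, x)]) = g (freeg.Freeg [:: (1 : R, x)])) -> f =1 g.
Proof.
move=> fl gl fg D.
pose fM := GRing.isLinear.Build _ _ _ _ f fl.
pose F : {linear freegT -> V} := HB.pack f fM.
pose gM := GRing.isLinear.Build _ _ _ _ g gl.
pose G : {linear freegT -> V} := HB.pack g gM.
rewrite -(freeg.freeg_sumE D) -[LHS]/(F _) -[RHS]/(G _) !raddf_sum.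
apply: eq_bigr => x _.
have -> : freeg.Freeg [:: (freeg.coeff x D, x)] =
    freeg.coeff x D *: (freeg.Freeg [:: (1 : R, x)] : freegT).
  apply/eqP/freeg.freeg_eqP => y.
  by rewrite freeg.coeffZ !freeg.coeffU mul1r.
have FZ a u : F (a *: u) = a *: F u by rewrite linearZ.
have GZ a u : G (a *: u) = a *: G u by rewrite linearZ.
by rewrite -[LHS]/(F _) -[RHS]/(G _) FZ GZ /= fg.
Qed.

End free_modules.

(** Identities between chains are checked on coefficients, where [ring] applies. *)
Ltac chain_ring := apply/eqP/freeg.freeg_eqP => ?;
  rewrite ?(freeg.coeffD, freeg.coeffB, freeg.coeffN, freeg.coeffZ, freeg.coeff0); ring.

(** * Elementary homologies between paths *)

Section homologous_paths.
Variables (R : realType) (Omega : set 'rV[R]_2).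
Local Notation X := (set_type Omega).
Local Notation pt := 'rV[R]_2.
Local Notation ch := (path_chain Omega).
Local Notation bd := (range (@boundary R X 1)).
Implicit Types (x y z : pt) (p q : R -> pt).

Definition seg x y (t : R) : pt := x + t *: (y - x).

Definition restrict_path p (a b t : R) : pt := p (a + t * (b - a)).

Lemma seg0 x y : seg x y 0 = x.
Proof. by rewrite /seg scale0r addr0. Qed.

Lemma seg1 x y : seg x y 1 = y.
Proof. by rewrite /seg scale1r addrC subrK. Qed.

Lemma boundary_is_linear k : linear (@boundary R X k).
Proof. exact: fglift_is_linear. Qed.

Lemma boundaries_lin_closed : lin_closed bd.
Proof.
split.
  exists 0 => //; have := boundary_is_linear (k := 1) (-1) 0 0.
  by rewrite scaleN1r oppr0 addr0 scaleN1r addNr.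
move=> a _ _ [u _ <-] [v _ <-]; exists (a *: u + v) => //.
exact: boundary_is_linear.
Qed.

Lemma bdD D D' : bd D -> bd D' -> bd (D + D').
Proof. by move=> bz bz'; rewrite -[D]scale1r; apply: boundaries_lin_closed.2. Qed.

Lemma bdB D D' : bd D -> bd D' -> bd (D - D').
Proof. exact: lin_closedB boundaries_lin_closed. Qed.

Lemma seg_continuous x y : continuous (seg x y).
Proof.
apply: continuous_add; first exact: cst_continuous.
by apply: continuous_scale; [exact: continuous_idfun|exact: cst_continuous].
Qed.

Definition convex_set (C : set pt) : Prop := forall x y (t : R), 0 <= t <= 1 ->
  C x -> C y -> C ((1 - t) *: x + t *: y).

Lemma convex_seg C x y t : convex_set C -> C x -> C y -> 0 <= t <= 1 -> C (seg x y t).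
Proof. by move=> CC Cx Cy t01; rewrite /seg segE; exact: CC. Qed.

Lemma good_seg C x y : convex_set C -> C `<=` Omega -> C x -> C y ->
  good_path Omega (seg x y).
Proof.
move=> CC CO Cx Cy; split; first exact: seg_continuous.
by move=> t t01; apply: CO; exact: convex_seg.
Qed.

Lemma bd_const x : Omega x -> bd (ch (fun=> x)).
Proof.
move=> Ox; have H : good_square Omega (fun=> x) by split=> //; exact: cst_continuous.
by have := triangle_boundary H; rewrite addrK.
Qed.

Lemma bd_triangle C x y z : convex_set C -> C `<=` Omega -> C x -> C y -> C z ->
  bd (ch (seg x y) + ch (seg y z) - ch (seg x z)).
Proof.
move=> CC CO Cx Cy Cz.
pose f (s : R * R) : pt := x + s.1 *: (y - x) + s.2 *: (z - y).
have H : good_square Omega f.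
  split.
    apply: continuous_add; last first.
      by apply: continuous_scale; [exact: continuous_snd|exact: cst_continuous].
    apply: continuous_add; first exact: cst_continuous.
    by apply: continuous_scale; [exact: continuous_fst|exact: cst_continuous].
  move=> u v v0 vu u1; apply: CO; rewrite /f /=.
  have [u0|u0] := eqVneq u 0.
    have -> : v = 0 by apply/eqP; rewrite eq_le v0 andbT -u0.
    by rewrite u0 !scale0r !addr0.
  have u_gt0 : 0 < u by rewrite lt_neqAle eq_sym u0 (le_trans v0).
  have -> : x + u *: (y - x) + v *: (z - y) = seg x (seg y z (v / u)) u.
    by apply/rowP => j; rewrite !mxE; field.
  apply: convex_seg => //; last by rewrite u1 andbT ltW.
  by apply: convex_seg => //; rewrite divr_ge0 ?ler_pdivrMr ?mul1r // ltW.
have := triangle_boundary H; congr (bd (ch _ + ch _ - ch _)); apply/funext => t;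
  apply/rowP => j; rewrite /f /seg /= !mxE; ring.
Qed.

(** A degenerate triangle inside the image of [p]: the parameter a + u (b - a) + v (c - b) runs over
    the two pieces along the legs and over the whole along the diagonal. *)
Lemma bd_concat p a b c : good_path Omega p -> 0 <= a -> a <= b -> b <= c -> c <= 1 ->
  bd (ch (restrict_path p a b) + ch (restrict_path p b c) - ch (restrict_path p a c)).
Proof.
move=> [pc pO] a0 ab bc c1.
pose f (s : R * R) : pt := p (a + s.1 * (b - a) + s.2 * (c - b)).
have H : good_square Omega f.
  split.
    move=> s; apply: (@continuous_comp _ _ _ (fun s : R * R => a + s.1 * (b - a) + s.2 * (c - b)));
      last exact: pc.
    apply: continuous_radd; last first.
      by apply: continuous_rmul; [exact: continuous_snd|exact: cst_continuous].
    apply: continuous_radd; first exact: cst_continuous.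
    by apply: continuous_rmul; [exact: continuous_fst|exact: cst_continuous].
  move=> u v v0 vu u1; apply: pO => /=; have u0 := le_trans v0 vu; have v1 := le_trans vu u1.
  have ba : 0 <= b - a by rewrite subr_ge0.
  have cb : 0 <= c - b by rewrite subr_ge0.
  have := mulr_ge0 u0 ba; have := mulr_ge0 v0 cb.
  have := ler_wpM2r ba u1; have := ler_wpM2r cb v1; rewrite !mul1r; lra.
have := triangle_boundary H; congr (bd (ch _ + ch _ - ch _)); apply/funext => t;
  rewrite /f /restrict_path /=; congr (p _); ring.
Qed.

(** The square of the straight-line homotopy is cut along its diagonal. In the difference of the two
    halves the diagonal cancels, and the sides over the common endpoints are constant, hence
    boundaries. *)
Lemma bd_homotopy C p q : convex_set C -> C `<=` Omega -> continuous p -> continuous q ->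
  (forall t, 0 <= t <= 1 -> C (p t)) -> (forall t, 0 <= t <= 1 -> C (q t)) ->
  p 0 = q 0 -> p 1 = q 1 -> bd (ch p - ch q).
Proof.
move=> CC CO pc qc pC qC e0 e1.
pose h (u t : R) : pt := (1 - t) *: p u + t *: q u.
have hc (f g : R * R -> R) : continuous f -> continuous g ->
    continuous (fun s => h (f s) (g s)).
  move=> fc gc; apply: continuous_add; apply: continuous_scale => //.
  - by apply: continuous_rsub => //; exact: cst_continuous.
  - by move=> s; apply: continuous_comp; [exact: fc|exact: pc].
  - by move=> s; apply: continuous_comp; [exact: fc|exact: qc].
have hO u v : 0 <= u <= 1 -> 0 <= v <= 1 -> Omega (h u v).
  by move=> u01 v01; apply: CO; apply: CC => //; [exact: pC|exact: qC].
have H1 : good_square Omega (fun s => h s.1 s.2).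
  split; first by apply: hc; [exact: continuous_fst|exact: continuous_snd].
  by move=> u v v0 vu u1 /=; apply: hO; [rewrite (le_trans v0)|rewrite v0 (le_trans vu)].
have H2 : good_square Omega (fun s => h s.2 s.1).
  split; first by apply: hc; [exact: continuous_snd|exact: continuous_fst].
  by move=> u v v0 vu u1 /=; apply: hO; [rewrite v0 (le_trans vu)|rewrite (le_trans v0)].
have t01 : 0 <= (0 : R) <= 1 by rewrite lexx ler01.
have t11 : 0 <= (1 : R) <= 1 by rewrite lexx ler01.
have b0 := bd_const (CO _ (pC 0 t01)); have b1 := bd_const (CO _ (pC 1 t11)).
have B1 := triangle_boundary H1; have B2 := triangle_boundary H2; move: B1 B2 => /=.
have -> : (fun t => h t 0) = p by apply/funext => t; rewrite /h subr0 scale1r scale0r addr0.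
have -> : (fun t => h 1 t) = fun=> p 1.
  by apply/funext => t; rewrite /h -e1 -scalerDl subrK scale1r.
have -> : (fun t : R => h 0 t) = fun=> p 0.
  by apply/funext => t; rewrite /h -e0 -scalerDl subrK scale1r.
have -> : (fun t => h t 1) = q by apply/funext => t; rewrite /h subrr scale0r add0r scale1r.
move=> B1 B2; have := bdD (bdB (bdB B1 B2) b1) b0.
by congr (bd _); chain_ring.
Qed.

End homologous_paths.

Lemma sum_delta2 (R : realType) (I : finType) (V : lmodType R) (F : I -> I -> V) i j :
  \sum_k \sum_l ((k == i) && (l == j))%:R *: F k l = F i j.
Proof.
rewrite (bigD1 i) //= (bigD1 j) //= !eqxx scale1r big1 ?addr0; last first.
  by move=> l /negPf ->; rewrite andbF scale0r.
by rewrite big1 ?addr0 // => k /negPf ->; apply: big1 => l _; exact: scale0r.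
Qed.

(** * Cocycles of the triangulation and their integrals *)

Section path_decomposition.
Variables (R : realType) (M : triangulation R) (Omega : set 'rV[R]_2).
Hypothesis OmegaE : Omega = inside M.
Variable T0 : tri M.
Local Notation X := (set_type Omega).
Local Notation pt := 'rV[R]_2.
Local Notation ch := (path_chain Omega).
Local Notation bd := (range (@boundary R X 1)).
Implicit Types (x y z : pt) (T : tri M) (p : R -> pt) (B : set pt).

Definition tri_at x : tri M := xget T0 [set T | in_tri T x].

Lemma tri_atP x : Omega x -> in_tri (tri_at x) x.
Proof.
rewrite OmegaE => /inside_covered[T xT].
by rewrite /tri_at; apply: (xgetPex T0 (P := [set T | in_tri T x])); exists T.
Qed.

Definition common T T' : set pt := [set x | [/\ in_tri T x, in_tri T' x & Omega x]].

Definition meets T T' : bool := `[< common T T' !=set0 >].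

Definition meeting_point T T' : pt := xget 0 (common T T').

Lemma meeting_pointP T T' : meets T T' -> common T T' (meeting_point T T').
Proof. by move=> /asboolP[x xP]; exact: (xgetPex 0 (ex_intro _ x xP)). Qed.

Lemma meetsP T T' x : in_tri T x -> in_tri T' x -> Omega x -> meets T T'.
Proof. by move=> *; apply/asboolP; exists x. Qed.

Definition connection T T' : singular_chain R X 1 :=
  if meets T T' then ch (seg (center T) (meeting_point T T')) +
    ch (seg (meeting_point T T') (center T')) else 0.

Lemma connection_eq0 T T' : meets T T' = false -> connection T T' = 0.
Proof. by rewrite /connection => ->. Qed.

(** A tail from [y] to the center of its triangle; tails extend any path to one between centers and
    cancel in cycles. *)
Definition base_chain y : singular_chain R X 1 := ch (seg y (center (tri_at y))).

Definition tri_inside T : set pt := [set x | in_tri T x /\ Omega x].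

Lemma tri_inside_convex T : convex_set (tri_inside T).
Proof.
move=> x y t t01 [xT xO] [yT yO]; split; first exact: in_tri_convex.
by move: xO yO; rewrite OmegaE => xO yO; exact: inside_convex t01 xT yT xO yO.
Qed.

Lemma center_Omega T : Omega (center T).
Proof. by rewrite OmegaE; exact: center_inside. Qed.

Lemma center_tri_inside T : tri_inside T (center T).
Proof. by split; [exact: center_in|exact: center_Omega]. Qed.

Lemma tri_at_center T : tri_at (center T) = T.
Proof.
apply/esym/(@inner_point_unique _ _ T (tri_at (center T)) (center T)).
  by move=> k; exact: center_inner.
exact/tri_atP/center_Omega.
Qed.

Lemma star_ball x : Omega x -> exists2 e : R, 0 < e &
  let B := [set y | `|x - y| < e] in
  [/\ convex_set B, B `<=` Omega, B x & forall y T, B y -> in_tri T y -> in_tri T x].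
Proof.
rewrite OmegaE => ix.
have near_x : nbhs x (inside M `&` [set y | forall T : tri M, in_tri T y -> in_tri T x]).
  exact: filterI (inside_near ix) (star_near M x).
have [e e0 eP] := (@nbhs_normP _ 'rV[R]_2 x _).1 near_x.
exists e => //=; split.
- move=> y z t /andP[t0 t1] /= ye ze.
  have -> : x - ((1 - t) *: y + t *: z) = (1 - t) *: (x - y) + t *: (x - z).
    by apply/rowP => j; rewrite !mxE; ring.
  apply: le_lt_trans (ler_normD _ _) _; rewrite !normrZ !ger0_norm ?subr_ge0 //.
  have [->|t0'] := eqVneq t 0; first by rewrite subr0 mul1r mul0r addr0.
  have {}t0' : 0 < t by rewrite lt_neqAle eq_sym t0'.
  have -> : e = (1 - t) * e + t * e by ring.
  by apply: ler_ltD; [rewrite ler_wpM2l ?subr_ge0 // ltW|rewrite ltr_pM2l].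
- by move=> y /eP[].
- by rewrite /= subrr normr0.
- by move=> y T /eP[_ +] yT; apply.
Qed.

Lemma bd_tri T x y z : tri_inside T x -> tri_inside T y -> tri_inside T z ->
  bd (ch (seg x y) + ch (seg y z) - ch (seg x z)).
Proof. by apply: bd_triangle; [exact: tri_inside_convex|move=> ? []]. Qed.

Lemma seg_refl x : seg x x = fun=> x.
Proof. by apply/funext => t; rewrite /seg subrr scaler0 addr0. Qed.

Lemma bd_tri_rev T x y : tri_inside T x -> tri_inside T y ->
  bd (ch (seg x y) + ch (seg y x)).
Proof.
move=> xT yT; have := bdD (bd_tri xT yT xT) (bd_const xT.2).
by rewrite seg_refl subrK.
Qed.

(** Any common point may replace the chosen one, because the segment between the two lies in both
    triangles. *)
Lemma bd_connection T T' x : common T T' x ->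
  bd (ch (seg (center T) x) + ch (seg x (center T')) - connection T T').
Proof.
move=> [xT xT' xO]; have TT := meetsP xT xT' xO; rewrite /connection TT.
have [mT mT' mO] := meeting_pointP TT; set m := meeting_point T T' in mT mT' mO *.
have cT := center_tri_inside T; have cT' := center_tri_inside T'.
have b1 := bd_tri cT (conj mT mO) (conj xT xO).
have b2 := bd_tri (conj xT' xO) (conj mT' mO) cT'.
have b3 := bd_tri_rev (conj mT mO) (conj xT xO).
have := bdB b3 (bdD b1 b2).
by congr (bd _); chain_ring.
Qed.

Definition decomposed (D : singular_chain R X 1) x y : Prop :=
  exists w : tri M -> tri M -> R,
    bd (D - base_chain x + base_chain y - \sum_T \sum_T' w T T' *: connection T T').

(** In the convex set [B] the path is homologous to the segments from [y] to [x] and from [x] to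
    [z]. The triangles chosen for [y] and [z] both contain [x], so [x] connects their centers and a
    single connection suffices. *)
Lemma small_path_decomposed p x y z B : continuous p -> p 0 = y -> p 1 = z ->
  convex_set B -> B `<=` Omega -> B x -> (forall v T, B v -> in_tri T v -> in_tri T x) ->
  (forall t, 0 <= t <= 1 -> B (p t)) -> decomposed (ch p) y z.
Proof.
move=> pc p0 p1 BC BO Bx Bstar pB.
have t01 : 0 <= (0 : R) <= 1 by rewrite lexx ler01.
have t11 : 0 <= (1 : R) <= 1 by rewrite lexx ler01.
have By : B y by rewrite -p0; exact: pB.
have Bz : B z by rewrite -p1; exact: pB.
pose T := tri_at y; pose T' := tri_at z.
have yT := tri_atP (BO _ By); have zT' := tri_atP (BO _ Bz).
have xT := Bstar _ _ By yT; have xT' := Bstar _ _ Bz zT'.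
have xO := BO _ Bx.
exists (fun S S' => ((S == T) && (S' == T'))%:R).
have -> : \sum_S \sum_S' ((S == T) && (S' == T'))%:R *: connection S S' = connection T T'.
  exact: sum_delta2.
have h1 : bd (ch p - ch (seg y z)).
  apply: (bd_homotopy BC BO) => //; first exact: seg_continuous.
  - by move=> t; exact: convex_seg.
  - by rewrite p0 /seg scale0r addr0.
  - by rewrite p1 /seg scale1r addrC subrK.
have h2 := bd_triangle BC BO By Bx Bz.
have cT := center_tri_inside T; have cT' := center_tri_inside T'.
have h3 := bd_tri (conj yT (BO _ By)) cT (conj xT xO).
have h4 := bd_tri (conj xT' xO) cT' (conj zT' (BO _ Bz)).
have h5 := bd_tri_rev (conj zT' (BO _ Bz)) cT'.
have h6 := bd_connection (And3 xT xT' xO).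
have := bdD (bdD (bdB (bdB (bdB h1 h2) h3) h4) h5) h6.
by congr (bd _); rewrite /base_chain -/T -/T'; chain_ring.
Qed.

Lemma restrict_path_full p : restrict_path p 0 1 = p.
Proof. by apply/funext => t; rewrite /restrict_path subr0 mulr1 add0r. Qed.

Lemma restrict_path_continuous p a b : continuous p -> continuous (restrict_path p a b).
Proof.
move=> pc; have hc : continuous (fun u : R => a + u * (b - a)).
  apply: continuous_radd; first exact: cst_continuous.
  by apply: continuous_rmul; [exact: continuous_idfun|exact: cst_continuous].
by move=> u; apply: (continuous_comp (hc u) (pc _)).
Qed.

(** Decompositions add up along the path, the tails at an intermediate point cancelling; near each
    parameter the path stays in a star ball. *)
Lemma path_decomposed p : good_path Omega p -> decomposed (ch p) (p 0) (p 1).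
Proof.
move=> [pc pO].
rewrite -[in ch p](restrict_path_full p).
apply: (@interval_chain R (fun a b => decomposed (ch (restrict_path p a b)) (p a) (p b)) 0 1) => //.
  move=> a b c a0 ab bc c1 [w wP] [w' wP'].
  exists (fun T T' => w T T' + w' T T').
  have -> : \sum_T \sum_T' (w T T' + w' T T') *: connection T T' =
      \sum_T \sum_T' w T T' *: connection T T' + \sum_T \sum_T' w' T T' *: connection T T'.
    rewrite -big_split; apply: eq_bigr => T _; rewrite -big_split.
    by apply: eq_bigr => T' _; rewrite scalerDl.
  have := bdB (bdD wP wP') (bd_concat (conj pc pO) a0 ab bc c1).
  by congr (bd _); chain_ring.
move=> t t01; have [e e0 [BC BO Bx Bstar]] := star_ball (pO t t01).
have near_t : nbhs t [set u | `|p t - p u| < e].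
  have near_pt : nbhs (p t) [set y | `|p t - y| < e].
    by apply: (@nbhs_normP _ 'rV[R]_2 (p t) _).2; exists e.
  exact: (pc t _ near_pt).
have [r r0 rP] := (@nbhs_normP _ R^o t _).1 near_t; exists r => // a b ab [a01 ar] [b01 br].
apply: (@small_path_decomposed (restrict_path p a b) (p t) (p a) (p b)
  [set y | `|p t - y| < e] (restrict_path_continuous pc) _ _ BC BO Bx Bstar).
- by rewrite /restrict_path mul0r addr0.
- by rewrite /restrict_path mul1r addrC subrK.
- move=> u /andP[u0 u1]; apply: rP; rewrite /ball_ /= /restrict_path distrC.
  have ba : 0 <= b - a by rewrite subr_ge0.
  have := mulr_ge0 u0 ba; have := ler_wpM2r ba u1; rewrite mul1r.
  move: ar br; rewrite !ltr_norml => /andP[? ?] /andP[? ?] ? ?; lra.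
Qed.

End path_decomposition.

(** * Cocycles and their integrals over paths and chains *)

Section cocycles.
Variables (R : realType) (M : triangulation R) (Omega : set 'rV[R]_2).
Hypothesis OmegaE : Omega = inside M.
Variable T0 : tri M.
Local Notation X := (set_type Omega).
Local Notation pt := 'rV[R]_2.
Local Notation ch := (path_chain Omega).
Local Notation bd := (range (@boundary R X 1)).
Local Notation tri_at := (tri_at T0).
Implicit Types (x y z : pt) (T : tri M) (p q : R -> pt) (c : tri M -> tri M -> R).

(** A Čech 1-cocycle with constant coefficients for the cover of [Omega] by the triangles. Values on
    pairs that do not meet in [Omega] are unconstrained. *)
Definition cocycle c : Prop := forall T T' T'' x, Omega x ->
  in_tri T x -> in_tri T' x -> in_tri T'' x -> c T T' + c T' T'' = c T T''.

Lemma cocycle_diag c T : cocycle c -> c T T = 0.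
Proof.
move=> cP; have [cT cO] := center_tri_inside OmegaE T.
by have := cP T T T _ cO cT cT cT => /eqP; rewrite -subr_eq0 addrK => /eqP.
Qed.

Definition jump c x y : R := c (tri_at x) (tri_at y).

Definition path_integral c p : R :=
  local_integral 0 1 (fun u v => jump c (p u) (p v)).

Lemma jump_additive c x u v w : cocycle c -> Omega x ->
  in_tri (tri_at u) x -> in_tri (tri_at v) x -> in_tri (tri_at w) x ->
  jump c u v + jump c v w = jump c u w.
Proof. by move=> cP xO *; exact: (cP _ _ _ x). Qed.

Lemma star_nbhs x : Omega x -> nbhs x [set y | in_tri (tri_at y) x].
Proof.
move=> xO; have ix : nbhs x (inside M) by apply: inside_near; rewrite -OmegaE.
apply: filterS (filterI ix (star_near M x)) => y [yO yP].
by apply: yP; apply: (tri_atP OmegaE); rewrite OmegaE.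
Qed.

(** For parameters near [t] every chosen triangle contains [p t], a point of [Omega], so the cocycle
    identity applies there. *)
Lemma locally_additive_path c p : cocycle c -> good_path Omega p ->
  locally_additive 0 1 (fun u v => jump c (p u) (p v)).
Proof.
move=> cP [pc pO] t t01; have near_t := pc t _ (star_nbhs (pO t t01)).
have [r r0 rP] := (@nbhs_normP _ R^o t _).1 near_t; exists r => // u v w uP vP wP.
by apply: (@jump_additive c (p t)) => //; [exact: pO|apply: rP..];
  rewrite /ball_ /= distrC; [case: uP|case: vP|case: wP].
Qed.

Lemma path_integral_ext c p q : (forall t, 0 <= t <= 1 -> p t = q t) ->
  path_integral c p = path_integral c q.
Proof. by move=> pq; apply: local_integral_ext => u v uP vP; rewrite !pq. Qed.

Lemma path_integral_const c x : cocycle c -> Omega x -> path_integral c (fun=> x) = 0.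
Proof.
move=> cP xO; rewrite /path_integral local_integral_additive //.
  by rewrite /jump cocycle_diag.
by move=> u v w _ _ _; apply: (@jump_additive c x) => //; exact: (tri_atP OmegaE).
Qed.

Lemma good_seg_tri T x y : tri_inside Omega T x -> tri_inside Omega T y ->
  good_path Omega (seg x y).
Proof. by apply: (good_seg (@tri_inside_convex _ _ _ OmegaE T)) => z []. Qed.

(** The segment stays in [T], so comparison with [T] provides a primitive. *)
Lemma path_integral_seg c T x y : cocycle c -> tri_inside Omega T x ->
  tri_inside Omega T y -> path_integral c (seg x y) = c T (tri_at y) - c T (tri_at x).
Proof.
move=> cP xT yT; have TC := @tri_inside_convex _ _ _ OmegaE T.
have gp := good_seg_tri xT yT.
have near_t t (t01 : 0 <= t <= 1) := gp.1 t _ (star_nbhs (gp.2 t t01)).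
rewrite /path_integral (@local_integralE _ _ _ _ (fun t => c T (tri_at (seg x y t)))) //.
  by rewrite seg0 seg1.
move=> t t01; have [r r0 rP] := (@nbhs_normP _ R^o t _).1 (near_t t t01).
exists r => // u v uP vP.
have [tT tO] := convex_seg TC xT yT t01.
rewrite -(cP T (tri_at (seg x y u)) (tri_at (seg x y v)) (seg x y t)) //.
- by rewrite addrAC subrr add0r.
- by apply: rP; rewrite /ball_ /= distrC; case: uP.
- by apply: rP; rewrite /ball_ /= distrC; case: vP.
Qed.

Lemma path_integral_delta (k : tri M -> R) p :
  path_integral (fun T T' => k T' - k T) p = k (tri_at (p 1)) - k (tri_at (p 0)).
Proof.
rewrite /path_integral (@local_integralE _ _ _ _ (fun t => k (tri_at (p t)))) //.
by move=> t t01; exists 1.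
Qed.

Lemma path_integral_lin (a : R) c c' p : cocycle c -> cocycle c' -> good_path Omega p ->
  path_integral (fun T T' => a * c T T' + c' T T') p =
  a * path_integral c p + path_integral c' p.
Proof.
move=> cP cP' pP; rewrite -local_integral_lin //; exact: locally_additive_path.
Qed.

Lemma path_integral_rectangle c (f : R * R -> pt) : cocycle c -> continuous f ->
  (forall s t, 0 <= s <= 1 -> 0 <= t <= 1 -> Omega (f (s, t))) ->
  path_integral c (fun t => f (t, 0)) + path_integral c (fun t => f (1, t)) =
  path_integral c (fun t => f (0, t)) + path_integral c (fun t => f (t, 1)).
Proof.
move=> cP fc fO.
apply: (local_integral_rectangle (G := fun u u' v v' => jump c (f (u, u')) (f (v, v')))).
move=> s t s01 t01; have near_st := fc (s, t) _ (star_nbhs (fO s t s01 t01)).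
have [e e0 eP] := (nbhs_ballP _ _).1 near_st; exists e => // u u' v v' w w' uP vP wP uP' vP' wP'.
have inball a b : near_in 0 1 s e a -> near_in 0 1 t e b ->
    in_tri (tri_at (f (a, b))) (f (s, t)).
  by move=> [_ aP] [_ bP]; apply: eP; split; rewrite /ball /= distrC.
apply: (@jump_additive c (f (s, t)) (f (u, u')) (f (v, v')) (f (w, w'))) => //;
  by [exact: fO|exact: inball].
Qed.

Definition chain_integral c : singular_chain R X 1 -> R :=
  freeg.fglift (fun s => path_integral c (path_of s) : R^o).

Lemma chain_integral_is_linear c : linear (chain_integral c : _ -> R^o).
Proof. exact: fglift_is_linear. Qed.

Lemma chain_integral_chain c s : chain_integral c (chain_of s) = path_integral c (path_of s).
Proof. by rewrite /chain_integral freeg.liftU scale1r. Qed.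

Lemma chain_integral_path c p : good_path Omega p ->
  chain_integral c (ch p) = path_integral c p.
Proof.
move=> pP; rewrite (path_chainE pP) chain_integral_chain; apply: path_integral_ext => t t01.
by rewrite path_of_simplex1 clampE.
Qed.

Lemma chain_integralD c D D' :
  chain_integral c (D + D') = chain_integral c D + chain_integral c D'.
Proof. by have := chain_integral_is_linear c 1 D D'; rewrite !scale1r. Qed.

Lemma chain_integral0 c : chain_integral c 0 = 0.
Proof. by apply: (addrI (chain_integral c 0)); rewrite -chain_integralD !addr0. Qed.

Lemma chain_integralZ c (a : R) D : chain_integral c (a *: D) = a * chain_integral c D.
Proof.
by have := chain_integral_is_linear c a D 0; rewrite addr0 chain_integral0 addr0.
Qed.

Lemma chain_integralB c D D' :
  chain_integral c (D - D') = chain_integral c D - chain_integral c D'.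
Proof. by rewrite -scaleN1r chain_integralD chain_integralZ mulN1r. Qed.

Lemma chain_integral_sum c (I : finType) (F : I -> singular_chain R X 1) :
  chain_integral c (\sum_i F i) = \sum_i chain_integral c (F i).
Proof.
by elim/big_rec2: _ => [|i y D _ <-]; rewrite ?chain_integral0 ?chain_integralD.
Qed.

Lemma chain_integral_lin (a : R) c c' D : cocycle c -> cocycle c' ->
  chain_integral (fun T T' => a * c T T' + c' T T') D =
  a * chain_integral c D + chain_integral c' D.
Proof.
move=> cP cP'; move: D.
apply: (@freeg_linear_ext R _ R^o _
  (fun D => a * chain_integral c D + chain_integral c' D : R^o)).
- exact: chain_integral_is_linear.
- by move=> b D D'; rewrite !chain_integralD !chain_integralZ -[b *: _]/(b * _); ring.
- move=> s; rewrite -/(chain_of s) !chain_integral_chain path_integral_lin //.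
  exact: good_path_of.
Qed.

(** Three sides of the square are the faces of the simplex, and the fourth is constant with integral
    0. *)
Lemma chain_integral_simplex_boundary c s : cocycle c ->
  chain_integral c (boundary (chain_of s)) = 0.
Proof.
move=> cP; rewrite boundary_simplex chain_integralD chain_integralB !chain_integral_chain.
rewrite (path_of_face s (@face_edge0 R)) (path_of_face s (@face_edge1 R)) (path_of_face s (@face_edge2 R)).
have := path_integral_rectangle cP (@square_of_continuous _ _ s)
  (fun u v _ _ => @square_of_in _ _ s (u, v)).
have -> : (fun t => square_of s (0, t)) = fun=> square_of s (0, 0).
  by apply/funext => t; rewrite /square_of (triangle_point_apex t 0).
rewrite path_integral_const //; last exact: square_of_in.
by move=> e; rewrite -addrAC [X in X - _]addrC e add0r subrr.
Qed.

Lemma chain_integral_boundary c D : cocycle c -> bd D -> chain_integral c D = 0.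
Proof.
move=> cP [E _ <-].
apply: (@freeg_linear_ext R _ R^o (fun E => chain_integral c (boundary E) : R^o)
  (fun=> 0)) => [||s].
- by move=> a E1 E2; rewrite boundary_is_linear chain_integralD chain_integralZ.
- by move=> a E1 E2; rewrite scaler0 addr0.
- exact: chain_integral_simplex_boundary.
Qed.

Lemma chain_integral_connection c T T' : cocycle c ->
  chain_integral c (connection Omega T T') = if meets Omega T T' then c T T' else 0.
Proof.
move=> cP; rewrite /connection; case: ifP => TT; last exact: chain_integral0.
have [mT mT' mO] := meeting_pointP TT; set m := meeting_point _ _ _ in mT mT' mO *.
have cT := center_tri_inside OmegaE T; have cT' := center_tri_inside OmegaE T'.
rewrite chain_integralD !chain_integral_path; last first.
- exact: (good_seg_tri cT (conj mT mO)).
- exact: (good_seg_tri (conj mT' mO) cT').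
rewrite (path_integral_seg cP cT (conj mT mO)) (path_integral_seg cP (conj mT' mO) cT').
rewrite !(tri_at_center OmegaE) !cocycle_diag // subr0 sub0r.
have am := tri_atP OmegaE T0 mO.
by rewrite -(cP T T' (tri_at m) m) // addrK.
Qed.

End cocycles.

(** * Simply connected domains *)

Section simple_connectedness.
Variables (R : realType) (M : triangulation R) (Omega : set 'rV[R]_2).
Hypothesis OmegaE : Omega = inside M.
Variable T0 : tri M.
Local Notation X := (set_type Omega).
Local Notation pt := 'rV[R]_2.
Local Notation tri_at := (tri_at T0).
Local Notation cocycle := (@cocycle R M Omega).
Local Notation path_integral := (path_integral T0).
Implicit Types (x y z : pt) (T : tri M) (p q : R -> pt) (c : tri M -> tri M -> R).

Lemma within_comp (S T U : topologicalType) (A : set T) (f : T -> U) (h : S -> T) :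
  {within A, continuous f} -> continuous h -> (forall s, A (h s)) ->
  continuous (fun s => f (h s)).
Proof.
move=> /subspace_continuousP fc hc hA s P fP.
have H : nbhs (h s) [set t | A t -> P (f t)] := fc (h s) (hA s) P fP.
have Fs : Filter (nbhs s) by exact: nbhs_filter.
by apply: (@filterS _ _ Fs _ _ _ (hc s _ H)) => s' /= /(_ (hA s')).
Qed.

Lemma clamp_itv (t : R) : `[0, 1]%classic (clamp t).
Proof. by rewrite /= in_itv /=; exact: clamp_in. Qed.

Lemma good_path_clamp (g : R -> X) : {within `[0, 1], continuous g} ->
  good_path Omega (fun t => set_val (g (clamp t))).
Proof.
move=> gc; split=> [|t _]; last exact: set_valP.
have hc : continuous (fun t => g (clamp t)).
  exact: (within_comp gc (@clamp_continuous R) clamp_itv).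
by move=> t; apply: continuous_comp (hc t) (@set_val_continuous _ _ _ _).
Qed.

Lemma connecting_path x y : simply_connected R X -> Omega x -> Omega y ->
  exists p, [/\ good_path Omega p, p 0 = x & p 1 = y].
Proof.
move=> [_ pc _] xO yO.
have [g [gc g0 g1]] := pc (SigSub (mem_set xO)) (SigSub (mem_set yO)).
exists (fun t => set_val (g (clamp t))); split; first exact: good_path_clamp.
  by rewrite clamp0 g0.
by rewrite clamp1 g1.
Qed.

(** A contraction of the loop is a square with the loop on one side and constants on the other
    three. *)
Lemma loop_integral c p : simply_connected R X -> cocycle c -> good_path Omega p ->
  p 0 = p 1 -> path_integral c p = 0.
Proof.
move=> [_ _ sc] cP [pc pO] p01.
have pO' t : p (clamp t) \in Omega by apply: mem_set; apply: pO; exact: clamp_in.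
pose g t : X := SigSub (pO' t).
have gc : continuous g.
  apply: continuous_sub_type => t /=.
  by apply: (@continuous_comp _ _ _ (@clamp R) p); [exact: clamp_continuous|exact: pc].
have [||H [Hc H0 H1 Hs]] := sc g.
- exact: continuous_subspaceT.
- by apply/val_inj; rewrite /= clamp0 clamp1.
pose f (s : R * R) : pt := set_val (H (clamp s.1, clamp s.2)).
have fc : continuous f.
  have hc : continuous (fun s : R * R => H (clamp s.1, clamp s.2)).
    apply: (within_comp (h := fun s : R * R => (clamp s.1, clamp s.2)) Hc).
      apply: continuous_pair.
        by move=> s; apply: continuous_comp; [exact: continuous_fst|exact: clamp_continuous].
      by move=> s; apply: continuous_comp; [exact: continuous_snd|exact: clamp_continuous].
    by move=> s; split; exact: clamp_itv.
  by move=> s; apply: continuous_comp (hc s) (@set_val_continuous _ _ _ _).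
have fO s t : 0 <= s <= 1 -> 0 <= t <= 1 -> Omega (f (s, t)) by move=> _ _; exact: set_valP.
have in01 (t : R) : clamp t \in `[0, 1] by rewrite in_itv /= clamp_in.
have p0O : Omega (p 0) by apply: pO; rewrite lexx ler01.
have := path_integral_rectangle OmegaE T0 cP fc fO.
have -> : (fun t => f (t, 0)) = fun=> p 0.
  by apply/funext => t; rewrite /f clamp0 (Hs _ (in01 t)).1 -[LHS]/(p (clamp 0)) clamp0.
have -> : (fun t => f (t, 1)) = fun=> p 0.
  by apply/funext => t; rewrite /f clamp1 (Hs _ (in01 t)).2 -[LHS]/(p (clamp 0)) clamp0.
have -> : (fun t => f (1, t)) = fun=> p 0.
  by apply/funext => t; rewrite /f clamp1 (H1 _ (in01 t)) -[LHS]/(p (clamp 0)) clamp0.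
have -> : path_integral c (fun t => f (0, t)) = path_integral c p.
  apply: path_integral_ext => t t01; rewrite /f clamp0 (H0 _ (in01 t)).
  by rewrite -[LHS]/(p (clamp (clamp t))) !clampE // clampE.
by rewrite !(path_integral_const OmegaE T0 cP p0O) !addr0.
Qed.

(* The three sides of a triangle as one loop: adding the paths as vectors,
   with the idle ones resting at their endpoints, spares gluing continuous maps. *)
Lemma triangle_integral c p q s : simply_connected R X -> cocycle c ->
  good_path Omega p -> good_path Omega q -> good_path Omega s ->
  p 0 = q 0 -> p 1 = s 0 -> q 1 = s 1 ->
  path_integral c p + path_integral c s = path_integral c q.
Proof.
move=> sc cP pP qP sP pq0 ps qs.
(* Three clocks: after clamping, [h1], [h2] and [h3] run on successive thirds of the interval, the
   last one backwards, and rest at 0 or 1 elsewhere. *)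
pose h1 t : R := 3 * t; pose h2 t : R := 3 * t - 1; pose h3 t : R := 3 - 3 * t.
pose l t : pt := p (clamp (h1 t)) + (s (clamp (h2 t)) - s 0) + (q (clamp (h3 t)) - s 1).
have h1c : continuous h1.
  by apply: continuous_rmul; [exact: cst_continuous|exact: continuous_idfun].
have h2c : continuous h2 by apply: continuous_rsub => //; exact: cst_continuous.
have h3c : continuous h3 by apply: continuous_rsub => //; exact: cst_continuous.
have cc (r : R -> pt) (h : R -> R) : continuous r -> continuous h ->
    continuous (fun t => r (clamp (h t))).
  move=> rc hc t.
  apply: (@continuous_comp _ _ _ (fun t => clamp (h t)) r); last exact: rc.
  by apply: continuous_comp; [exact: hc|exact: clamp_continuous].
have lc : continuous l.
  apply: continuous_add; last first.
    by apply: continuous_sub; [apply: cc => //; exact: qP.1|exact: cst_continuous].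
  apply: continuous_add; first by apply: cc => //; exact: pP.1.
  by apply: continuous_sub; [apply: cc => //; exact: sP.1|exact: cst_continuous].
have l1 t : t <= 3^-1 -> l t = p (clamp (h1 t)).
  move=> t3; rewrite /l (clamp_le0 (t := h2 t)) ?subrr ?addr0; last by rewrite /h2; lra.
  rewrite (clamp_ge1 (t := h3 t)); last by rewrite /h3; lra.
  by rewrite qs subrr addr0.
have l2 t : 3^-1 <= t <= 2 / 3 -> l t = s (clamp (h2 t)).
  move=> /andP[t1 t2]; rewrite /l (clamp_ge1 (t := h1 t)); last by rewrite /h1; lra.
  rewrite (clamp_ge1 (t := h3 t)); last by rewrite /h3; lra.
  by rewrite qs ps; apply/rowP => j; rewrite !mxE; ring.
have l3 t : 2 / 3 <= t -> l t = q (clamp (h3 t)).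
  move=> t2; rewrite /l (clamp_ge1 (t := h1 t)); last by rewrite /h1; lra.
  rewrite (clamp_ge1 (t := h2 t)); last by rewrite /h2; lra.
  by rewrite ps; apply/rowP => j; rewrite !mxE; ring.
have lP : good_path Omega l.
  split=> // t t01; have [t3|t3] := leP t 3^-1.
    by rewrite l1 //; apply: pP.2; exact: clamp_in.
  have [t2|t2] := leP t (2 / 3).
    by rewrite l2 ?t2 ?ltW //; apply: sP.2; exact: clamp_in.
  by rewrite l3 ?ltW //; apply: qP.2; exact: clamp_in.
have l01 : l 0 = l 1.
  rewrite l1 ?invr_ge0 ?ler0n // l3; last by lra.
  by rewrite /h1 /h3 mulr0 mulr1 subrr clamp0.
have := loop_integral sc cP lP l01.
have lA := locally_additive_path OmegaE T0 cP lP.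
have i3 : (0 : R) <= 3^-1 by rewrite invr_ge0 ler0n.
have i31 : (3^-1 : R) <= 1 by lra.
have i32 : (3^-1 : R) <= 2 / 3 by lra.
have i21 : (2 / 3 : R) <= 1 by lra.
rewrite /path_integral (local_integralD i3 i31 lA).
rewrite (local_integralD i32 i21 (locally_additive_sub i3 (lexx _) lA)).
have prim r (rP : good_path Omega r) :
  exists K, primitive 0 1 (fun u v => jump T0 c (r u) (r v)) K.
  exact: (primitive_exists ler01 (locally_additive_path OmegaE T0 cP rP)).
have [Kp KpP] := prim p pP; have [Kq KqP] := prim q qP; have [Ks KsP] := prim s sP.
rewrite (local_integralE ler01 KpP) (local_integralE ler01 KqP) (local_integralE ler01 KsP).
have lip (h : R -> R) : (forall u v, h u - h v = 3 * (u - v)) \/ (forall u v, h u - h v = 3 * (v - u)) ->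
    forall u v, `|h u - h v| <= 3 * `|u - v|.
  by move=> [hE|hE] u v; rewrite hE normrM ger0_norm ?ler0n // distrC.
rewrite (@local_integral_ext _ 0 3^-1 _ (fun u v => jump T0 c (p (h1 u)) (p (h1 v)))); last first.
  move=> u v /andP[u0 u1] /andP[v0 v1]; rewrite !l1 // !clampE // /h1; lra.
rewrite (@local_integral_comp _ 0 1 0 3^-1 3 h1 (fun u v => jump T0 c (p u) (p v)) Kp) //; first last.
- by apply: lip; left => u v; rewrite /h1; ring.
- by move=> u /andP[u0 u1]; rewrite /h1; lra.
rewrite (@local_integral_ext _ 3^-1 (2 / 3) _ (fun u v => jump T0 c (s (h2 u)) (s (h2 v)))); last first.
  move=> u v uP vP; rewrite !l2 //; move: uP vP => /andP[u0 u1] /andP[v0 v1].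
  by rewrite !clampE // /h2; lra.
rewrite (@local_integral_comp _ 0 1 3^-1 (2 / 3) 3 h2 (fun u v => jump T0 c (s u) (s v)) Ks) //; first last.
- by apply: lip; left => u v; rewrite /h2; ring.
- by move=> u /andP[u0 u1]; rewrite /h2; lra.
rewrite (@local_integral_ext _ (2 / 3) 1 _ (fun u v => jump T0 c (q (h3 u)) (q (h3 v)))); last first.
  move=> u v /andP[u0 u1] /andP[v0 v1]; rewrite !l3 // !clampE // /h3; lra.
rewrite (@local_integral_comp _ 0 1 (2 / 3) 1 3 h3 (fun u v => jump T0 c (q u) (q v)) Kq) //; first last.
- by apply: lip; right => u v; rewrite /h3; ring.
- by move=> u /andP[u0 u1]; rewrite /h3; lra.
have -> : h1 3^-1 = 1 by rewrite /h1; field.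
have -> : h1 0 = 0 by rewrite /h1; ring.
have -> : h2 (2 / 3) = 1 by rewrite /h2; field.
have -> : h2 3^-1 = 0 by rewrite /h2; field.
have -> : h3 1 = 0 by rewrite /h3; ring.
have -> : h3 (2 / 3) = 1 by rewrite /h3; field.
lra.
Qed.

(** As for potentials of closed forms: integrate [c] from a fixed center to the center of [T]. A
    path is chosen for every point of [Omega], and [triangle_integral] compares the choices along
    segments inside one triangle. *)
Lemma simply_connected_cocycle c : simply_connected R X -> cocycle c ->
  exists k : tri M -> R, forall T T', meets Omega T T' -> c T T' = k T' - k T.
Proof.
move=> sc cP; have c0 := center_Omega OmegaE T0.
have path_to y : exists p, Omega y -> [/\ good_path Omega p, p 0 = center T0 & p 1 = y].
  have [yO|yO] := pselect (Omega y); last by exists (fun=> 0).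
  by have [p pP] := connecting_path sc c0 yO; exists p.
have [pa paP] := choice path_to.
have step T x y : tri_inside Omega T x -> tri_inside Omega T y ->
    path_integral c (pa x) + path_integral c (seg x y) = path_integral c (pa y).
  move=> xT yT; have [px x0 x1] := paP _ xT.2; have [py y0 y1] := paP _ yT.2.
  apply: triangle_integral => //; first exact: (good_seg_tri OmegaE xT yT).
  - by rewrite x0 y0.
  - by rewrite seg0.
  - by rewrite seg1.
exists (fun T => path_integral c (pa (center T))) => T T' TT.
have [mT mT' mO] := meeting_pointP TT; set m := meeting_point _ _ _ in mT mT' mO *.
have cT := center_tri_inside OmegaE T; have cT' := center_tri_inside OmegaE T'.
have e1 := step T _ _ cT (conj mT mO); have e2 := step T' _ _ (conj mT' mO) cT'.
rewrite (path_integral_seg OmegaE T0 cP cT (conj mT mO)) in e1.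
rewrite (path_integral_seg OmegaE T0 cP (conj mT' mO) cT') in e2.
rewrite !(tri_at_center OmegaE) !(cocycle_diag OmegaE) // in e1 e2.
have := cP T T' (tri_at m) m mO mT mT' (tri_atP OmegaE T0 mO); lra.
Qed.

(** Along a path between the centers the value of [k] on the current triangle is locally constant by
    [star_constant], so the zero function is a primitive of its jumps. *)
Lemma connected_constant (k : tri M -> R) T T' : simply_connected R X ->
  (forall S i S' i', adjacent S i S' i' -> k S = k S') -> k T = k T'.
Proof.
move=> sc kP; have [p [[pc pO] p0 p1]] :=
  connecting_path sc (center_Omega OmegaE T) (center_Omega OmegaE T').
rewrite -(tri_at_center OmegaE T0 T) -(tri_at_center OmegaE T0 T') -p0 -p1.
have := path_integral_delta T0 k p; rewrite /path_integral.
rewrite (@local_integralE _ _ _ _ (fun=> 0)) ?ler01 //.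
  by rewrite subrr => /esym/eqP; rewrite subr_eq0 => /eqP.
move=> t t01; have near_t := pc t _ (star_nbhs OmegaE T0 (pO t t01)).
have [r r0 rP] := (@nbhs_normP _ R^o t _).1 near_t; exists r => // u v uP vP.
have uT : in_tri (tri_at (p u)) (p t) by apply: rP; rewrite /ball_ /= distrC; case: uP.
have vT : in_tri (tri_at (p v)) (p t) by apply: rP; rewrite /ball_ /= distrC; case: vP.
have px : inside M (p t) by rewrite -OmegaE; exact: pO.
have e := star_constant (fun S i S' i' a _ => kP S i S' i' a) px uT vT.
by rewrite /jump e !subrr.
Qed.

End simple_connectedness.

(** * Broken spaces and periods *)

Section lines.
Variable R : realType.
Implicit Types (a b x y z : 'rV[R]_2) (p q g : mpoly.mpoly 2 R).

Lemma dot_grad w p : dot (mpoly.mderiv 0 p, mpoly.mderiv 1 p) w = dir_deriv w p.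
Proof. by []. Qed.

Lemma eval_dot (v : mpoly.mpoly 2 R * mpoly.mpoly 2 R) w x :
  eval (dot v w) x = w 0 0 * eval v.1 x + w 0 1 * eval v.2 x.
Proof. by rewrite /dot evalD !evalZ. Qed.

Lemma segmentP a b x : segment a b x <-> exists2 t : R, 0 <= t <= 1 & x = a + t *: (b - a).
Proof.
split=> [[t /= t01 <-]|[t t01 ->]].
  by exists t; [move: t01; rewrite in_itv|rewrite segE].
by exists t; [rewrite /= in_itv|rewrite segE].
Qed.

Lemma eval_scaled_dir w p x (c : R) :
  eval (dir_deriv (c *: w) p) x = c * eval (dir_deriv w p) x.
Proof. by rewrite /dir_deriv !evalD !evalZ !mxE; ring. Qed.

Lemma segment_diff a b y z : segment a b y -> segment a b z ->
  exists s : R, z - y = s *: (b - a).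
Proof.
move=> /segmentP[s _ ->] /segmentP[t _ ->]; exists (t - s).
by apply/rowP => j; rewrite !mxE; ring.
Qed.

Lemma deriv_along_segment a b g x y z :
  (forall u, segment a b u -> eval g u = 0) ->
  segment a b x -> segment a b y -> segment a b z -> eval (dir_deriv (z - y) g) x = 0.
Proof.
move=> g0 /segmentP[t t01 ->] yE zE; have [s ->] := segment_diff yE zE.
rewrite eval_scaled_dir -horner_on_line -deriv_on_line.
have -> : on_line a (b - a) g = 0.
  apply: poly_eq0_unit_interval => u u01; rewrite horner_on_line.
  by apply: g0; apply/segmentP; exists u.
by rewrite derivC horner0 mulr0.
Qed.

Lemma const_along_segment a b g x y :
  (forall u, segment a b u -> eval (dir_deriv (b - a) g) u = 0) ->
  segment a b x -> segment a b y -> eval g x = eval g y.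
Proof.
move=> g0 /segmentP[s s01 ->] /segmentP[t t01 ->]; rewrite -!horner_on_line.
have d0 : (on_line a (b - a) g)^`() = 0.
  apply: poly_eq0_unit_interval => u u01; rewrite deriv_on_line horner_on_line.
  by apply: g0; apply/segmentP; exists u.
have -> : on_line a (b - a) g = ((on_line a (b - a) g)`_0)%:P.
  apply/polyP => -[|i]; rewrite coefC //=.
  have /polyP/(_ i) := d0; rewrite coef_deriv coef0 => /eqP.
  by rewrite mulrn_eq0 /= => /eqP.
by rewrite !hornerC.
Qed.

End lines.

(** * Interelement conditions in pointwise form *)

Section broken_spaces.
Variables (R : realType) (M : triangulation R) (L : edge_labelling M) (d : nat).
Implicit Types (T : tri M) (k : 'I_3) (x y z : 'rV[R]_2).
Local Notation poly := (mpoly.mpoly 2 R).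

Definition labels (e : interior_edge M) T k T' k' : Prop :=
  [/\ adjacent T k T' k', T = tri_plus L e, T' = tri_minus L e &
      edge T k = segment (src L e) (tgt L e)].

Lemma labels_exists e : exists T k T' k', labels e T k T' k'.
Proof.
have /(is_edgeP _ (tri_nondegenerate _))[k kE] := tri_plus_edge L e.
have /(is_edgeP _ (tri_nondegenerate _))[k' kE'] := tri_minus_edge L e.
exists (tri_plus L e), k, (tri_minus L e), k'; split=> //; last by rewrite src_tgt kE.
by split; [exact: tri_plus_minus|rewrite /edge -kE -kE'].
Qed.

(** The triangles labelled at the edge of [T] and [T'] are these two, in some order, since an edge
    belongs to at most two triangles. *)
Lemma labels_adjacent T k T' k' : adjacent T k T' k' ->
  exists e, labels e T k T' k' \/ labels e T' k' T k.
Proof.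
move=> a; have nd := tri_nondegenerate.
have eP : edge T k \in [set E | exists S S' : tri M,
    [/\ S != S', is_edge (vtx S) E & is_edge (vtx S') E]].
  apply: mem_set; exists T, T'; split; first by case: a.
    by apply/(is_edgeP _ (nd _ _ _)); exists k.
  by apply/(is_edgeP _ (nd _ _ _)); exists k'; case: a.
pose e : interior_edge M := SigSub eP; exists e.
have [S [j [S' [j' [b SE SE' jE]]]]] := labels_exists e.
have kj : edge T k = edge S j by rewrite jE src_tgt.
have kj' : edge T k = edge S' j' by rewrite kj; case: b.
have SP i U : edge T k = edge U i -> U = T \/ U = T'.
  move=> kU; have [->|UT] := eqVneq U T; first by left.
  by right; apply: (@adjacent_unique _ _ T k U i T' k') => //; split=> //; rewrite eq_sym.
have [SS _] := b.
have kE : edge T k = segment (src L e) (tgt L e) by rewrite kj.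
case: (SP _ _ kj) => ST; case: (SP _ _ kj') => ST'.
- by rewrite ST ST' eqxx in SS.
- by left; split; rewrite // -?ST -?ST'.
- right; split; rewrite -?ST -?ST' //; first by rewrite ST ST'; exact: adjacent_sym.
  by rewrite ST; case: a => _ <-.
- by rewrite ST ST' eqxx in SS.
Qed.

(** Eliminates labels, orientations and coefficient vectors in favour of values on common edges. *)
Lemma V0P u : V0 L d u <-> broken d.+1 u /\
  forall T k T' k' x, adjacent T k T' k' -> edge T k x -> eval (u T) x = eval (u T') x.
Proof.
split=> [[ub u0]|[ub uc]]; split=> //.
  have H e T k T' k' : labels e T k T' k' -> forall x, edge T k x -> eval (u T) x = eval (u T') x.
    move=> [a -> -> kE] x; rewrite kE => /segmentP[t t01 ->].
    have /eqP := u0 e; rewrite subr_eq0 => /eqP/coef_eqP; apply=> //; exact: ub.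
  move=> T k T' k' x a xk; have [e [l|l]] := labels_adjacent a; first exact: (H _ _ _ _ _ l).
  by apply/esym/(H _ _ _ _ _ l); rewrite -(proj2 a).
move=> e; have [T [k [T' [k' [a TE TE' kE]]]]] := labels_exists e.
apply/eqP; rewrite subr_eq0; apply/eqP/coef_eqP; try exact: ub.
move=> t t01; rewrite -TE -TE'; apply: (uc _ _ _ _ _ a).
by rewrite kE; apply/segmentP; exists t.
Qed.

Lemma dot_degree m (v : poly * poly) w : deg_le m v.1 -> deg_le m v.2 ->
  deg_le m (dot v w).
Proof. by move=> v1 v2; apply: degree_boundD; exact: degree_boundZ. Qed.

Lemma corner_tangent T k T' k' e : labels e T k T' k' -> src L e != tgt L e.
Proof.
move=> [_ _ _ kE]; have [i [j [ij _ _ E]]] := edge_corners T k.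
apply/eqP => st; have single x : edge T k x -> x = src L e.
  by rewrite kE st => /segmentP[t _ ->]; rewrite subrr scaler0 addr0.
have e1 : edge T k (corner T i).
  by rewrite E; apply/segmentP; exists 0; rewrite ?lexx ?ler01 // scale0r addr0.
have e2 : edge T k (corner T j).
  by rewrite E; apply/segmentP; exists 1; rewrite ?lexx ?ler01 // scale1r addrC subrK.
by move: ij; rewrite (@corner_inj _ _ T i j) ?eqxx // (single _ e1) (single _ e2).
Qed.

(** Differences [z - y] of points of the edge are multiples of its unit tangent, so the
    normalization disappears from the condition. *)
Lemma V1P v : V1curl L d v <-> broken_field d v /\
  forall T k T' k' x y z, adjacent T k T' k' ->
    edge T k x -> edge T k y -> edge T k z ->
    eval (dot (v T) (z - y)) x = eval (dot (v T') (z - y)) x.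
Proof.
have scaled (u : poly * poly) w c x : eval (dot u (c *: w)) x = c * eval (dot u w) x.
  by rewrite !eval_dot !mxE; ring.
have tangent e T k T' k' : labels e T k T' k' -> exists2 c : R, c != 0 &
    unit_tangent (src L e) (tgt L e) = c *: (tgt L e - src L e).
  move=> /corner_tangent st; eexists; last by [].
  rewrite invr_eq0 sqrtr_eq0 -ltNge lt_neqAle sumr_ge0 => [|i _]; last exact: sqr_ge0.
  rewrite andbT eq_sym; apply: contra st; rewrite psumr_eq0 => [/allP s0|i _]; last exact: sqr_ge0.
  rewrite eq_sym -subr_eq0; apply/eqP/rowP => i; rewrite [RHS]mxE; apply/eqP.
  by have := s0 i; rewrite mem_index_enum /= sqrf_eq0; apply.
split=> [[vb v0]|[vb vc]]; split=> //.
  have H e T k T' k' : labels e T k T' k' -> forall x y z, edge T k x -> edge T k y ->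
      edge T k z -> eval (dot (v T) (z - y)) x = eval (dot (v T') (z - y)) x.
    move=> l x y z; have [c c0 cE] := tangent _ _ _ _ _ l; have [a TE TE' kE] := l.
    rewrite kE => /segmentP[t t01 ->] yE zE; have [s ->] := segment_diff yE zE.
    rewrite !scaled; congr (_ * _).
    have /eqP := v0 e; rewrite subr_eq0 => /eqP/coef_eqP H.
    have := H (dot_degree _ (vb _).1 (vb _).2) (dot_degree _ (vb _).1 (vb _).2) t t01.
    by rewrite cE !scaled => /(mulfI c0); rewrite -TE -TE'.
  move=> T k T' k' x y z a xk yk zk; have [e [l|l]] := labels_adjacent a.
    exact: (H _ _ _ _ _ l).
  by apply/esym/(H _ _ _ _ _ l); rewrite -(proj2 a).
move=> e; have [T [k [T' [k' l]]]] := labels_exists e.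
have [c c0 cE] := tangent _ _ _ _ _ l; have [a TE TE' kE] := l.
apply/eqP; rewrite subr_eq0; apply/eqP/coef_eqP; try exact: (dot_degree _ (vb _).1 (vb _).2).
move=> t t01; rewrite cE !scaled -TE -TE'; congr (_ * _).
apply: (vc _ _ _ _ _ _ _ a); rewrite kE; apply/segmentP.
- by exists t.
- by exists 0; rewrite ?lexx ?ler01 // scale0r addr0.
- by exists 1; rewrite ?lexx ?ler01 // scale1r addrC subrK.
Qed.

End broken_spaces.

(** The argument [d.+1] is the size bound of polynomials of degree [d]. *)
HB.lock Definition tri_potential (R : realType) (M : triangulation R) (d : nat)
  (v : {ffun tri M -> mpoly.mpoly 2 R * mpoly.mpoly 2 R}) (T : tri M) : mpoly.mpoly 2 R :=
  potential d.+1 (v T).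

(** * Periods of curl-free fields *)

Section periods.
Variables (R : realType) (M : triangulation R) (L : edge_labelling M) (d : nat).
Variable Omega : set 'rV[R]_2.
Hypothesis OmegaE : Omega = inside M.
Variable T0 : tri M.
Implicit Types (T : tri M) (k : 'I_3) (x y z : 'rV[R]_2).
Local Notation poly := (mpoly.mpoly 2 R).
Local Notation field := {ffun tri M -> poly * poly}.
Implicit Types (v : field) (u : {ffun tri M -> poly}).
Local Notation lam T x k := (bary (vtx T) x 0 k).

Local Notation tri_potential := (tri_potential d).

(* For [v] in [ker_curl], the choice of the meeting point is immaterial. *)
Definition period v T T' : R :=
  eval (tri_potential v T') (meeting_point Omega T T') -
  eval (tri_potential v T) (meeting_point Omega T T').

Lemma period_lin (a : R) v v' T T' :
  period (a *: v + v') T T' = a * period v T T' + period v' T T'.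
Proof.
have E S : tri_potential (a *: v + v') S = a *: tri_potential v S + tri_potential v' S.
  by rewrite tri_potential.unlock ffunE [(a *: v) S]ffunE potential_is_linear.
rewrite /period (E T) (E T'); move: (tri_potential v T) (tri_potential v T')
  (tri_potential v' T) (tri_potential v' T') (meeting_point Omega T T') => p p' q q' m.
by rewrite (evalD _ q') (evalD _ q) !evalZ; ring.
Qed.

Lemma ker_curl_potential v T : ker_curl L d v ->
  [/\ deg_le d.+1 (tri_potential v T), mpoly.mderiv 0 (tri_potential v T) = (v T).1
    & mpoly.mderiv 1 (tri_potential v T) = (v T).2].
Proof.
move=> [[vb _] v0]; have [v1 v2] := vb T.
have [|d0 d1] := @mderiv_potential R d.+1 (v T) v1 v2.
  have /ffunP/(_ T) := v0; rewrite !ffunE => /eqP; rewrite subr_eq0 => /eqP.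
  exact.
by rewrite tri_potential.unlock; split=> //; exact: potential_bound.
Qed.

Lemma ker_curl_dir v T w : ker_curl L d v -> dir_deriv w (tri_potential v T) = dot (v T) w.
Proof. by move=> /(ker_curl_potential T)[_ d0 d1]; rewrite /dir_deriv d0 d1. Qed.

(** The tangential derivative of the jump of potentials is the jump of the tangential component of
    [v], which is 0. *)
Lemma period_edge v T k T' k' x y : ker_curl L d v -> adjacent T k T' k' ->
  edge T k x -> edge T k y ->
  eval (tri_potential v T') x - eval (tri_potential v T) x =
  eval (tri_potential v T') y - eval (tri_potential v T) y.
Proof.
move=> vk a xk yk; rewrite -!evalB; have [i [j [_ _ _ kE]]] := edge_corners T k.
rewrite kE in xk yk; apply: (const_along_segment _ xk yk) => z; rewrite -kE => zk.
rewrite dir_derivB evalB (ker_curl_dir T' _ vk) (ker_curl_dir T _ vk).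
have /V1P[_ vc] := vk.1.
have iE : edge T k (corner T i).
  by rewrite kE; apply/segmentP; exists 0; rewrite ?lexx ?ler01 // scale0r addr0.
have jE : edge T k (corner T j).
  by rewrite kE; apply/segmentP; exists 1; rewrite ?lexx ?ler01 // scale1r addrC subrK.
by rewrite (vc _ _ _ _ _ _ _ a zk iE jE) subrr.
Qed.

Lemma common_cases T T' x y : common Omega T T' x -> common Omega T T' y ->
  [\/ T = T', x = y | exists k k', [/\ adjacent T k T' k', edge T k x & edge T k y]].
Proof.
move=> [xT xT' xO] [yT yT' yO]; have [TT|TT] := eqVneq T T'; first by constructor 1.
case: (conforming TT xT xT') => [[i [i' [_ I]]]|[k [k' [kk I]]]].
  by constructor 2; rewrite (I _ xT xT') (I _ yT yT').
by constructor 3; exists k, k'; split=> //; exact: I.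
Qed.

Lemma common_meets T T' x : common Omega T T' x -> meets Omega T T'.
Proof. by move=> [xT xT' xO]; exact: meetsP xT xT' xO. Qed.

Lemma periodE v T T' x : ker_curl L d v -> common Omega T T' x ->
  period v T T' = eval (tri_potential v T') x - eval (tri_potential v T) x.
Proof.
move=> vk xC; have mC := meeting_pointP (common_meets xC).
rewrite /period; case: (common_cases mC xC) => [->|->//|[k [k' [a mk xk]]]].
  by rewrite !subrr.
exact: period_edge vk a mk xk.
Qed.

Lemma period_cocycle v : ker_curl L d v -> cocycle Omega (period v).
Proof.
move=> vk T T' T'' x xO xT xT' xT''.
have c1 : common Omega T T' x by [].
have c2 : common Omega T' T'' x by [].
have c3 : common Omega T T'' x by [].
by rewrite (periodE vk c1) (periodE vk c2) (periodE vk c3); ring.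
Qed.

Lemma adjacent_common T k T' k' : adjacent T k T' k' ->
  exists2 m, edge T k m & common Omega T T' m.
Proof.
move=> a; have [m [mk mT mT' mi]] := adjacent_inside a; exists m => //.
by split; rewrite ?OmegaE.
Qed.

Lemma grad_V0 u : V0 L d u -> ker_curl L d (grad u).
Proof.
move=> /V0P[ub uc]; split; last first.
  by apply/ffunP => T; rewrite !ffunE /= mpoly.mderiv_comm subrr.
apply/V1P; split=> [T|T k T' k' x y z a xk yk zk].
  by rewrite ffunE /=; split; apply: degree_bound_deriv (ub T).
have [i [j [_ _ _ kE]]] := edge_corners T k.
rewrite kE in xk yk zk; rewrite !ffunE !dot_grad.
apply/eqP; rewrite -subr_eq0 -evalB -dir_derivB; apply/eqP.
apply: (deriv_along_segment _ xk yk zk) => t; rewrite -kE => tk.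
by rewrite evalB (uc _ _ _ _ _ a tk) subrr.
Qed.

Lemma period_exact v : ker_curl L d v ->
  range_grad L d v <-> exists k : tri M -> R, forall T T', meets Omega T T' ->
    period v T T' = k T' - k T.
Proof.
move=> vk; split=> [[u uV uv]|[k kP]].
  have cst T : exists c, tri_potential v T - u T = mpoly.mpolyC 2 c.
    have [_ d0 d1] := ker_curl_potential T vk.
    by apply: mderiv_eq0_const; rewrite mpoly.mderivB ?d0 ?d1 -uv ffunE subrr.
  have [k kP] := choice cst; exists k => T T' TT.
  have [mT mT' mO] := meeting_pointP TT; set m := meeting_point _ _ _ in mT mT' mO *.
  have pE S : eval (tri_potential v S) m = eval (u S) m + k S.
    by rewrite -[k S](evalC (k S) m) -kP -evalD addrC subrK.
  have /V0P[_ uc] := uV.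
  have mi : inside M m by rewrite -OmegaE.
  have um : eval (u T) m = eval (u T') m.
    exact: (@star_constant _ _ (fun S => eval (u S) m) m T T'
      (fun S i S' i' a mk => uc _ _ _ _ _ a mk) mi mT mT').
  by rewrite /period -/m !pE um; ring.
exists [ffun T => tri_potential v T - mpoly.mpolyC 2 (k T)].
  apply/V0P; split=> [T|T i T' i' x a xi].
    rewrite ffunE; have [pd _ _] := ker_curl_potential T vk.
    by apply: degree_boundB => //; apply: leq_trans (degree_boundC _) _.
  have [m mi mC] := adjacent_common a.
  have := kP T T' (common_meets mC).
  rewrite (periodE vk mC) (period_edge vk a mi xi) !ffunE !evalB !evalC; lra.
apply/ffunP => T; rewrite !ffunE !mpoly.mderivB !mpoly.mderivC !subr0.
by have [_ -> ->] := ker_curl_potential T vk; case: (v T).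
Qed.

(** For [x] in [Omega] compare every triangle with the one chosen at [x]. At a boundary vertex the
    triangles need not have a common point in [Omega], so only jumps across edges are prescribed, by
    [boundary_potential]. *)
Lemma vertex_potential c x : cocycle Omega c -> exists kap : tri M -> R,
  (forall T k T' k' i, corner T i = x -> adjacent T k T' k' -> edge T k x ->
     kap T' - kap T = c T T') /\
  (Omega x -> forall T T', in_tri T x -> in_tri T' x -> kap T' - kap T = c T T').
Proof.
move=> cP; have [xO|xO] := pselect (Omega x).
  have tx := tri_atP OmegaE T0 xO.
  have H T T' : in_tri T x -> in_tri T' x ->
      c (tri_at T0 x) T' - c (tri_at T0 x) T = c T T'.
    by move=> xT xT'; rewrite -(cP (tri_at T0 x) T T' x) //; ring.
  exists (c (tri_at T0 x)); split=> // T k T' k' i _ a xk; apply: H; first by case: xk.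
  by move: xk; rewrite (proj2 a) => -[].
have cN T k T' k' : adjacent T k T' k' -> - c T T' = - - c T' T.
  move=> /adjacent_common[m _ [mT mT' mO]]; rewrite opprK.
  have := cP T T' T m mO mT mT' mT; rewrite (cocycle_diag OmegaE) //.
  by move=> /eqP; rewrite addrC addr_eq0 => /eqP ->.
have xi : ~ inside M x by rewrite -OmegaE.
have [kap kapP] := boundary_potential (c := fun T T' => - c T T') cN xi.
exists kap; split=> // T k T' k' i Ti a xk.
by rewrite -opprB (kapP _ _ _ _ _ Ti a xk) opprK.
Qed.

(** On [T] take the affine function with value [kap x T] at each corner [x]. Across a common edge
    its jump is [c T T'] at both ends, hence constant by affinity, so the broken gradient has
    single-valued tangential components. The constants [k] measure the difference between this
    function and [tri_potential]. *)
Lemma cocycle_realized c : cocycle Omega c -> exists2 v, ker_curl L d v &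
  exists k : tri M -> R, forall T T', meets Omega T T' ->
    period v T T' = c T T' + (k T' - k T).
Proof.
move=> cP; have [kap kapP] := choice (fun x => vertex_potential x cP).
pose P T : poly := \sum_i kap (corner T i) T *: bary_poly (vtx T) i.
have evalP T x : eval (P T) x = \sum_i kap (corner T i) T * lam T x i.
  rewrite /P /eval raddf_sum /=; apply: eq_bigr => i _.
  by rewrite mpoly.mevalZ -/(eval _ x) eval_bary_poly.
have P_corner T i : eval (P T) (corner T i) = kap (corner T i) T.
  rewrite evalP (bigD1 i) //= lam_corner eqxx mulr1 big1 ?addr0 // => j ji.
  by rewrite lam_corner (negPf ji) mulr0.
have P_seg T x y t : eval (P T) (x + t *: (y - x)) =
    (1 - t) * eval (P T) x + t * eval (P T) y.
  rewrite !evalP !mulr_sumr -big_split; apply: eq_bigr => i _ /=.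
  by rewrite lam_seg; ring.
have P_edge T k T' k' x : adjacent T k T' k' -> edge T k x ->
    eval (P T') x - eval (P T) x = c T T'.
  move=> a; have [i [j [ij ki kj kE]]] := edge_corners T k.
  have jump_corner l : k != l -> eval (P T') (corner T l) - eval (P T) (corner T l) = c T T'.
    move=> kl; have lk : edge T k (corner T l) by apply: corner_edge; rewrite eq_sym.
    have [lT' _] : edge T' k' (corner T l) by rewrite -(proj2 a).
    have [l' ll] := corner_shared lT'.
    rewrite P_corner ll P_corner -ll.
    exact: ((kapP (corner T l)).1 _ _ _ _ _ erefl a lk).
  rewrite kE => /segmentP[t _ ->]; rewrite !P_seg.
  have := jump_corner i ki; have := jump_corner j kj; nra.
have P_deg T : deg_le 1 (P T).
  apply: degree_bound_sum => i _; apply: degree_boundZ; apply: degree_boundD.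
    by apply: leq_trans (degree_boundC _) _.
  by apply: degree_bound_sum => j _; apply: degree_boundZ; exact: degree_bound_coord.
pose u : {ffun tri M -> poly} := [ffun T => P T].
have vk : ker_curl L d (grad u).
  split; last by apply/ffunP => T; rewrite !ffunE /= mpoly.mderiv_comm subrr.
  apply/V1P; split=> [T|T k T' k' x y z a xk yk zk].
    rewrite !ffunE /=; split; apply: leq_trans (degree_bound_deriv _ (P_deg T)) _ => //.
  have [i [j [_ _ _ kE]]] := edge_corners T k.
  rewrite kE in xk yk zk; rewrite !ffunE !dot_grad.
  apply/eqP; rewrite -subr_eq0 -evalB -dir_derivB.
  have -> : dir_deriv (z - y) (P T - P T') =
      dir_deriv (z - y) (P T - P T' + mpoly.mpolyC 2 (c T T')).
    by rewrite [RHS]dir_derivD dir_derivC addr0.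
  apply/eqP; apply: (deriv_along_segment _ xk yk zk) => t; rewrite -kE => tk.
  rewrite evalD evalB evalC -(P_edge _ _ _ _ _ a tk); ring.
exists (grad u) => //.
have cst T : exists e, tri_potential (grad u) T - P T = mpoly.mpolyC 2 e.
  have [_ d0 d1] := ker_curl_potential T vk.
  by apply: mderiv_eq0_const; rewrite mpoly.mderivB ?d0 ?d1 !ffunE subrr.
have [k kP] := choice cst; exists k => T T' TT.
have mC := meeting_pointP TT; rewrite /period; set m := meeting_point _ _ _ in mC *.
have pE S : eval (tri_potential (grad u) S) m = eval (P S) m + k S.
  by rewrite -[k S](evalC (k S) m) -kP -evalD addrC subrK.
have [mT mT' mO] := mC; rewrite !pE.
suff <- : eval (P T') m - eval (P T) m = c T T' by ring.
(* Triangles meeting across an edge are settled by [P_edge]. If they meet in a single vertex, it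
   lies in [Omega] and the second property of [kap] gives the jump. *)
have [<-|TT'] := eqVneq T T'; first by rewrite subrr (cocycle_diag OmegaE).
case: (conforming TT' mT mT') => [[i [i' [ii I]]]|[l [l' [ll I]]]]; last first.
  by apply: (P_edge T l T' l') => //; exact: I.
have mi := I _ mT mT'.
rewrite {1}mi ii P_corner -ii mi P_corner -mi.
exact: ((kapP m).2 mO).
Qed.

End periods.

(** * Duality between cycles and cocycles *)

Section free_module_induction.
Variables (R : realType) (K : choiceType).
Local Notation freegT := (freeg.FreegDefs.type_of (Phant R) (Phant K)).

Lemma freeg_ind (P : freegT -> Prop) : P 0 ->
  (forall (a : R) D D', P D -> P D' -> P (a *: D + D')) ->
  (forall x, P (freeg.Freeg [:: (1 : R, x)])) -> forall D, P D.
Proof.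
move=> P0 Plin Px D; rewrite -(freeg.freeg_sumE D).
elim/big_ind: _ => // [D1 D2 P1 P2|x _].
  by rewrite -[D1]scale1r; exact: Plin.
have -> : freeg.Freeg [:: (freeg.coeff x D, x)] =
    freeg.coeff x D *: (freeg.Freeg [:: (1 : R, x)] : freegT) + 0.
  apply/eqP/freeg.freeg_eqP => y.
  by rewrite addr0 freeg.coeffZ !freeg.coeffU mul1r.
exact: Plin.
Qed.

End free_module_induction.

Section pair_rows.
Variables (R : realType) (I : finType).
Local Notation N := #|{: I * I}|.
Implicit Types (f g : I -> I -> R).

(** Weights on pairs of triangles as row vectors, to which matrix duality applies. *)
Definition pair_row f : 'rV[R]_N := \row_i f (enum_val i).1 (enum_val i).2.

Definition row_pair (a : 'rV[R]_N) (i j : I) : R := a 0 (enum_rank (i, j)).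

Lemma row_pairK a : pair_row (row_pair a) = a.
Proof. by apply/rowP => i; rewrite mxE /row_pair -surjective_pairing enum_valK. Qed.

Lemma pair_rowK f i j : row_pair (pair_row f) i j = f i j.
Proof. by rewrite /row_pair mxE enum_rankK. Qed.

Lemma sum_enum_val (V : nmodType) (J : finType) (F : J -> V) :
  \sum_(i < #|{: J}|) F (enum_val i) = \sum_j F j.
Proof. by rewrite (reindex (@enum_val J predT)) //=; apply: onW_bij; exact: enum_val_bij. Qed.

Lemma sum_pair_row (V : nmodType) (F : I -> I -> V) :
  \sum_(i < N) F (enum_val i).1 (enum_val i).2 = \sum_i \sum_j F i j.
Proof. by rewrite (sum_enum_val (fun p : I * I => F p.1 p.2)) pair_bigA. Qed.

Lemma pair_row_dot f g : (pair_row f *m (pair_row g)^T) 0 0 = \sum_i \sum_j f i j * g i j.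
Proof.
rewrite mxE -sum_pair_row; apply: eq_bigr => i _; by rewrite !mxE.
Qed.

End pair_rows.

(** * Cycles as combinations of connections *)

Section homology.
Variables (R : realType) (M : triangulation R) (Omega : set 'rV[R]_2).
Hypothesis OmegaE : Omega = inside M.
Variable T0 : tri M.
Local Notation X := (set_type Omega).
Local Notation pt := 'rV[R]_2.
Local Notation ch := (path_chain Omega).
Local Notation bd := (range (@boundary R X 1)).
Local Notation tri_at := (tri_at T0).
Local Notation chain_integral := (@chain_integral R M Omega T0).
Local Notation connection := (connection Omega).
Local Notation meets := (meets Omega).
Implicit Types (x y z : pt) (T : tri M) (c : tri M -> tri M -> R) (w : tri M -> tri M -> R).

Definition vertex0 : stdsimplex R 0.
Proof.
exists (const_mx 1); apply: mem_set; split=> [i|]; first by rewrite mxE ler01.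
by rewrite big_ord1 mxE.
Defined.

Lemma stdsimplex0 (l : stdsimplex R 0) : (set_val l : 'rV[R]_1) 0 0 = 1.
Proof. by have [_] := set_valP l; rewrite big_ord1. Qed.

Definition point_of (s : singular_simplex R X 0) : pt :=
  set_val ((set_val s : stdsimplex R 0 -> X) vertex0).

Lemma simplex0_eq (s s' : singular_simplex R X 0) : point_of s = point_of s' -> s = s'.
Proof.
move=> ss; apply/val_inj/funext => l; apply/val_inj.
have -> : l = vertex0 by apply/val_inj/rowP => j; rewrite !ord1 stdsimplex0 mxE.
exact: ss.
Qed.

Lemma point_of_face (s : singular_simplex R X 1) :
  point_of (face 0 s) = path_of s 1 /\ point_of (face 1 s) = path_of s 0.
Proof.
suff H : face_map 0 vertex0 = edge_point (1 : R) /\ face_map 1 vertex0 = edge_point (0 : R).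
  by rewrite /point_of /path_of -H.1 -H.2.
split; apply/val_inj/rowP => j.
  rewrite -[LHS]/(insert0 0 (const_mx 1) 0 j) [RHS]mxE /= clamp1 subrr.
  case: (unliftP 0 j) => [l ->|->]; last by rewrite (insert0E 0 _ 0).2.
  by rewrite (insert0E 0 _ l).1 mxE ord1.
rewrite -[LHS]/(insert0 1 (const_mx 1) 0 j) [RHS]mxE /= clamp0 subr0.
case: (unliftP 1 j) => [l ->|->]; last by rewrite (insert0E 1 _ 0).2.
by rewrite (insert0E 1 _ l).1 mxE ord1.
Qed.

Section extend_points.
Variables (V : lmodType R) (F : pt -> V).

Definition extend_points : singular_chain R X 0 -> V :=
  freeg.fglift (fun s => F (point_of s)).

Lemma extend_points_lin : linear extend_points.
Proof. exact: fglift_is_linear. Qed.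

Lemma extend_points0 : extend_points 0 = 0.
Proof.
by have := extend_points_lin (-1) 0 0; rewrite scaleN1r oppr0 addr0 scaleN1r addNr.
Qed.

Lemma extend_boundary (s : singular_simplex R X 1) :
  extend_points (boundary (chain_of s)) = F (path_of s 1) - F (path_of s 0).
Proof.
rewrite boundary_path -scaleN1r addrC extend_points_lin scaleN1r addrC.
by rewrite /extend_points /chain_of !freeg.liftU !scale1r (point_of_face s).1 (point_of_face s).2.
Qed.

End extend_points.

Lemma boundary_connection T T' (s s' : singular_simplex R X 0) :
  point_of s = center T -> point_of s' = center T' ->
  boundary (connection T T') = (meets T T')%:R *: (chain_of s' - chain_of s).
Proof.
move=> sT sT'; rewrite /connection; case: ifP => TT; last first.
  rewrite scale0r; have := boundary_is_linear (R := R) (Omega := Omega) (k := 0) (-1) 0 0.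
  by rewrite scaleN1r oppr0 addr0 scaleN1r addNr.
have [mT mT' mO] := meeting_pointP TT; set m := meeting_point _ _ _ in mT mT' mO *.
have cT := center_tri_inside OmegaE T; have cT' := center_tri_inside OmegaE T'.
have H1 := good_seg_tri OmegaE cT (conj mT mO).
have H2 := good_seg_tri OmegaE (conj mT' mO) cT'.
rewrite (path_chainE H1) (path_chainE H2) -[chain_of (simplex1 H1)]scale1r.
rewrite boundary_is_linear scale1r !boundary_path scale1r.
have -> : face 0 (simplex1 H2) = s'.
  by apply: simplex0_eq; rewrite (point_of_face _).1 path_of_simplex1 clamp1 seg1.
have -> : face 1 (simplex1 H1) = s.
  by apply: simplex0_eq; rewrite (point_of_face _).2 path_of_simplex1 clamp0 seg0.
have -> : face 0 (simplex1 H1) = face 1 (simplex1 H2).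
  apply: simplex0_eq; rewrite (point_of_face _).1 (point_of_face _).2 !path_of_simplex1.
  by rewrite clamp0 clamp1 seg0 seg1.
by rewrite addrC addrA subrK.
Qed.

(** Linear extension of [path_decomposed]: the tails at both ends of every path assemble into a
    function of the boundary alone, which vanishes for a cycle. *)
Lemma chain_decomposed D : exists w,
  bd (D + extend_points (base_chain Omega T0) (boundary D) -
      \sum_T \sum_T' w T T' *: connection T T').
Proof.
move: D; apply: freeg_ind.
- exists (fun _ _ => 0).
  have b0 : boundary (0 : singular_chain R X 1) = 0.
    have := boundary_is_linear (R := R) (Omega := Omega) (k := 0) (-1) 0 0.
    by rewrite scaleN1r oppr0 addr0 scaleN1r addNr.
  rewrite b0 extend_points0 addr0 big1 ?subr0; first exact: (boundaries_lin_closed Omega).1.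
  by move=> T _; apply: big1 => T' _; rewrite scale0r.
- move=> a D D' [w wP] [w' wP']; exists (fun T T' => a * w T T' + w' T T').
  have -> : \sum_T \sum_T' (a * w T T' + w' T T') *: connection T T' =
      a *: (\sum_T \sum_T' w T T' *: connection T T') + \sum_T \sum_T' w' T T' *: connection T T'.
    rewrite scaler_sumr -big_split; apply: eq_bigr => T _.
    rewrite scaler_sumr -big_split; apply: eq_bigr => T' _.
    by rewrite scalerDl scalerA.
  rewrite boundary_is_linear extend_points_lin.
  have := (boundaries_lin_closed Omega).2 a _ _ wP wP'; congr (bd _).
  by rewrite scalerBr scalerDr addrACA -opprD [X in X - _]addrACA.
- move=> s; rewrite -/(chain_of s) extend_boundary -path_chain_of.
  have [w wP] := path_decomposed OmegaE T0 (good_path_of s); exists w.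
  by move: wP; congr (bd (_ - _)); rewrite [RHS]addrA [RHS]addrAC.
Qed.

Lemma cycle_decomposed D : boundary D = 0 -> exists w,
  bd (D - \sum_T \sum_T' w T T' *: connection T T').
Proof.
by move=> D0; have [w] := chain_decomposed D; rewrite D0 extend_points0 addr0; exists w.
Qed.

Lemma chain_integral_connections c w : cocycle Omega c ->
  chain_integral c (\sum_T \sum_T' w T T' *: connection T T') =
  \sum_T \sum_T' ((meets T T')%:R * w T T') * c T T'.
Proof.
move=> cP; rewrite chain_integral_sum; apply: eq_bigr => T _.
rewrite chain_integral_sum; apply: eq_bigr => T' _.
rewrite chain_integralZ (chain_integral_connection OmegaE) //.
by case: ifP; rewrite ?mul1r ?mul0r ?mulr0.
Qed.

Lemma bd_triple T T' T'' x : Omega x -> in_tri T x -> in_tri T' x -> in_tri T'' x ->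
  bd (connection T T' + connection T' T'' - connection T T'').
Proof.
move=> xO xT xT' xT''.
have b1 := bd_connection OmegaE (And3 xT xT' xO).
have b2 := bd_connection OmegaE (And3 xT' xT'' xO).
have b3 := bd_connection OmegaE (And3 xT xT'' xO).
have b4 := bd_tri_rev OmegaE (conj xT' xO) (center_tri_inside OmegaE T').
have := bdD (bdB b3 (bdD b1 b2)) b4; congr (bd _).
move: (ch _) (ch _) (ch _) (ch _) (connection _ _) (connection _ _) (connection _ _).
by move=> *; chain_ring.
Qed.

(** Coefficients of the cocycle relation of a triple, or zero if its triangles have no common point
    in [Omega]. A vector annihilated by all these rows is therefore a cocycle. *)
Definition triple_row (t : tri M * tri M * tri M) : 'rV[R]_#|{: tri M * tri M}| :=
  pair_row (fun S S' => (`[< exists x, [/\ Omega x, in_tri t.1.1 x, in_tri t.1.2 x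
      & in_tri t.2 x] >])%:R *
    (((S == t.1.1) && (S' == t.1.2))%:R + ((S == t.1.2) && (S' == t.2))%:R -
     ((S == t.1.1) && (S' == t.2))%:R)).

Definition triple_mx : 'M[R]_(#|{: tri M * tri M * tri M}|, #|{: tri M * tri M}|) :=
  \matrix_i triple_row (enum_val i).

Lemma sum_delta_r (I : finType) (F : I -> I -> R) i j :
  \sum_k \sum_l ((k == i) && (l == j))%:R * F k l = F i j.
Proof. exact: (@sum_delta2 R I R^o). Qed.

(** The cycle is homologous to a combination of connections whose weights are orthogonal to all
    cocycles. By [submx_dual] the weights are combinations of triple relations, and each of these is
    a boundary by [bd_triple]. *)
Lemma null_homologous D : boundary D = 0 ->
  (forall c, cocycle Omega c -> chain_integral c D = 0) -> bd D.
Proof.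
move=> D0 Dc; have [w wP] := cycle_decomposed D0.
pose Lam (a : 'rV[R]_#|{: tri M * tri M}|) : singular_chain R X 1 :=
  \sum_i a 0 i *: connection (enum_val i).1 (enum_val i).2.
have LamE f : Lam (pair_row f) = \sum_T \sum_T' f T T' *: connection T T'.
  rewrite -(sum_pair_row (fun T T' => f T T' *: connection T T')).
  by apply: eq_bigr => i _; rewrite mxE.
pose f T T' := (meets T T')%:R * w T T'.
have sub : (pair_row f <= triple_mx)%MS.
  apply: submx_dual => c cT; pose cc := row_pair c.
  have ccP : cocycle Omega cc.
    move=> T T' T'' x xO xT xT' xT''.
    have := congr1 (fun A : 'cV_#|{: tri M * tri M * tri M}| => A (enum_rank (T, T', T'')) 0) cT.
    rewrite -(row_pairK c) [RHS]mxE.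
    have -> : (triple_mx *m (pair_row (row_pair c))^T) (enum_rank (T, T', T'')) 0 =
      (triple_row (T, T', T'') *m (pair_row (row_pair c))^T) 0 0.
      by rewrite [LHS]mxE [RHS]mxE; apply: eq_bigr => j _; rewrite [triple_mx _ _]mxE enum_rankK.
    rewrite pair_row_dot /=.
    have -> : `[< exists x, [/\ Omega x, in_tri T x, in_tri T' x & in_tri T'' x] >] = true.
      by apply/asboolP; exists x.
    rewrite (_ : \sum_i \sum_j _ = cc T T' + cc T' T'' - cc T T''); last first.
      rewrite -(sum_delta_r cc T T') -(sum_delta_r cc T' T'') -(sum_delta_r cc T T'').
      rewrite -sumrN -!big_split /=; apply: eq_bigr => S _.
      rewrite -sumrN -!big_split /=; apply: eq_bigr => S' _.
      by rewrite /cc; ring.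
    by move=> /eqP; rewrite subr_eq0 => /eqP.
  apply/matrixP => i j; rewrite !ord1 [RHS]mxE -(row_pairK c) pair_row_dot.
  rewrite -(chain_integral_connections w ccP) -(Dc cc ccP).
  have := chain_integral_boundary OmegaE T0 ccP wP.
  by rewrite chain_integralB => /eqP; rewrite subr_eq0 => /eqP <-.
have bdLam a : (a <= triple_mx)%MS -> bd (Lam a).
  move=> /submxP[y ->].
  have -> : Lam (y *m triple_mx) = \sum_t y 0 t *: Lam (triple_row (enum_val t)).
    rewrite /Lam; under [RHS]eq_bigr do rewrite scaler_sumr.
    rewrite exchange_big; apply: eq_bigr => i _ /=.
    rewrite mxE scaler_suml; apply: eq_bigr => t _.
    by rewrite [triple_mx _ _]mxE scalerA.
  elim/big_ind: _ => [||t _]; first exact: (boundaries_lin_closed Omega).1.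
    exact: bdD.
  rewrite -[_ *: _]addr0; apply: (boundaries_lin_closed Omega).2; last exact: (boundaries_lin_closed Omega).1.
  rewrite LamE; case: (enum_val t) => -[T T'] T'' /=.
  case: asboolP => [[x [xO xT xT' xT'']]|_]; last first.
    rewrite big1; first exact: (boundaries_lin_closed Omega).1.
    by move=> S _; apply: big1 => S' _; rewrite mul0r scale0r.
  have := bd_triple xO xT xT' xT''; congr (bd _).
  rewrite -(sum_delta2 (fun S S' => connection S S') T T').
  rewrite -(sum_delta2 (fun S S' => connection S S') T' T'').
  rewrite -(sum_delta2 (fun S S' => connection S S') T T'').
  rewrite -sumrN -!big_split /=; apply: eq_bigr => S _.
  rewrite -sumrN -!big_split /=; apply: eq_bigr => S' _.
  by rewrite mul1r scalerBl scalerDl.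
(* Masking the weights by [meets] leaves the chain unchanged, since the other connections are 0. *)
have := bdD wP (bdLam _ sub); rewrite LamE.
have -> : \sum_T \sum_T' ((meets T T')%:R * w T T') *: connection T T' =
    \sum_T \sum_T' w T T' *: connection T T'.
  apply: eq_bigr => T _; apply: eq_bigr => T' _.
  case TT : (meets T T'); first by rewrite mul1r.
  by rewrite (connection_eq0 TT) !scaler0.
by rewrite subrK.
Qed.

(** Row [S] is the coboundary of the indicator of one triangle, restricted to meeting pairs. *)
Definition delta_mx_pairs : 'M[R]_(#|tri M|, #|{: tri M * tri M}|) :=
  \matrix_S pair_row (fun T T' => (meets T T')%:R *
    ((T' == enum_val S)%:R - (T == enum_val S)%:R)).

Lemma delta_rows f : (pair_row f <= delta_mx_pairs)%MS <->
  exists k : tri M -> R, forall T T', f T T' = (meets T T')%:R * (k T' - k T).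
Proof.
have rowE (y : 'rV[R]_#|tri M|) : y *m delta_mx_pairs = pair_row (fun T T' =>
    (meets T T')%:R * (y 0 (enum_rank T') - y 0 (enum_rank T))).
  apply/rowP => i; rewrite [RHS]mxE mxE.
  case iE: (enum_val i) => [T T'] /=.
  have pick S : \sum_t y 0 t * (S == enum_val t)%:R = y 0 (enum_rank S).
    rewrite (bigD1 (enum_rank S)) //= enum_rankK eqxx mulr1 big1 ?addr0 // => t tS.
    case: eqP => [e|_]; last by rewrite mulr0.
    by move: tS; rewrite e enum_valK eqxx.
  rewrite -!pick -sumrB mulr_sumr; apply: eq_bigr => t _.
  by rewrite [delta_mx_pairs _ _]mxE mxE iE /=; ring.
split=> [/submxP[y yE]|[k kP]].
  exists (fun T => y 0 (enum_rank T)) => T T'.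
  by rewrite -(pair_rowK f) yE rowE pair_rowK.
apply/submxP; exists (\row_t k (enum_val t)); rewrite rowE.
by apply/rowP => i; rewrite !mxE kP !enum_rankK.
Qed.

(** Weights orthogonal to all coboundaries make the combination of connections a cycle. The integral
    of [c] over it vanishes, so [c] is orthogonal to these weights, and [submx_dual] makes it a
    coboundary. *)
Lemma exact_cocycle c : cocycle Omega c ->
  (forall D, boundary D = 0 -> chain_integral c D = 0) ->
  exists k : tri M -> R, forall T T', meets T T' -> c T T' = k T' - k T.
Proof.
move=> cP c0.
pose f T T' := (meets T T')%:R * c T T'.
suff /delta_rows[k kP] : (pair_row f <= delta_mx_pairs)%MS.
  by exists k => T T' TT; have := kP T T'; rewrite /f TT !mul1r.
apply: submx_dual => a aD; rewrite -(row_pairK a); pose w := row_pair a.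
apply/matrixP => i j; rewrite !ord1 [RHS]mxE pair_row_dot.
have -> : \sum_T \sum_T' (meets T T')%:R * c T T' * row_pair a T T' =
    \sum_T \sum_T' ((meets T T')%:R * w T T') * c T T'.
  by apply: eq_bigr => T _; apply: eq_bigr => T' _; rewrite /w; ring.
rewrite -(chain_integral_connections w cP); apply: c0.
have H0 (S : tri M) : good_path Omega (fun=> center S).
  by split; [exact: cst_continuous|move=> t _; exact: (center_Omega OmegaE)].
(* The 0-simplex at a center, obtained as a face of a constant path. *)
pose s S : singular_simplex R X 0 := face 0 (simplex1 (H0 S)).
have sP S : point_of (s S) = center S by rewrite (point_of_face _).1 path_of_simplex1.
pose bM := GRing.isLinear.Build _ _ _ _ _ (boundary_is_linear (R := R) (Omega := Omega) (k := 0)).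
pose B : {linear singular_chain R X 1 -> singular_chain R X 0} := HB.pack (@boundary R X 0) bM.
rewrite -[LHS]/(B _) linear_sum.
under eq_bigr => T _ do rewrite linear_sum.
have -> : \sum_T \sum_T' B (w T T' *: connection T T') =
    \sum_T \sum_T' \sum_S ((meets T T')%:R * w T T' * ((T' == S)%:R - (T == S)%:R)) *: chain_of (s S).
  apply: eq_bigr => T _; apply: eq_bigr => T' _.
  rewrite linearZ /= (boundary_connection (sP T) (sP T')) scalerA.
  have -> : chain_of (s T') - chain_of (s T) =
      \sum_S ((T' == S)%:R - (T == S)%:R) *: chain_of (s S).
    under eq_bigr do rewrite scalerBl.
    rewrite sumrB; congr (_ - _).
      rewrite (bigD1 T') //= eqxx scale1r big1 ?addr0 // => S.
      by rewrite eq_sym => /negPf ->; rewrite scale0r.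
    rewrite (bigD1 T) //= eqxx scale1r big1 ?addr0 // => S.
    by rewrite eq_sym => /negPf ->; rewrite scale0r.
  rewrite scaler_sumr; apply: eq_bigr => S _.
  by rewrite scalerA [w T T' * _]mulrC.
under eq_bigr => T _ do rewrite exchange_big.
rewrite exchange_big big1 // => S _.
under eq_bigr => T _ do rewrite -scaler_suml.
rewrite -scaler_suml; apply/eqP; rewrite scaler_eq0; apply/orP; left; apply/eqP.
(* The coefficient of the center of [S] in the boundary is the entry [S] of
   [delta_mx_pairs *m a^T]. *)
have := congr1 (fun A : 'cV_#|tri M| => A (enum_rank S) 0) aD.
rewrite [RHS]mxE => aS; rewrite -[RHS]aS.
have -> : (delta_mx_pairs *m a^T) (enum_rank S) 0 =
    (pair_row (fun T T' => (meets T T')%:R * ((T' == S)%:R - (T == S)%:R)) *m a^T) 0 0.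
  by rewrite [LHS]mxE [RHS]mxE; apply: eq_bigr => l _; rewrite [delta_mx_pairs _ _]mxE enum_rankK.
rewrite -(row_pairK a) pair_row_dot; apply: eq_bigr => T _; apply: eq_bigr => T' _.
by rewrite /w; ring.
Qed.

Lemma chain_integral_delta (k : tri M -> R) D : boundary D = 0 ->
  chain_integral (fun T T' => k T' - k T) D = 0.
Proof.
move=> D0; have : extend_points (fun x => k (tri_at x) : R^o) (boundary D) = 0.
  by rewrite D0 extend_points0.
move=> <-; move: D {D0}; apply: (@freeg_linear_ext R _ R^o _ (fun D =>
  extend_points (fun x => k (tri_at x) : R^o) (boundary D))).
- exact: chain_integral_is_linear.
- by move=> a D D'; rewrite boundary_is_linear extend_points_lin.
- by move=> s; rewrite -/(chain_of s) extend_boundary chain_integral_chain path_integral_delta.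
Qed.

(** Jumps between nearby parameters of a path only involve triangles sharing a point of the path, so
    values on other pairs never enter. *)
Lemma chain_integral_ext c c' D : cocycle Omega c ->
  (forall T T', meets T T' -> c T T' = c' T T') ->
  chain_integral c D = chain_integral c' D.
Proof.
move=> cP cc; move: D; apply: (@freeg_linear_ext R _ R^o).
- exact: chain_integral_is_linear.
- exact: chain_integral_is_linear.
move=> s; rewrite -/(chain_of s) !chain_integral_chain.
have [sc sO] := good_path_of s.
have [K KP] := primitive_exists ler01 (locally_additive_path OmegaE T0 cP (good_path_of s)).
rewrite /path_integral (local_integralE ler01 KP); apply/esym/local_integralE => // t t01.
have [e e0 eP] := KP t t01.
have [r r0 rP] := (@nbhs_normP _ R^o t _).1 (sc t _ (star_nbhs OmegaE T0 (sO t t01))).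
exists (Num.min e r); first by rewrite lt_min e0.
move=> u v /near_in_min[u1 u2] /near_in_min[v1 v2]; rewrite (eP _ _ u1 v1) /jump; apply: cc.
by apply: (@meetsP _ _ _ _ _ (path_of s t)); [apply: rP|apply: rP|exact: sO];
  rewrite /ball_ /= distrC; [case: u2|case: v2].
Qed.

End homology.

(** * Surjectivity of the curl *)

Section curl_surjective.
Variables (R : realType) (M : triangulation R) (L : edge_labelling M) (d : nat).
Hypothesis d_gt0 : (1 <= d)%N.
Implicit Types (T S : tri M) (x y z w : 'rV[R]_2).
Local Notation poly := (mpoly.mpoly 2 R).
Local Notation field := {ffun tri M -> poly * poly}.
Implicit Types (v : field).
Local Notation lam T x k := (bary (vtx T) x 0 k).
Local Notation dlam T w k := (dbary (vtx T) w 0 k).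
Local Notation nd := tri_nondegenerate.

Lemma V1curl_lin_closed : lin_closed (V1curl L d).
Proof.
split=> [|a v v' /V1P[vb vc] /V1P[vb' vc']]; apply/V1P; split.
- by move=> T; rewrite ffunE; split; exact: degree_bound0.
- by move=> T k T' k' x y z _ _ _ _; rewrite !ffunE.
- move=> T; have [v1 v2] := vb T; have [v1' v2'] := vb' T.
  by rewrite !ffunE; split; apply: degree_bound_lin.
- move=> T k T' k' x y z A xk yk zk.
  have D S : eval (dot ((a *: v + v') S) (z - y)) x =
      a * eval (dot (v S) (z - y)) x + eval (dot (v' S) (z - y)) x.
    have -> : (a *: v + v') S = (a *: (v S).1 + (v' S).1, a *: (v S).2 + (v' S).2).
      by rewrite ffunE [(a *: v) S]ffunE.
    by rewrite !eval_dot !evalD !evalZ; ring.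
  by rewrite !D (vc _ _ _ _ _ _ _ A xk yk zk) (vc' _ _ _ _ _ _ _ A xk yk zk).
Qed.

Lemma bary_poly_bound (V : 'M[R]_(3, 2)) k :
  (mpoly.mmeasure mpoly.mdeg (bary_poly V k) <= 2)%N.
Proof.
apply: degree_boundD; first by apply: leq_trans (degree_boundC _) _.
by apply: degree_bound_sum => j _; apply: degree_boundZ; exact: degree_bound_coord.
Qed.

Lemma dbary_coord (V : 'M[R]_(3, 2)) w k : dbary V w 0 k =
  w 0 0 * dbary V (delta_mx 0 0) 0 k + w 0 1 * dbary V (delta_mx 0 1) 0 k.
Proof.
have {1}-> : w = w 0 0 *: delta_mx 0 0 + (w 0 1 *: delta_mx 0 1 + 0).
  by rewrite {1}(row_sum_delta w) big_ord_recl big_ord1 addr0; congr (_ + _ *: delta_mx 0 _);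
    [congr (w 0 _)|]; apply/val_inj.
by rewrite !dbary_is_linear linear0 !mxE addr0.
Qed.

Lemma dir_deriv_bary_poly (V : 'M[R]_(3, 2)) w k :
  dir_deriv w (bary_poly V k) = mpoly.mpolyC 2 (dbary V w 0 k).
Proof.
have H (c : R) i : dir_deriv w (c *: mpoly.mpolyX R (mpoly.mnm1 i)) = mpoly.mpolyC 2 (c * w 0 i).
  by rewrite linearZ /= -/(coord_poly R i) dir_deriv_coord -mpoly.mul_mpolyC -mpoly.mpolyCM.
rewrite /bary_poly dir_derivD dir_derivC add0r big_ord_recl big_ord1 dir_derivD !H -mpoly.mpolyCD.
congr (mpoly.mpolyC 2 _); rewrite [RHS]dbary_coord mulrC [X in _ + X]mulrC.
by congr (_ * dbary _ (delta_mx _ _) _ _ + w 0 _ * dbary _ (delta_mx _ _) _ _); apply: val_inj.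
Qed.

(* The Whitney-type field [lam_a beta grad lam_b]. *)
Definition bubble T (a b : 'I_3) (beta : poly) : poly * poly :=
  (dlam T (delta_mx 0 0) b *: (bary_poly (vtx T) a * beta),
   dlam T (delta_mx 0 1) b *: (bary_poly (vtx T) a * beta)).

Lemma eval_bubble T a b beta w x :
  eval (dot (bubble T a b beta) w) x = dlam T w b * (lam T x a * eval beta x).
Proof.
by rewrite eval_dot /= !evalZ !evalM !eval_bary_poly [dlam T w b]dbary_coord; ring.
Qed.

Lemma bubble_bound T a b beta : (mpoly.mmeasure mpoly.mdeg beta <= d)%N ->
  deg_le d (bubble T a b beta).1 /\ deg_le d (bubble T a b beta).2.
Proof.
case: d d_gt0 => // e _ bb.
have H : (mpoly.mmeasure mpoly.mdeg (bary_poly (vtx T) a * beta) <= e.+2)%N.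
  by apply: (@degree_boundM _ 1 e) => //; exact: bary_poly_bound.
by split; apply: degree_boundZ.
Qed.

(** With [w] the gradient of [lam_b] turned by a right angle, the curl of P grad [lam_b] is the
    derivative of P along [w]. Since [lam_a] varies at a constant nonzero rate along [w], rescaling
    [w] gives [lam_a] derivative 1, and the antiderivative of [g] built from it is divisible by
    [lam_a]. *)
Lemma bubble_curl T a b g : a != b -> (mpoly.mmeasure mpoly.mdeg g <= d)%N ->
  exists2 beta, (mpoly.mmeasure mpoly.mdeg beta <= d)%N &
    mpoly.mderiv 0 (bubble T a b beta).2 - mpoly.mderiv 1 (bubble T a b beta).1 = g.
Proof.
move=> ab gb.
pose w : 'rV[R]_2 := dlam T (delta_mx 0 1) b *: delta_mx 0 0 +
  (- dlam T (delta_mx 0 0) b) *: delta_mx 0 1.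
have w0 : w 0 0 = dlam T (delta_mx 0 1) b by rewrite !mxE /=; ring.
have w1 : w 0 1 = - dlam T (delta_mx 0 0) b by rewrite !mxE /=; ring.
have wb : dlam T w b = 0 by rewrite dbary_coord w0 w1; ring.
(* If [lam_a] and [lam_b] were both constant along [w], then [w] would be 0 and [lam_b] would have
   zero gradient. *)
have J0 : dlam T w a != 0.
  apply/eqP => wa; have [c [ca cb cc]] := ord3P ab.
  have wc : dlam T w c = 0.
    have := dbary_sum w (nd T); rewrite (bigD1 a) //= (bigD1 b) 1?eq_sym //= (bigD1 c) /=; last by rewrite ca cb.
    rewrite wa wb !add0r big1 ?addr0 // => i /andP[/andP[ia ib] ic].
    by case: (cc i) => ii; move: ia ib ic; rewrite ii eqxx.
  have w00 : w = 0.
    rewrite (dbaryK w (nd T)) big1 // => i _.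
    by case: (cc i) => ->; rewrite ?wa ?wb ?wc scale0r.
  have := dbaryE (vtx T) (corner T a) (corner T b) => /rowP/(_ b).
  rewrite dbary_coord; have := w0; have := w1; rewrite w00 !mxE => /esym/eqP.
  rewrite oppr_eq0 => /eqP -> <-; rewrite !mulr0 addr0 !lam_corner eqxx eq_sym (negPf ab).
  by rewrite subr0 => /eqP; rewrite eq_sym oner_eq0.
pose t := (dlam T w a)^-1 *: w.
have tl : dir_deriv t (bary_poly (vtx T) a) = 1.
  by rewrite dir_deriv_bary_poly [dbary _ t]linearZ mxE mulVf.
have gb' : (mpoly.mmeasure mpoly.mdeg ((dlam T w a)^-1 *: g) <= d)%N by exact: degree_boundZ.
exists (antideriv_quot d t (bary_poly (vtx T) a) ((dlam T w a)^-1 *: g)).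
  by apply: antideriv_quot_bound => //; exact: bary_poly_bound.
rewrite /bubble /= -/(antideriv _ _ _ _).
set P := antideriv _ _ _ _.
have wt : w = dlam T w a *: t + 0 by rewrite addr0 scalerA mulfV // scale1r.
transitivity (dir_deriv w P).
  by rewrite /dir_deriv w0 w1 !mpoly.mderivZ scaleNr.
rewrite wt dir_deriv_dir dir_deriv_antideriv // scalerA mulfV // scale1r.
by rewrite /dir_deriv !mxE !scale0r !addr0.
Qed.

Lemma edge_supported_V1 T k v : broken_field d v ->
  (forall S i x y z, edge S i <> edge T k -> edge S i x -> edge S i y -> edge S i z ->
     eval (dot (v S) (z - y)) x = 0) ->
  (forall T' k' x y z, adjacent T k T' k' -> edge T k x -> edge T k y -> edge T k z ->
     eval (dot (v T) (z - y)) x = eval (dot (v T') (z - y)) x) ->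
  V1curl L d v.
Proof.
move=> vb v0 vT; apply/V1P; split=> // S i S' i' x y z A xi yi zi.
have [Ei|Ei] := pselect (edge S i = edge T k); last first.
  have [_ EE] := A; rewrite (v0 _ _ _ _ _ Ei xi yi zi); rewrite EE in Ei xi yi zi.
  by rewrite (v0 _ _ _ _ _ Ei xi yi zi).
have [ST|ST] := eqVneq S T.
  have ik : i = k by subst S; apply: (side_inj (nd T)); rewrite -/(edge T i) Ei.
  by subst S i; exact: vT A xi yi zi.
have AT : adjacent T k S i by split; [rewrite eq_sym|].
have [S'T|S'T] := eqVneq S' T.
  by subst S'; apply/esym/(vT _ _ _ _ _ AT); rewrite -Ei.
have AT' : adjacent T k S' i' by split; [rewrite eq_sym|rewrite -Ei; exact: proj2 A].
by have := proj1 A; rewrite (adjacent_unique AT AT') eqxx.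
Qed.

(** The same [beta] serves on every triangle with both corners; they are looked up because the
    neighbour may number them differently. *)
Definition bubble_field T (a b : 'I_3) beta : field :=
  [ffun S => if [pick p : 'I_3 * 'I_3 | (corner S p.1 == corner T a) &&
     (corner S p.2 == corner T b)] is Some p then bubble S p.1 p.2 beta else 0].

Lemma bubble_fieldE T S a b a' b' beta : corner S a' = corner T a ->
  corner S b' = corner T b -> bubble_field T a b beta S = bubble S a' b' beta.
Proof.
move=> Ea Eb; rewrite ffunE; case: pickP => [[i j] /= /andP[/eqP ia /eqP jb]|/(_ (a', b'))].
  by rewrite (@corner_inj _ _ S i a') 1?(@corner_inj _ _ S j b') ?ia ?Ea ?jb ?Eb.
by rewrite /= Ea Eb !eqxx.
Qed.

Lemma bubble_field_out T S a b k beta : a != b -> k != a -> k != b ->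
  (forall i, edge S i <> edge T k) -> bubble_field T a b beta S = 0.
Proof.
move=> ab ka kb Sk; rewrite ffunE; case: pickP => // -[i j] /= /andP[/eqP ia /eqP jb].
have ij : i != j.
  by apply: contra ab => /eqP ij; apply/eqP/(@corner_inj _ _ T); rewrite -ia ij.
have [c [ci cj _]] := ord3P ij; case: (Sk c).
rewrite /edge -(sideE (nd S) ij ci cj) -(sideE (nd T) ab ka kb).
by rewrite -!/(corner _ _) ia jb.
Qed.

(** The tangential component vanishes on the sides opposite [a] and [b], where [lam_a] or [lam_b] is
    0. On the common side the traces of [lam_a] and [lam_b] are the same from both triangles. *)
Lemma bubble_field_V1 T a b k beta : a != b -> k != a -> k != b ->
  (mpoly.mmeasure mpoly.mdeg beta <= d)%N -> V1curl L d (bubble_field T a b beta).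
Proof.
move=> ab ka kb bb.
have kE : edge T k = segment (corner T a) (corner T b) by rewrite /edge -(sideE (nd T) ab ka kb).
apply: (@edge_supported_V1 T k) => [S|S i x y z Si xi yi zi|T' k' x y z A xk yk zk].
- rewrite ffunE; case: pickP => [p _|_]; first exact: bubble_bound.
  by split; exact: degree_bound0.
- have zero : eval (dot (0 : poly * poly) (z - y)) x = 0.
    have e0 : eval (0 : poly) x = 0 by rewrite -(subrr (0 : poly)) evalB subrr.
    by rewrite eval_dot [X in _ * X + _]e0 [X in _ + _ * X]e0 !mulr0 addr0.
  rewrite ffunE; case: pickP => [[a' b'] /= /andP[/eqP Ea /eqP Eb]|_]; last exact: zero.
  rewrite eval_bubble; have ab' : a' != b'.
    by apply: contra ab => /eqP ij; apply/eqP/(@corner_inj _ _ T); rewrite -Ea ij.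
  have [c [ca cb cc]] := ord3P ab'.
  case: (cc i) => ii; move: Si xi yi zi; rewrite ii => Si xi yi zi.
  + by rewrite (proj2 xi) mul0r mulr0.
  + have := dbaryE (vtx S) y z => /rowP/(_ b'); rewrite !mxE => ->.
    by rewrite (proj2 yi) (proj2 zi); ring.
  + case: Si; rewrite kE -Ea -Eb; rewrite /edge -(sideE (nd S) ab' ca cb).
    by [].
- have [TT EE] := A.
  have shared l : k != l -> exists l', corner T l = corner T' l'.
    move=> kl; have lk : edge T k (corner T l) by apply: corner_edge; rewrite eq_sym.
    by apply: corner_shared; move: lk; rewrite EE => -[].
  have [a' Ea] := shared a ka; have [b' Eb] := shared b kb.
  rewrite (bubble_fieldE beta (erefl (corner T a)) (erefl (corner T b))).
  rewrite (bubble_fieldE beta (esym Ea) (esym Eb)) !eval_bubble.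
  have same l l' u : corner T l = corner T' l' -> edge T k u -> lam T u l = lam T' u l'.
    move=> El; rewrite kE => /segmentP[t _ ->]; rewrite !lam_seg.
    have ab' : a' != b'.
      by apply: contra ab => /eqP ij; apply/eqP/(@corner_inj _ _ T); rewrite Ea ij.
    have eqc i i' : corner T i = corner T' i' -> lam T (corner T i) l = lam T' (corner T i) l'.
      move=> Ei; rewrite lam_corner Ei lam_corner; congr (nat_of_bool _)%:R.
      apply/eqP/eqP => ?; first by subst; apply: (@corner_inj _ _ T'); rewrite -El.
      by subst; apply: (@corner_inj _ _ T); rewrite Ei.
    by rewrite (eqc a a') // (eqc b b').
  have dl (S : tri M) l : dlam S (z - y) l = lam S z l - lam S y l.
    by have := dbaryE (vtx S) y z => /rowP/(_ l) ->; rewrite !mxE.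
  by rewrite !dl (same _ _ _ Ea xk) (same _ _ _ Eb yk) (same _ _ _ Eb zk).
Qed.

Definition curl_reaches T : Prop := forall g, (mpoly.mmeasure mpoly.mdeg g <= d)%N ->
  exists2 v, V1curl L d v & curl v = [ffun S => if S == T then g else 0].

Lemma curlD v v' : curl (v + v') = curl v + curl v'.
Proof.
apply/ffunP => T; rewrite !ffunE !mpoly.mderivD.
by rewrite opprD addrACA.
Qed.

Lemma curl_degree v T : broken_field d v -> (mpoly.mmeasure mpoly.mdeg (curl v T) <= d)%N.
Proof.
move=> /(_ T)[v1 v2]; rewrite ffunE.
by apply: degree_boundB; [apply: degree_bound_deriv v2|apply: degree_bound_deriv v1].
Qed.

Lemma curl_reaches_adjacent T k :
  (forall T' k', adjacent T k T' k' -> curl_reaches T') -> curl_reaches T.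
Proof.
move=> RT g gb; have [a [b [ab ka kb _]]] := edge_corners T k.
have [beta bb curlT] := bubble_curl T ab gb.
pose u := bubble_field T a b beta.
have uV : V1curl L d u by exact: bubble_field_V1 ab ka kb bb.
have uT : curl u T = g.
  by rewrite ffunE (bubble_fieldE beta (erefl (corner T a)) (erefl (corner T b))).
have uout S : (forall i, edge S i <> edge T k) -> curl u S = 0.
  move=> Sk; rewrite ffunE (bubble_field_out beta ab ka kb Sk).
  by rewrite !mpoly.mderiv0 subrr.
(* The neighbour across the edge, if any, receives a curl that a field for that neighbour
   compensates; at a boundary edge nothing has to be corrected. *)
have [[[T' k'] /= A]|none] := pselect (exists p : tri M * 'I_3, adjacent T k p.1 p.2).
  have [|v vV vE] := RT T' k' A (- curl u T').
    by rewrite -scaleN1r; apply: degree_boundZ; apply: curl_degree; have [] := uV.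
  exists (u + v); first by rewrite -[u]scale1r; apply: V1curl_lin_closed.2.
  apply/ffunP => S.
  have vS : curl v S = if S == T' then - curl u T' else 0 by rewrite vE ffunE.
  have -> : curl (u + v) S = curl u S + curl v S by rewrite curlD [LHS]ffunE.
  rewrite vS [RHS]ffunE.
  have [->|ST] := eqVneq S T.
    by rewrite (negPf (proj1 A)) uT addr0.
  have [->|ST'] := eqVneq S T'; first by rewrite subrr.
  rewrite addr0; apply: uout => i Ei.
  have AS : adjacent T k S i by split; [rewrite eq_sym|].
  by move: ST'; rewrite (adjacent_unique A AS) eqxx.
exists u => //; apply/ffunP => S; rewrite [RHS]ffunE; case: eqVneq => [->//|ST].
by apply: uout => i Ei; apply: none; exists (S, i); split; [rewrite eq_sym|].
Qed.

(** If some triangle failed, every edge of a failing triangle would have a failing neighbour, by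
    [curl_reaches_adjacent]; such a family cannot exist. *)
Lemma curl_reaches_all T : curl_reaches T.
Proof.
apply: contrapT => TR.
apply: (@no_closed_family _ _ [set S | ~~ `[< curl_reaches S >]]%SET).
  by apply/finset.set0Pn; exists T; rewrite inE; apply/asboolPn.
move=> S k; rewrite inE => /asboolPn SR.
apply: contrapT => none; apply: SR; apply: (@curl_reaches_adjacent S k) => T' k' A.
apply: contrapT => T'R; apply: none; exists T', k'; split=> //.
by rewrite inE; apply/asboolPn.
Qed.

Lemma curl_surjective : @curl R M @` V1curl L d = V2 d.
Proof.
apply/seteqP; split=> [_ [v [vb _] <-] T|g gb].
  by apply: leq_trans (curl_degree T vb) _; rewrite prednK.
have H T : exists v, V1curl L d v /\ curl v = [ffun S => if S == T then g T else 0].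
  have [|v vV vE] := @curl_reaches_all T (g T); last by exists v.
  by have := gb T; rewrite /deg_le prednK.
have [v vP] := choice H.
exists (\sum_T v T).
  elim/big_ind: _ => [|x y xV yV|T _]; first exact: V1curl_lin_closed.1.
    by rewrite -[x]scale1r; apply: V1curl_lin_closed.2.
  by have [] := vP T.
have -> : curl (\sum_T v T) = \sum_T curl (v T).
  apply: (big_morph _ curlD).
  by apply/ffunP => S; rewrite !ffunE !mpoly.mderiv0 subrr.
apply/ffunP => S; rewrite sum_ffunE (bigD1 S) //= (vP S).2 ffunE eqxx big1 ?addr0 // => T TS.
by rewrite (vP T).2 ffunE eq_sym (negPf TS).
Qed.

End curl_surjective.

(** * The discrete de Rham sequence *)

Section chains.
Variables (R : realType) (Omega : set 'rV[R]_2).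
Local Notation X := (set_type Omega).

Lemma boundary_boundary (D : singular_chain R X 2) : boundary (boundary D) = 0.
Proof.
pose f D : singular_chain R X 0 := boundary (boundary D).
suff /(_ D) : f =1 (fun=> 0) by [].
apply: freeg_linear_ext.
- by move=> a x y; rewrite /f !boundary_is_linear.
- by move=> a x y; rewrite scaler0 addr0.
move=> s; rewrite -/(chain_of s) /f boundary_simplex.
pose bM := GRing.isLinear.Build _ _ _ _ _ (boundary_is_linear (R := R) (Omega := Omega) (k := 0)).
pose B : {linear singular_chain R X 1 -> singular_chain R X 0} := HB.pack (@boundary R X 0) bM.
have pE i (j : 'I_2) h : (forall t, face_map i (edge_point t) = triangle_point (h t)) ->
    point_of (face j (face i s)) = square_of s (h (if j == 0 then 1 else 0)).
  move=> hP; have [p0 p1] := point_of_face (face i s).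
  case: (ord2P j) => ->; rewrite ?p0 ?p1 (@path_of_face _ _ _ _ _ hP) //.
have e1 : face 0 (face 0 s) = face 0 (face 1 s).
  by apply: simplex0_eq; rewrite (pE _ _ _ (@face_edge0 R)) (pE _ _ _ (@face_edge1 R)).
have e2 : face 1 (face 0 s) = face 0 (face 2 s).
  by apply: simplex0_eq; rewrite (pE _ _ _ (@face_edge0 R)) (pE _ _ _ (@face_edge2 R)).
have e3 : face 1 (face 1 s) = face 1 (face 2 s).
  apply: simplex0_eq; rewrite (pE _ _ _ (@face_edge1 R)) (pE _ _ _ (@face_edge2 R)) /=.
  by rewrite /square_of (triangle_point_apex 0 1).
rewrite -[LHS]/(B _) linearD linearB /= !boundary_path e1 e2 e3.
have cancel (V : zmodType) (a b c : V) : a - b - (a - c) + (b - c) = 0.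
  by rewrite -[a - b](subrKA c) [X in X + _]addrAC subrr add0r subrKA subrr.
exact: cancel.
Qed.

Lemma cycles_lin_closed : lin_closed [set z : singular_chain R X 1 | boundary z = 0].
Proof.
split=> [|a x y /= x0 y0]; last by rewrite /= boundary_is_linear x0 y0 scaler0 addr0.
by have := @boundary_is_linear R Omega 0 (-1) 0 0; rewrite /= scaler0 addr0 scaleN1r addNr => <-.
Qed.

End chains.

Section de_rham.
Variables (R : realType) (M : triangulation R) (L : edge_labelling M) (d : nat).
Variable Omega : set 'rV[R]_2.
Hypothesis OmegaE : Omega = inside M.
Variable T0 : tri M.
Local Notation X := (set_type Omega).
Local Notation poly := (mpoly.mpoly 2 R).
Local Notation field := {ffun tri M -> poly * poly}.
Implicit Types (v : field).

Lemma ker_curl_lin_closed : lin_closed (ker_curl L d).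
Proof.
have c0 : curl (0 : field) = 0.
  by apply/ffunP => T; rewrite !ffunE !mpoly.mderiv0 subrr.
split=> [|a v v' [vV v0] [vV' v0']]; first by split=> //; exact: (V1curl_lin_closed L d).1.
split; first exact: (V1curl_lin_closed L d).2.
have E S : (a *: v + v') S = (a *: (v S).1 + (v' S).1, a *: (v S).2 + (v' S).2).
  by rewrite ffunE [(a *: v) S]ffunE.
apply/ffunP => T; rewrite [LHS]ffunE E /= !mpoly.mderivD !mpoly.mderivZ opprD addrACA -scalerBr.
have := congr1 (fun f : {ffun tri M -> poly} => f T) v0; rewrite /= ffunE => ->.
have := congr1 (fun f : {ffun tri M -> poly} => f T) v0'; rewrite /= ffunE => ->.
by rewrite [RHS]ffunE [X in a *: X]ffunE scaler0 add0r ffunE.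
Qed.

Lemma range_grad_ker_curl : range_grad L d `<=` ker_curl L d.
Proof. by move=> _ [u uV <-]; exact: grad_V0. Qed.

Lemma const_injective : injective (@const R M).
Proof.
move=> a b /(congr1 (fun f : {ffun tri M -> poly} => f T0)); rewrite !ffunE => ab.
by rewrite -(evalC a 0) ab evalC.
Qed.

Lemma ker_gradE : simply_connected R X -> ker_grad L d = range (@const R M).
Proof.
move=> sc; apply/seteqP; split=> [u [/V0P[ub uc] u0]|_ [c _ <-]]; last first.
  split; last by apply/ffunP => T; rewrite !ffunE !mpoly.mderivC.
  apply/V0P; split=> [T|T k T' k' x _ _]; rewrite !ffunE //.
  by apply: leq_trans (degree_boundC _) _.
have H T : exists c, u T = mpoly.mpolyC 2 c.
  have /ffunP/(_ T) := u0; rewrite !ffunE => -[d0 d1].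
  exact: mderiv_eq0_const d0 d1.
have [k kP] := choice H.
exists (k T0) => //; apply/ffunP => T; rewrite ffunE kP; congr (mpoly.mpolyC 2 _).
apply: (connected_constant OmegaE T0 _ _ sc) => S i S' i' A.
have [m mi _] := adjacent_common OmegaE A.
by have := uc _ _ _ _ _ A mi; rewrite !kP !evalC.
Qed.

Lemma ker_curl_exact : simply_connected R X -> ker_curl L d = range_grad L d.
Proof.
move=> sc; apply/seteqP; split=> [v vk|]; last exact: range_grad_ker_curl.
apply/(period_exact OmegaE vk).
exact: (simply_connected_cocycle OmegaE T0 sc (period_cocycle vk)).
Qed.

(** The periods modulo coboundaries form a linear map into a finite-dimensional space, whose kernel
    on curl-free fields consists of the gradients. The cokernel matrix implements the quotient. *)
Lemma curl_cohomology_finite : exists b, quotient_dim (ker_curl L d) (range_grad L d) b.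
Proof.
pose f v T T' := (meets Omega T T')%:R * period d Omega v T T'.
pose psi v := pair_row (f v) *m cokermx (delta_mx_pairs M Omega).
have psi_lin : linear psi.
  move=> a v v'; rewrite /psi scalemxAl -mulmxDl; congr (_ *m _).
  by apply/rowP => i; rewrite !mxE /f period_lin; ring.
pose psiM := GRing.isLinear.Build _ _ _ _ _ psi_lin.
apply: (@quotient_dim_finite R field _ _ _ (HB.pack psi psiM)).
- exact: ker_curl_lin_closed.
- exact: range_grad_ker_curl.
move=> v vk; rewrite (period_exact OmegaE vk) /=.
split=> [[k kP]|/eqP]; last rewrite -submxE => /delta_rows[k kP].
  apply/eqP; rewrite -submxE; apply/delta_rows; exists k => T T'.
  by rewrite /f; case: (boolP (meets _ T T')) => [/kP->|]; rewrite ?mul0r.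
by exists k => T T' TT; have := kP T T'; rewrite /f TT !mul1r.
Qed.

(** The pairing integrates the periods of a field over a chain. Its kernels on both sides are
    [null_homologous], together with [cocycle_realized], and [exact_cocycle], together with
    [period_exact]. *)
Lemma betti_number_cohomology b :
  quotient_dim (ker_curl L d) (range_grad L d) b -> first_betti_number R X b.
Proof.
have ci_ext (c c' : tri M -> tri M -> R) (D : singular_chain R X 1) : cocycle Omega c ->
    (forall T T', meets Omega T T' -> c T T' = c' T T') ->
    chain_integral T0 c D = chain_integral T0 c' D.
  exact: chain_integral_ext.
apply: (quotient_dim_pairing (form := fun D v => chain_integral T0 (period d Omega v) D)).
- exact: cycles_lin_closed.
- by move=> _ [D _ <-]; exact: boundary_boundary.
- exact: ker_curl_lin_closed.
- exists 0; last by apply/ffunP => T; rewrite !ffunE !mpoly.mderiv0.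
  apply/V0P; split=> [T|T k T' k' x _ _]; rewrite !ffunE //; exact: degree_bound0.
- by move=> v; exact: chain_integral_is_linear.
- move=> D a v v' vk vk' /=.
  rewrite -(chain_integral_lin OmegaE T0 a D (period_cocycle vk) (period_cocycle vk')).
  by congr (chain_integral T0 _ D); apply/funext => T; apply/funext => T'; exact: period_lin.
- move=> D D0; split=> [Db v vk|Dv].
    exact: (chain_integral_boundary OmegaE T0 (period_cocycle vk) Db).
  apply: (null_homologous OmegaE (T0 := T0) D0) => c cP.
  have [v vk [k kP]] := cocycle_realized L d OmegaE T0 cP.
  have := Dv v vk; rewrite (ci_ext _ _ _ (period_cocycle vk) kP) /=.
  (* The realized periods differ from [c] by this coboundary, whose integral over the cycle [D] is
     0. *)
  pose dk T T' := k T' - k T.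
  have dkP : cocycle Omega dk by move=> T T' T'' x _ _ _ _; rewrite /dk; ring.
  have -> : (fun T T' => c T T' + (k T' - k T)) = (fun T T' => 1 * c T T' + dk T T').
    by apply/funext => T; apply/funext => T'; rewrite mul1r.
  rewrite (chain_integral_lin OmegaE T0 1 D cP dkP) mul1r.
  have dk0 : chain_integral T0 dk D = 0 by exact: (chain_integral_delta T0 k D0).
  by rewrite dk0 addr0 => ->.
move=> v vk; rewrite (period_exact OmegaE vk); split=> [[k kP] D D0|vD].
  by rewrite (ci_ext _ _ _ (period_cocycle vk) kP) (chain_integral_delta T0 k D0).
exact: (exact_cocycle OmegaE (period_cocycle vk) vD).
Qed.

End de_rham.

Theorem theorem4p4 (R : realType) (Omega : set 'rV[R]_2)
    (M : triangulation R) (L : edge_labelling M) (d : nat) :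
  triangulates M Omega -> (1 <= d)%N ->
  (simply_connected R (set_type Omega) ->
    [/\ injective (@const R M),
        ker_grad L d = range (@const R M),
        range_grad L d `<=` V1curl L d,
        ker_curl L d = range_grad L d
      & @curl R M @` V1curl L d = V2 d]) /\
  (exists b : nat,
    first_betti_number R (set_type Omega) b /\
    quotient_dim (ker_curl L d) (range_grad L d) b).
Proof.
move=> [[x xO] _ OmegaI _] d_gt0.
have OmegaE : Omega = inside M.
  rewrite OmegaI; apply/seteqP; split=> y yO; apply: filterS yO.
    by move=> z [T _ zT]; exists T.
  by move=> z [T zT]; exists T.
have [T0 _] : covered M x by apply: inside_covered; rewrite -OmegaE.
split=> [sc|].
  split.
  - exact: (const_injective T0).
  - exact: (ker_gradE L d OmegaE T0 sc).
  - by move=> v /range_grad_ker_curl[].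
  - exact: (ker_curl_exact L d OmegaE T0 sc).
  - exact: curl_surjective.
have [b bP] := curl_cohomology_finite L d OmegaE.
by exists b; split=> //; exact: (betti_number_cohomology OmegaE T0 bP).
Qed.
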